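(* Let $d\in\mathbb N$, $\alpha\ge0$, and let $f$ be a probability density on $\mathbb R^d$ satisfying (C1). Let $\mathcal X_n$ consist of $n$ independent random vectors with density $f$. Then as $n\to\infty$, $$ n^{(\alpha-d)/d}\mathcal N^{d,\alpha}(\mathcal X_n)\xrightarrow{L^2}\Gamma(1+\alpha/d)\left(v_d^{-\alpha/d}-\tfrac12 v_d\,\omega_d^{-1-\alpha/d}\right)\int_{\mathrm{supp}(f)}f(\mathbf x)^{(d-\alpha)/d}d\mathbf x. $$ In particular, with $\mathcal U_n$ consisting of $n$ independent uniform points on $(0,1)^d$: for $d=2$ and all $\alpha\ge0$, $$ n^{(\alpha-2)/2}\mathcal N^{2,\alpha}(\mathcal U_n)\xrightarrow{L^2}\Gamma(1+\alpha/2)\left(\pi^{-\alpha/2}-\frac{\pi}{2}\left(\frac{6}{8\pi+3\sqrt3}\right)^{1+\alpha/2}\right); $$ for $d=2$, $\alpha=1$, $n^{-1/2}\mathcal N^{2,1}(\mathcal U_n)\xrightarrow{L^2}\frac12-\frac14\left(\frac{6\pi}{8\pi+3\sqrt3}\right)^{3/2}$; and for $d=1$, $\alpha=1$, $\mathcal N^{1,1}(\mathcal U_n)\xrightarrow{L^2}7/18$.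
   Context: $\|\cdot\|$ is the Euclidean norm. The nearest-neighbour (undirected) graph on a finite $\mathcal X\subset\mathbb R^d$ has an undirected edge between $\mathbf x,\mathbf y\in\mathcal X$ iff $\mathbf y$ is the nearest neighbour of $\mathbf x$ in $\mathcal X\setminus\{\mathbf x\}$ or vice versa (an edge between mutual nearest neighbours is counted once). $\mathcal N^{d,\alpha}(\mathcal X)$ is its total power-weighted edge length $\sum_{\text{edges }\{\mathbf u,\mathbf v\}}\|\mathbf u-\mathbf v\|^\alpha$. $v_d=\pi^{d/2}/\Gamma(1+d/2)$ is the volume of the unit $d$-ball and $\omega_d$ is the volume of the union of two unit $d$-balls whose centres are at distance $1$. Condition (C1): $f$ is supported by a convex polyhedron in $\mathbb R^d$ and is bounded away from $0$ and $\infty$ on its support; $\mathrm{supp}(f)$ is its support. *)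

(* Defs.v *)
From HB Require Import structures.
From mathcomp Require Import all_boot all_order all_algebra.
From mathcomp Require Import all_classical all_reals all_analysis.
Set Implicit Arguments. Unset Strict Implicit. Unset Printing Implicit Defensive.
Import Order.TTheory GRing.Theory Num.Theory.
Import numFieldNormedType.Exports.
Local Open Scope classical_set_scope.
Local Open Scope ring_scope.

Section Defs.
Variable R : realType.

(* Points of R^d are d-tuples of reals; d.-tuple R carries the product
   (= Borel) sigma-algebra of mathcomp-analysis. *)

Definition edist (d : nat) (x y : d.-tuple R) : R :=
  Num.sqrt (\sum_(i < d) (tnth x i - tnth y i) ^+ 2).

Definition is_nn (d : nat) (s : seq (d.-tuple R)) (x y : d.-tuple R) : bool :=
  [&& y \in s, y != x & all (fun z => (z == x) || (edist x y <= edist x z)) s].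

Definition nn_edge (d : nat) (s : seq (d.-tuple R)) (x y : d.-tuple R) : bool :=
  is_nn s x y || is_nn s y x.

(* N^{d,alpha}(X) for the finite set X = {points of s}: sum over undirected
   edges {u,v} of |u-v|^alpha.  Summing over ordered pairs counts every
   undirected edge exactly twice, hence the factor 1/2. *)
Definition NN_weight (d : nat) (alpha : R) (s : seq (d.-tuple R)) : R :=
  let t := undup s in
  2^-1 * \sum_(x <- t) \sum_(y <- t | nn_edge t x y) (edist x y) `^ alpha.

(* the Lebesgue measure on R^d, characterised by its value on closed boxes
   (boxes form a pi-system generating the Borel sets, so this determines it) *)
Definition is_lebesgue (d : nat) (mu : {measure set (d.-tuple R) -> \bar R}) : Prop :=
  forall a b : d.-tuple R, (forall i, tnth a i <= tnth b i) ->
    mu [set x | forall i, tnth a i <= tnth x i <= tnth b i] =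
    (\prod_(i < d) (tnth b i - tnth a i))%:E.

Definition Gamma (s : R) : R :=
  fine (\int[lebesgue_measure]_(t in `]0%R, +oo[%classic)
          ((t `^ (s - 1)) * expR (- t))%:E)%E.

Definition vball (d : nat) : R :=
  pi `^ (d%:R / 2) / Gamma (1 + d%:R / 2).

Definition e1 (d : nat) : d.-tuple R := [tuple (if nat_of_ord i == 0%N then 1 else 0) | i < d].

Definition omega (d : nat) (mu : {measure set (d.-tuple R) -> \bar R}) : R :=
  fine (mu ([set x | edist x [tuple 0 | _ < d] <= 1] `|`
            [set x | edist x (e1 d) <= 1])).

(* (C1) with supp(f) = K: K is a convex polyhedron (a finite intersection of
   closed half-spaces), f vanishes outside K and c <= f <= C on K, 0 < c. *)
Definition convex_polyhedron (d : nat) (K : set (d.-tuple R)) : Prop :=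
  exists (m : nat) (a : 'I_m -> d.-tuple R) (b : 'I_m -> R),
    K = [set x | forall j, \sum_(i < d) tnth (a j) i * tnth x i <= b j].

Definition C1 (d : nat) (f : d.-tuple R -> R) (K : set (d.-tuple R)) : Prop :=
  convex_polyhedron K /\ (forall x, ~ K x -> f x = 0) /\
  exists c C : R, 0 < c /\ forall x, K x -> c <= f x <= C.

Definition prob_density (d : nat) (mu : {measure set (d.-tuple R) -> \bar R})
    (f : d.-tuple R -> R) : Prop :=
  measurable_fun setT f /\ (forall x, 0 <= f x) /\
  (\int[mu]_x (f x)%:E = 1)%E.

Definition iid_with_density (d : nat) (mu : {measure set (d.-tuple R) -> \bar R})
    (f : d.-tuple R -> R) (dO : measure_display) (O : measurableType dO)
    (P : probability O R) (X : nat -> O -> d.-tuple R) : Prop :=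
  (forall i, measurable_fun setT (X i)) /\
  (forall i (A : set (d.-tuple R)), measurable A ->
     P (X i @^-1` A) = (\int[mu]_(x in A) (f x)%:E)%E) /\
  (forall (s : seq nat) (A : nat -> set (d.-tuple R)), uniq s ->
     (forall i, measurable (A i)) ->
     P (\bigcap_(i in [set` s]) (X i @^-1` A i)) =
     (\big[*%E/1%E]_(i <- s) P (X i @^-1` A i))%E).

Definition sample (d : nat) (O : Type) (X : nat -> O -> d.-tuple R) (n : nat) (w : O)
  : seq (d.-tuple R) := [seq X i w | i <- iota 0 n].

Definition L2_cvg_const (dO : measure_display) (O : measurableType dO)
    (P : probability O R) (Y : nat -> O -> R) (c : R) : Prop :=
  ((fun n => \int[P]_w ((Y n w - c) ^+ 2)%:E) @ \oo --> 0)%E.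

End Defs.

(* Main.v *)
(* Off the null event of ties, a sample point y is the nearest neighbour of x exactly when
   the open ball around x through y contains no further sample point, and x, y are mutual
   nearest neighbours exactly when the union of the balls around x and y of radius |x - y|
   contains none.  Hence the total weight is T_0 - T_1 / 2, where T_b sums |x - y|^alpha over
   the ordered pairs of sample points whose region S_b(x, y) (one ball, or the union of two)
   is void.  Its mean is n (n - 1) J(n - 2) for
     J(m) = \int \int f(x) f(y) |x - y|^alpha (1 - F(S_b(x, y)))^m dx dy,
   and the substitution y = x + m^(-1/d) u, the L1 continuity of translations of f and the
   domination coming from F(ball(x, r)) >= const r^d on the bounded convex support show that
     m^(1 + alpha/d) J(m) -> \int \int f(x)^2 |u|^alpha exp(- f(x) kappa_b |u|^d) dx du,
   where kappa_b is v_d or omega_d; the limit is evaluated in polar coordinates.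
   For the second moment, two void events whose regions are far apart contribute at most
   n^4 J(n - 4)^2, since disjoint regions satisfy 1 - s - t <= (1 - s) (1 - t), whereas
   the pairs of edges near each other are negligible, being bounded by first moments with
   weights |x - y|^(2 alpha) and |x - y|^(2 alpha + d).  So the second moment of the rescaled
   T_b is asymptotically at most the square of the limit of its mean, which is L2
   convergence. *)
Require Import Defs.
From HB Require Import structures.
From mathcomp Require Import all_boot all_order all_algebra.
From mathcomp Require Import all_classical all_reals all_analysis.
From mathcomp Require Import measurable_realfun ring lra.
Import Order.TTheory GRing.Theory Num.Theory.
Import numFieldNormedType.Exports.
Set Implicit Arguments. Unset Strict Implicit. Unset Printing Implicit Defensive.
Local Open Scope classical_set_scope.
Local Open Scope ring_scope.
(* all_analysis exports another constant with this name. *)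
Local Notation edist := Defs.edist.

(** * Euclidean distance and boxes *)

(** The density is only measurable, so the local estimate that S_b(x, y) has probability about f(x)
    kappa_b |x - y|^d need not hold at every x. It holds on average over x: the error is at most an
    integral of |f(x + h) - f(x)| over h in the region, and Tonelli turns this into translation
    differences of f. This is why the limit is taken in L1 of x for each fixed u, with dominated
    convergence in u alone. Put a = 1 + alpha/d. The square of the mean of T_b has order n^(4 - 2a).
    A third point within a fixed multiple of an edge costs a factor |x - y|^d, so near pairs
    contribute n^3 n^(-2a), and coinciding pairs n^2 n^(1 - 2a): both are smaller by a factor n.
    Lebesgue measure is given through its values on boxes only. Its scaling comes from uniqueness on
    boxes. Its invariance under reflections, which makes omega_d independent of the direction
    between the centres, comes from the uniqueness of translation invariant measures up to a
    factor. *)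

Lemma sqrtr_measurable (R : realType) : measurable_fun setT (@Num.sqrt R).
Proof.
by apply: continuous_measurable_fun; exact: sqrt_continuous.
Qed.

Lemma indic_congr (R : realType) (T U : Type) (A : set T) (B : set U) x y :
  (A x <-> B y) -> \1_A x = \1_B y :> R.
Proof.
move=> AB; rewrite !indicE; have [h|h] := pselect (A x).
  by rewrite !mem_set//; exact/AB.
by rewrite !memNset// => /AB.
Qed.

Lemma indic_setI (R : realType) (T : Type) (A B : set T) x :
  \1_(A `&` B) x = \1_A x * \1_B x :> R.
Proof.
rewrite !indicE; have [hA|hA] := pselect (A x); have [hB|hB] := pselect (B x).
- by rewrite !mem_set// mulr1.
- by rewrite (memNset hB) memNset ?mulr0//; case.
- by rewrite (memNset hA) memNset ?mul0r//; case.
- by rewrite (memNset hA) memNset ?mul0r//; case.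
Qed.

Lemma indic_setC (R : realType) (T : Type) (A : set T) x :
  \1_(~` A) x = 1 - \1_A x :> R.
Proof.
rewrite !indicE; have [hA|hA] := pselect (A x).
  by rewrite (mem_set hA) subrr memNset//; exact.
by rewrite (memNset hA) subr0 mem_set.
Qed.

Lemma indic_setU (R : realType) (T : Type) (A B : set T) x :
  \1_(A `|` B) x = \1_A x + \1_B x - \1_(A `&` B) x :> R.
Proof.
rewrite -(setCK (A `|` B)) setCU indic_setC indic_setI !indic_setC indic_setI; ring.
Qed.

Section Edist.
Context (R : realType) (d : nat).
Implicit Types (x y z h : d.-tuple R).

Lemma edist_ge0 x y : 0 <= edist x y.
Proof. exact: sqrtr_ge0. Qed.

Lemma edist_sqr x y : edist x y ^+ 2 = \sum_(i < d) (tnth x i - tnth y i) ^+ 2.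
Proof. by rewrite sqr_sqrtr// sumr_ge0// => i _; rewrite sqr_ge0. Qed.

Lemma edistC x y : edist x y = edist y x.
Proof. by congr Num.sqrt; apply: eq_bigr => i _; rewrite -opprB sqrrN. Qed.

Lemma edistxx x : edist x x = 0.
Proof. by rewrite /edist big1 ?sqrtr0// => i _; rewrite subrr expr0n. Qed.

Lemma edist_eq0 x y : (edist x y == 0) = (x == y).
Proof.
apply/eqP/eqP => [e0|->]; last exact: edistxx.
have := edist_sqr x y; rewrite e0 expr0n => /esym/eqP.
rewrite psumr_eq0; last by move=> i _; rewrite sqr_ge0.
move=> /allP H; apply: eq_from_tnth => i.
by apply/eqP; rewrite -subr_eq0 -sqrf_eq0; apply: H; rewrite mem_index_enum.
Qed.

Lemma coord_edist x y i : `|tnth x i - tnth y i| <= edist x y.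
Proof.
rewrite -(@ler_pXn2r _ 2)// ?nnegrE ?normr_ge0 ?edist_ge0//.
rewrite edist_sqr real_normK ?num_real// (bigD1 i)//= lerDl.
by rewrite sumr_ge0// => j _; rewrite sqr_ge0.
Qed.

(** Lagrange's identity: the double sum of the squares (a_i b_j - a_j b_i)^2 is twice the gap in the
    Cauchy-Schwarz inequality. *)
Lemma sum_mul_sqr_le (I : finType) (a b : I -> R) :
  (\sum_i a i * b i) ^+ 2 <= (\sum_i a i ^+ 2) * (\sum_i b i ^+ 2).
Proof.
have H : 0 <= \sum_i \sum_j (a i * b j - a j * b i) ^+ 2.
  by do 2 (apply: sumr_ge0 => ? _); rewrite sqr_ge0.
have E : \sum_i \sum_j (a i * b j - a j * b i) ^+ 2 =
  2 * ((\sum_i a i ^+ 2) * (\sum_i b i ^+ 2)) - 2 * (\sum_i a i * b i) ^+ 2.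
  transitivity (\sum_i \sum_j (a i ^+ 2 * b j ^+ 2 + a j ^+ 2 * b i ^+ 2
     - 2 * ((a i * b i) * (a j * b j)))).
    by apply: eq_bigr => i _; apply: eq_bigr => j _; ring.
  under eq_bigr do rewrite sumrB big_split/= -!mulr_sumr -mulr_suml.
  rewrite sumrB big_split/= -!mulr_suml -mulr_sumr -mulr_sumr -mulr_suml.
  ring.
by move: H; rewrite E; lra.
Qed.

Lemma edist_triangle x y z : edist x z <= edist x y + edist y z.
Proof.
rewrite -(@ler_pXn2r _ 2)// ?nnegrE ?addr_ge0 ?edist_ge0//.
have -> : edist x z ^+ 2 = edist x y ^+ 2 + edist y z ^+ 2 +
  2 * \sum_(i < d) (tnth x i - tnth y i) * (tnth y i - tnth z i).
  rewrite !edist_sqr mulr_sumr -!big_split/=.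
  by apply: eq_bigr => i _; ring.
have := sum_mul_sqr_le (fun i => tnth x i - tnth y i) (fun i => tnth y i - tnth z i).
rewrite -!edist_sqr -exprMn => H.
have : \sum_(i < d) (tnth x i - tnth y i) * (tnth y i - tnth z i) <=
  edist x y * edist y z.
  have [h|h] := leP 0 (\sum_(i < d) (tnth x i - tnth y i) * (tnth y i - tnth z i)).
    by rewrite -(@ler_pXn2r _ 2)// nnegrE mulr_ge0// edist_ge0.
  by apply: (le_trans (ltW h)); rewrite mulr_ge0// edist_ge0.
by nra.
Qed.

(** The base point precedes the argument, so that [affine rho x u] is x + rho u, [affine 1 h] is the
    translation by h and [affine (-1) u v] is u - v. *)
Definition affine (c : R) h x : d.-tuple R :=
  [tuple c * tnth x i + tnth h i | i < d].

Definition origin : d.-tuple R := [tuple 0 | _ < d].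

Lemma tnth_affine c h x i : tnth (affine c h x) i = c * tnth x i + tnth h i.
Proof. by rewrite tnth_mktuple. Qed.

Lemma tnth_origin i : tnth origin i = 0.
Proof. by rewrite tnth_mktuple. Qed.

Lemma edist_affine c h x y : edist (affine c h x) (affine c h y) = `|c| * edist x y.
Proof.
rewrite /edist -sqrtr_sqr -sqrtrM ?sqr_ge0// mulr_sumr; congr Num.sqrt.
by apply: eq_bigr => i _; rewrite !tnth_affine; ring.
Qed.

Lemma affine_edist_translate c x u :
  edist x (affine c x u) = `|c| * edist origin u.
Proof.
rewrite /edist -sqrtr_sqr -sqrtrM ?sqr_ge0// mulr_sumr; congr Num.sqrt.
by apply: eq_bigr => i _; rewrite tnth_affine tnth_origin; ring.
Qed.

Lemma measurable_affine c h : measurable_fun setT (affine c h).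
Proof.
apply/measurable_fun_tnthP => i.
rewrite (_ : _ \o _ = fun x => c * tnth x i + tnth h i); last first.
  by apply/funext => x /=; rewrite tnth_affine.
apply: measurable_funD => //; apply: measurable_funM => //; exact: measurable_tnth.
Qed.

End Edist.

Lemma measurable_edist (R : realType) d (dO : measure_display)
    (O : measurableType dO) (f g : O -> d.-tuple R) :
  measurable_fun setT f -> measurable_fun setT g ->
  measurable_fun setT (fun w => edist (f w) (g w)).
Proof.
move=> mf mg; rewrite /edist.
apply: (measurableT_comp (@sqrtr_measurable R)).
apply: measurable_sum => i.
apply: measurable_funX; apply: measurable_funB.
  exact: (measurableT_comp (measurable_tnth i)).
exact: (measurableT_comp (measurable_tnth i)).
Qed.

Lemma measurable_affine2 (R : realType) d c (dO : measure_display)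
    (O : measurableType dO) (f g : O -> d.-tuple R) :
  measurable_fun setT f -> measurable_fun setT g ->
  measurable_fun setT (fun w => affine c (f w) (g w)).
Proof.
move=> mf mg; apply/measurable_fun_tnthP => i.
rewrite (_ : _ \o _ = fun x => c * tnth (g x) i + tnth (f x) i); last first.
  by apply/funext => x /=; rewrite tnth_affine.
apply: measurable_funD; last exact: (measurableT_comp (measurable_tnth i)).
by apply: measurable_funM => //; exact: (measurableT_comp (measurable_tnth i)).
Qed.

Section ImageMeasure.
Local Open Scope ereal_scope.
Context d1 d2 (T1 : measurableType d1) (T2 : measurableType d2) (R : realType).
Variables (m : {measure set T1 -> \bar R}) (phi : T1 -> T2).
Hypothesis mphi : measurable_fun setT phi.

(** The measurability proof is an argument of the definition, so that the measure structure can be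
    attached to the term itself. *)
Definition image_measure of measurable_fun setT phi := pushforward m phi.

Let im0 : image_measure mphi set0 = 0.
Proof. by rewrite /image_measure /pushforward preimage_set0 measure0. Qed.

Let im_ge0 A : 0 <= image_measure mphi A.
Proof. exact: measure_ge0. Qed.

Let im_sadd : semi_sigma_additive (image_measure mphi).
Proof.
move=> F mF tF mUF; rewrite /image_measure /pushforward preimage_bigcup.
apply: measure_semi_sigma_additive.
- by move=> n; rewrite -[X in measurable X]setTI; exact: mphi.
- apply/trivIsetP => /= i j _ _ ij; rewrite -preimage_setI.
  by move/trivIsetP : tF => /(_ _ _ _ _ ij) ->//; rewrite preimage_set0.
- by rewrite -preimage_bigcup -[X in measurable X]setTI; exact: mphi.
Qed.

HB.instance Definition _ := isMeasure.Build _ _ _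
  (image_measure mphi) im0 im_ge0 im_sadd.

End ImageMeasure.

Lemma measurable_preimage d1 d2 (T1 : measurableType d1) (T2 : measurableType d2)
  (f : T1 -> T2) A : measurable_fun setT f -> measurable A -> measurable (f @^-1` A).
Proof. by move=> mf mA; rewrite -[X in measurable X]setTI; exact: mf. Qed.

Section Boxes.
Context (R : realType) (d : nat).
Local Notation T := (d.-tuple R).

Definition box (a b : T) : set T := [set x | forall i, tnth a i <= tnth x i <= tnth b i].

Definition boxes : set (set T) :=
  [set A | A = set0 \/ exists a b, (forall i, tnth a i <= tnth b i) /\ A = box a b].

Lemma boxes_setI : setI_closed boxes.
Proof.
move=> A B [->|[a [b [ab ->]]]]; first by rewrite set0I; left.
case=> [->|[a' [b' [ab' ->]]]]; first by rewrite setI0; left.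
pose a2 : T := [tuple Num.max (tnth a i) (tnth a' i) | i < d].
pose b2 : T := [tuple Num.min (tnth b i) (tnth b' i) | i < d].
have E : box a b `&` box a' b' = box a2 b2.
  apply/seteqP; split => x /=.
    move=> [H H'] i; rewrite !tnth_mktuple ge_max le_min.
    by move: (H i) (H' i) => /andP[-> ->] /andP[-> ->].
  move=> H; split=> i; move: (H i); rewrite !tnth_mktuple ge_max le_min;
    by case/andP=> /andP[? ?] /andP[? ?]; apply/andP.
rewrite E; have [ab2|ab2] := pselect (forall i, tnth a2 i <= tnth b2 i).
  by right; exists a2, b2.
left; apply/seteqP; split => x //= H; apply: ab2 => i.
by have /andP[h1 h2] := H i; exact: le_trans h2.
Qed.

Definition cbox (k : nat) : set T := box [tuple - k%:R | _ < d] [tuple k%:R | _ < d].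

Lemma cbox_boxes k : boxes (cbox k).
Proof.
right; do 2 eexists; split; last by [].
by move=> i; rewrite !tnth_mktuple; have : 0 <= k%:R :> R by []; lra.
Qed.

Lemma cbox_nd k l : (k <= l)%N -> cbox k `<=` cbox l.
Proof.
move=> kl x H i; move: (H i); rewrite !tnth_mktuple.
have : k%:R <= l%:R :> R by rewrite ler_nat.
by move=> kl'; case/andP=> ? ?; apply/andP; split; lra.
Qed.

Lemma cbox_cover : \bigcup_k (cbox k) = setT.
Proof.
apply/seteqP; split => // x _.
pose M := \sum_(i < d) `|tnth x i|.
have M0 : 0 <= M by apply: sumr_ge0.
exists (Num.Def.truncn M).+1 => // i; rewrite !tnth_mktuple.
have : `|tnth x i| <= M by rewrite /M (bigD1 i)//= lerDl sumr_ge0.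
have : M < (Num.Def.truncn M).+1%:R by rewrite truncnS_gt.
by rewrite -ler_norml => h1 h2; apply: (le_trans h2); exact: ltW.
Qed.

Lemma measurable_box a b : measurable (box a b).
Proof.
rewrite /box (_ : [set _ | _] = \bigcap_(i in [set: 'I_d])
  ((fun x : T => tnth x i) @^-1` `[tnth a i, tnth b i]%classic)); last first.
  apply/seteqP; split => x /= H i; first by move=> _ /=; rewrite in_itv/= H.
  by have := H i I; rewrite /= in_itv.
apply: fin_bigcap_measurable => // i _.
apply: measurable_preimage => //; exact: measurable_tnth.
Qed.

Lemma measurable_boxes : @measurable _ T = <<s boxes >>.
Proof.
apply/seteqP; split; last first.
  apply: smallest_sub; first exact: sigma_algebra_measurable.
  by move=> A [->//|[a [b [_ ->]]]]; exact: measurable_box.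
pose S := g_sigma_algebraType boxes.
have mid : measurable_fun [set: S] (fun x : S => (x : T)).
  apply/measurable_fun_tnthP => i.
  apply: (measurability _ (RGenCInfty.measurableE R)).
  move=> _ [_ [r ->] <-]; rewrite setTI.
  (* A closed half-space is an increasing union of boxes. Adding |r| to the upper corner keeps it
     above r, so that each box is nonempty. *)
  have -> : (@tnth d R ^~ i \o (fun x : S => (x : T))) @^-1` `[r, +oo[%classic =
    \bigcup_k (box [tuple if j == i then r else - k%:R | j < d]
                  [tuple k%:R + `|r| | j < d]).
    apply/seteqP; split => x /=.
      rewrite in_itv/= andbT => rx.
      have : [set: T] x by []. rewrite -cbox_cover => -[k _ H]; exists k => // j.
      have := H j; rewrite !tnth_mktuple => /andP[h1 h2].
      have : 0 <= `|r| by []. move=> r0.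
      case: (eqVneq j i) => [eji|_].
        rewrite eji in h1 h2 *; rewrite rx/=; lra.
      apply/andP; split; first lra. by lra.
    by move=> [k _ /(_ i)]; rewrite !tnth_mktuple eqxx in_itv/= andbT => /andP[].
  apply: bigcupT_measurable => k; apply: sub_sigma_algebra.
  have [h|h] := pselect (r <= k%:R + `|r|); last first.
    by exfalso; apply: h; have := ler_norm r; have : 0 <= k%:R :> R by []; lra.
  right; do 2 eexists; split; last by [].
  move=> j; rewrite !tnth_mktuple; case: ifP => // _.
  have : 0 <= `|r| by []. have : 0 <= k%:R :> R by []. by lra.
move=> A mA; have := mid measurableT A mA; by rewrite setTI.
Qed.

Lemma box_measure_unique (m1 m2 : {measure set T -> \bar R}) :
  (forall a b, (forall i, tnth a i <= tnth b i) -> m1 (box a b) = m2 (box a b)) ->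
  (forall a b, (forall i, tnth a i <= tnth b i) -> (m1 (box a b) < +oo)%E) ->
  forall A, measurable A -> m1 A = m2 A.
Proof.
move=> h1 h2 A mA; apply: (measure_unique boxes cbox) => //.
- exact: measurable_boxes.
- exact: boxes_setI.
- exact: cbox_boxes.
- exact: cbox_cover.
- by move=> B [->|[a [b [ab ->]]]]; [rewrite !measure0|exact: h1].
- move=> k; case: (cbox_boxes k) => [->|[a [b [ab ->]]]]; first by rewrite measure0.
  exact: h2.
Qed.

End Boxes.

(** * Tonelli, densities and Lebesgue measure on tuples *)

Section RealIntegrands.
Context d (T : measurableType d) (R : realType) (m : {measure set T -> \bar R}).
Implicit Types f g : T -> R.

Lemma ge0_integral_addE f g : measurable_fun setT f -> measurable_fun setT g ->
  (forall x, 0 <= f x) -> (forall x, 0 <= g x) ->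
  (\int[m]_x (f x + g x)%:E = \int[m]_x (f x)%:E + \int[m]_x (g x)%:E)%E.
Proof.
move=> mf mg f0 g0; under eq_integral do rewrite EFinD.
by rewrite ge0_integralD//; [move=> x _; rewrite lee_fin|exact/measurable_EFinP|
  move=> x _; rewrite lee_fin|exact/measurable_EFinP].
Qed.

Lemma ge0_integral_scaleE (k : R) f : measurable_fun setT f ->
  (forall x, 0 <= f x) -> 0 <= k ->
  (\int[m]_x (k * f x)%:E = k%:E * \int[m]_x (f x)%:E)%E.
Proof.
move=> mf f0 k0; under eq_integral do rewrite EFinM.
by rewrite ge0_integralZl//; [exact/measurable_EFinP|move=> x _; rewrite lee_fin].
Qed.

Lemma ge0_integral_leE f g : measurable_fun setT f -> measurable_fun setT g ->
  (forall x, 0 <= f x) -> (forall x, f x <= g x) ->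
  (\int[m]_x (f x)%:E <= \int[m]_x (g x)%:E)%E.
Proof.
move=> mf mg f0 fg; apply: ge0_le_integral => //.
- by move=> x _; rewrite lee_fin.
- exact/measurable_EFinP.
- exact/measurable_EFinP.
- by move=> x _; rewrite lee_fin.
Qed.

End RealIntegrands.

Section SigmaFiniteAlias.
Context d (T : measurableType d) (R : realType) (m : {measure set T -> \bar R}).
Hypothesis s : sigma_finite setT m.

(** A copy of m whose type mentions the hypothesis s, which lets the structure of sigma-finite
    measures be inferred for it. *)
Definition sigma_finite_alias of sigma_finite setT m : set T -> \bar R := m.

HB.instance Definition _ := isMeasure.Build _ _ _ (sigma_finite_alias s)
  (measure0 m) (measure_ge0 m) (@measure_semi_sigma_additive _ _ _ m).

HB.instance Definition _ := Measure_isSigmaFinite.Build _ _ _ (sigma_finite_alias s) s.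

End SigmaFiniteAlias.

Section TonelliSigmaFinite.
Local Open Scope ereal_scope.
Context d1 d2 (T1 : measurableType d1) (T2 : measurableType d2) (R : realType).
Variables (m1 : {measure set T1 -> \bar R}) (m2 : {measure set T2 -> \bar R}).
Hypotheses (s1 : sigma_finite setT m1) (s2 : sigma_finite setT m2).
Let M1 : {sigma_finite_measure set T1 -> \bar R} := sigma_finite_alias s1.
Let M2 : {sigma_finite_measure set T2 -> \bar R} := sigma_finite_alias s2.

Lemma tonelli_exchange (f : T1 * T2 -> \bar R) :
  measurable_fun setT f -> (forall x, 0 <= f x) ->
  \int[m1]_x \int[m2]_y f (x, y) = \int[m2]_y \int[m1]_x f (x, y).
Proof. exact: (@fubini_tonelli _ _ _ _ _ M1 M2). Qed.

Lemma measurable_integral_snd (f : T1 * T2 -> \bar R) :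
  measurable_fun setT f -> (forall x, 0 <= f x) ->
  measurable_fun setT (fun x => \int[m2]_y f (x, y)).
Proof. exact: (@measurable_fun_fubini_tonelli_F _ _ _ _ _ M2). Qed.

Lemma sigma_finite_product_unique (m' : {measure set (T1 * T2) -> \bar R}) :
  (forall A B, measurable A -> measurable B -> m' (A `*` B) = m1 A * m2 B) ->
  forall f : T1 * T2 -> \bar R, measurable_fun setT f -> (forall x, 0 <= f x) ->
  \int[m']_z f z = \int[m1]_x \int[m2]_y f (x, y).
Proof.
move=> H f mf f0; rewrite -[RHS](@fubini_tonelli1 _ _ _ _ _ M1 M2)//.
apply: (@eq_measure_integral _ _ _ _ (product_measure1 M1 M2)) => A mA _.
by apply/esym; apply: product_measure_unique.
Qed.

Lemma measurable_section_measure (A : set (T1 * T2)) : measurable A ->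
  measurable_fun setT (fun x => m2 [set y | A (x, y)]).
Proof.
move=> mA.
rewrite (_ : (fun x => _) = (fun x => \int[m2]_y (\1_A (x, y))%:E)).
  apply: (measurable_integral_snd (f := fun z => (\1_A z)%:E)) => //.
  by apply/measurable_EFinP; exact: measurable_indic.
apply/funext => x.
rewrite (_ : (fun y => _) = (fun y => (\1_[set y | A (x, y)] y)%:E)); last first.
  by apply/funext => y; congr EFin; exact: indic_congr.
rewrite integral_indic// ?setIT//.
exact: (@measurable_preimage _ _ _ _ (pair x) A).
Qed.

End TonelliSigmaFinite.

Lemma ge0_change_variables d1 d2 (T1 : measurableType d1) (T2 : measurableType d2)
    (R : realType) (m1 : {measure set T1 -> \bar R}) (m2 : {measure set T2 -> \bar R})
    (phi : T1 -> T2) (k : R) (f : T2 -> \bar R) :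
  (0 <= k)%R -> measurable_fun setT phi ->
  (forall A, measurable A -> m1 (phi @^-1` A) = k%:E * m2 A)%E ->
  measurable_fun setT f -> (forall x, 0 <= f x)%E ->
  (\int[m1]_x f (phi x) = k%:E * \int[m2]_y f y)%E.
Proof.
move=> k0 mphi H mf f0.
rewrite -(@ge0_integral_mscale _ _ _ m2 setT measurableT (NngNum k0) f)//.
rewrite -[LHS](@ge0_integral_pushforward _ _ _ _ _ phi mphi m1 setT f)//.
by apply: (@eq_measure_integral _ _ _ _ _ (image_measure m1 mphi)) => A mA _; rewrite /mscale/= /image_measure /pushforward H.
Qed.

(* Layer cake: g(x) is the length of [0, g(x)[, so Tonelli reduces the identity to the
   indicators of the superlevel sets of g. *)
Lemma ge0_integral_density d (T : measurableType d) (R : realType)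
    (m1 m2 : {measure set T -> \bar R}) (h g : T -> R) :
  sigma_finite setT m1 -> sigma_finite setT m2 ->
  measurable_fun setT h -> (forall x, 0 <= h x) ->
  measurable_fun setT g -> (forall x, 0 <= g x) ->
  (forall A, measurable A -> m2 A = \int[m1]_(x in A) (h x)%:E)%E ->
  (\int[m2]_x (g x)%:E = \int[m1]_x (g x * h x)%:E)%E.
Proof.
move=> s1 s2 mh h0 mg g0 H.
pose D : set (T * R) := [set z | 0 <= z.2 < g z.1].
have mD : measurable D.
  have -> : D = [set z : T * R | 0 <= z.2] `&` [set z | z.2 < g z.1].
    by apply/seteqP; split => z; rewrite /D/= => /andP.
  apply: measurableI.
    rewrite (_ : [set _ | _] = snd @^-1` `[0, +oo[%classic).
      exact: measurable_preimage.
    by apply/seteqP; split => z; rewrite /= in_itv/= andbT.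
  rewrite (_ : [set _ | _] = (fun z : T * R => g z.1 - z.2) @^-1` `]0, +oo[%classic).
    apply: measurable_preimage => //; apply: measurable_funB => //.
    exact: measurableT_comp.
  by apply/seteqP; split => z; rewrite /= in_itv/= andbT subr_gt0.
have sl := @sigma_finiteT _ _ _ (@lebesgue_measure R).
have LC x : (\int[lebesgue_measure]_t (\1_D (x, t))%:E = (g x)%:E)%E.
  rewrite (_ : (fun t => _) = (fun t => (\1_`[0%R, g x[%classic t)%:E)); last first.
    apply/funext => t; congr EFin; exact: indic_congr.
  rewrite integral_indic// setIT [LHS](lebesgue_measure_itv `[0%R, g x[)/= lte_fin.
  by have := g0 x; rewrite le_eqVlt => /predU1P[<-|->]; rewrite ?ltxx// sube0.
have mI : measurable_fun setT (fun z : T * R => (\1_D z)%:E : \bar R).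
  by apply/measurable_EFinP; exact: measurable_indic.
under eq_integral do rewrite -LC.
rewrite (tonelli_exchange s2 sl (f := fun z => (\1_D z)%:E))//.
transitivity (\int[lebesgue_measure]_t \int[m1]_x ((h x)%:E * (\1_D (x, t))%:E))%E.
  apply: eq_integral => t _.
  have mDt : measurable [set x | D (x, t)].
    by apply: (@measurable_preimage _ _ _ _ (fun x => (x, t)) D).
  have ED x : \1_D (x, t) = \1_[set x | D (x, t)] x :> R.
    exact: indic_congr.
  under eq_integral do rewrite ED.
  rewrite integral_indic// setIT H// integral_mkcond.
  apply: eq_integral => x _; rewrite ED patchE indicE.
  by case: ifP => _; rewrite ?mule1 ?mule0.
rewrite -(tonelli_exchange s1 sl (f := fun z => ((h z.1)%:E * (\1_D z)%:E)%E))//; last 2 first.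
- by apply: emeasurable_funM => //; apply/measurable_EFinP; exact: measurableT_comp.
- by move=> z; rewrite -EFinM lee_fin mulr_ge0.
apply: eq_integral => x _ /=; rewrite ge0_integralZl//.
- by rewrite LC -EFinM mulrC.
- exact: (measurableT_comp mI).
- by rewrite lee_fin.
Qed.

Section Lebesgue.
Context (R : realType) (d : nat).
Local Notation T := (d.-tuple R).
Implicit Types (mu nu : {measure set T -> \bar R}) (A B : set T) (x y h u : T).

Lemma lebesgue_box mu a b : is_lebesgue mu -> (forall i, tnth a i <= tnth b i) ->
  mu (box a b) = (\prod_(i < d) (tnth b i - tnth a i))%:E.
Proof. by move=> H ab; rewrite -H. Qed.

Lemma lebesgue_unique mu nu : is_lebesgue mu -> is_lebesgue nu ->
  forall A, measurable A -> mu A = nu A.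
Proof.
move=> Hm Hn; apply: box_measure_unique => a b ab.
  by rewrite !lebesgue_box.
by rewrite lebesgue_box// ltry.
Qed.

Lemma lebesgue_cbox mu k : is_lebesgue mu -> (mu (@cbox R d k) < +oo)%E.
Proof.
move=> H; case: (@cbox_boxes R d k) => [->|[a [b [ab ->]]]].
  by rewrite measure0.
by rewrite lebesgue_box// ltry.
Qed.

Lemma measurable_cbox k : measurable (@cbox R d k).
Proof. exact: measurable_box. Qed.

Lemma lebesgue_sigma_finite mu : is_lebesgue mu -> sigma_finite setT mu.
Proof.
move=> H; exists (@cbox R d); first by rewrite cbox_cover.
by move=> k; split; [exact: measurable_cbox|exact: lebesgue_cbox].
Qed.

(** Boxes pull back to boxes, with the two corners exchanged when c is negative; uniqueness on boxes
    does the rest. *)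
Lemma lebesgue_affine mu c h A : is_lebesgue mu -> c != 0 -> measurable A ->
  mu (affine c h @^-1` A) = ((`|c| ^- d)%:E * mu A)%E.
Proof.
move=> H c0 mA.
have k0 : 0 <= `|c| ^- d by rewrite invr_ge0 exprn_ge0.
have E a b : (forall i, tnth a i <= tnth b i) ->
    mu (affine c h @^-1` box a b) = ((`|c| ^- d)%:E * mu (box a b))%E.
  move=> ab.
  (* The preimages of the corners a (for true) and b (for false). The sign of c decides which of
     them is the lower corner. *)
  pose lo (s : bool) := [tuple ((if s then tnth a i else tnth b i) - tnth h i) / c | i < d].
  have cs : (0 < c) \/ (c < 0) by case: (ltrgtP 0 c) c0 => //; [left|right].
  have P : affine c h @^-1` box a b = box (lo (0 < c)) (lo (~~ (0 < c))).
    apply/seteqP; split => x /= Hx i; move: (Hx i); rewrite tnth_affine !tnth_mktuple.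
      case: cs => cs; rewrite ?cs/=; rewrite ?(lt_gtF cs)/=.
        by rewrite ler_pdivrMr// ler_pdivlMr//; case/andP=> ? ?; apply/andP; split; lra.
      by rewrite ler_ndivrMr// ler_ndivlMr//; case/andP=> ? ?; apply/andP; split; lra.
    case: cs => cs; rewrite ?cs/=; rewrite ?(lt_gtF cs)/=.
      by rewrite ler_pdivrMr// ler_pdivlMr//; case/andP=> ? ?; apply/andP; split; lra.
    by rewrite ler_ndivrMr// ler_ndivlMr//; case/andP=> ? ?; apply/andP; split; lra.
  rewrite P !lebesgue_box//; last first.
    move=> i; rewrite !tnth_mktuple; have := ab i.
    case: cs => cs; rewrite ?cs/=; rewrite ?(lt_gtF cs)/= => abi.
      by rewrite ler_pdivrMr// divfK//; lra.
    by rewrite ler_ndivrMr// divfK//; lra.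
  rewrite -EFinM; congr EFin.
  rewrite -[X in `|c| ^- X]card_ord -exprVn -prodr_const -big_split/=.
  apply: eq_bigr => i _; rewrite !tnth_mktuple.
  case: cs => cs; rewrite ?cs/=; rewrite ?(lt_gtF cs)/=.
    by rewrite gtr0_norm//; field.
  by rewrite ltr0_norm//; field.
pose m2 := mscale (NngNum k0) mu.
apply: (box_measure_unique (m1 := image_measure mu (measurable_affine c h))
  (m2 := m2)) mA => a b ab; first exact: E.
have := E _ _ ab; rewrite lebesgue_box// -EFinM => Eab.
by rewrite [X in (X < _)%E]Eab ltry.
Qed.

Lemma lebesgue_translate mu h A : is_lebesgue mu -> measurable A ->
  mu (affine 1 h @^-1` A) = mu A.
Proof. by move=> H mA; rewrite lebesgue_affine ?oner_neq0// normr1 expr1n invr1 mul1e. Qed.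

Lemma lebesgue_integral_affine mu c h (f : T -> \bar R) : is_lebesgue mu -> c != 0 ->
  measurable_fun setT f -> (forall x, 0 <= f x)%E ->
  (\int[mu]_x f (affine c h x) = (`|c| ^- d)%:E * \int[mu]_y f y)%E.
Proof.
move=> H c0 mf f0; apply: ge0_change_variables => //.
- exact: measurable_affine.
- by move=> A mA; exact: lebesgue_affine.
Qed.

Lemma lebesgue_integral_translate mu h (f : T -> \bar R) : is_lebesgue mu ->
  measurable_fun setT f -> (forall x, 0 <= f x)%E ->
  (\int[mu]_x f (affine 1 h x) = \int[mu]_y f y)%E.
Proof.
by move=> H mf f0; rewrite lebesgue_integral_affine ?oner_neq0// normr1 expr1n invr1 mul1e.
Qed.

(* Both sides are the integral of 1_A(y - x) 1_B(y), computed in the two orders. *)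
Lemma translation_invariant_unique mu nu A B : is_lebesgue mu ->
  sigma_finite setT nu ->
  (forall h C, measurable C -> nu (affine 1 h @^-1` C) = nu C) ->
  measurable A -> measurable B -> (nu A * mu B = mu A * nu B)%E.
Proof.
move=> Hm snu Hn mA mB.
have mI C : measurable C -> measurable_fun setT (fun x : T => (\1_C x)%:E : \bar R).
  by move=> mC; apply/measurable_EFinP; exact: measurable_indic.
have I0 (C D : set T) (x y : T) : (0 <= (\1_C x)%:E * (\1_D y)%:E :> \bar R)%E.
  by rewrite -EFinM lee_fin mulr_ge0.
have smu := lebesgue_sigma_finite Hm.
have nuI (f : T -> \bar R) h : measurable_fun setT f -> (forall x, 0 <= f x)%E ->
    (\int[nu]_x f (affine 1 h x) = \int[nu]_y f y)%E.
  move=> mf f0; rewrite (@ge0_change_variables _ _ _ _ _ nu nu (affine 1 h) 1 f)//.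
  - by rewrite mul1e.
  - exact: measurable_affine.
  - by move=> C mC; rewrite Hn// mul1e.
have mAB c : measurable_fun setT
    (fun z : T * T => ((\1_A (affine c z.1 z.2))%:E * (\1_B z.1)%:E)%E : \bar R).
  apply: emeasurable_funM.
    apply: (measurableT_comp (f := fun x => (\1_A x)%:E)); first exact: mI.
    exact: measurable_affine2.
  by apply: (measurableT_comp (f := fun x => (\1_B x)%:E)); first exact: mI.
have mAB' : measurable_fun setT
    (fun z : T * T => ((\1_A z.1)%:E * (\1_B (affine 1 z.1 z.2))%:E)%E : \bar R).
  apply: emeasurable_funM; first by apply: (measurableT_comp (f := fun x => (\1_A x)%:E)); first exact: mI.
  apply: (measurableT_comp (f := fun x => (\1_B x)%:E)); first exact: mI.
  exact: measurable_affine2.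
transitivity (\int[nu]_y \int[mu]_x ((\1_A y)%:E * (\1_B (affine 1 y x))%:E))%E.
  transitivity (\int[nu]_y ((\1_A y)%:E * mu B))%E.
    rewrite ge0_integralZr//; last exact: mI.
    by rewrite integral_indic// setIT.
  apply: eq_integral => y _; rewrite ge0_integralZl//; last first.
    apply: (measurableT_comp (f := fun x => (\1_B x)%:E)); first exact: mI.
    exact: measurable_affine.
  by rewrite (lebesgue_integral_translate y Hm (mI _ mB))// integral_indic// setIT.
rewrite (tonelli_exchange snu smu (f := fun z : T * T =>
  ((\1_A z.1)%:E * (\1_B (affine 1 z.1 z.2))%:E)%E))//.
transitivity (\int[mu]_x \int[nu]_y ((\1_A (affine (-1) y x))%:E * (\1_B y)%:E))%E.
  apply: eq_integral => x _.
  have g0 (y : T) : (0 <= (\1_A (affine (-1) y x))%:E * (\1_B y)%:E :> \bar R)%E by [].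
  rewrite -[RHS](nuI _ x _ g0); last first.
    apply: emeasurable_funM; last exact: mI.
    apply: (measurableT_comp (f := fun x => (\1_A x)%:E)); first exact: mI.
    exact: measurable_affine2.
  apply: eq_integral => y _; congr ((\1_A _)%:E * (\1_B _)%:E)%E.
    by apply: eq_from_tnth => i; rewrite !tnth_affine; ring.
  by apply: eq_from_tnth => i; rewrite !tnth_affine; ring.
rewrite -(tonelli_exchange snu smu (f := fun z : T * T =>
  ((\1_A (affine (-1) z.1 z.2))%:E * (\1_B z.1)%:E)%E))//.
transitivity (\int[nu]_y (mu A * (\1_B y)%:E))%E; last first.
  by rewrite ge0_integralZl// ?integral_indic ?setIT//; exact: mI.
apply: eq_integral => y _ /=; rewrite ge0_integralZr//; last first.
  apply: (measurableT_comp (f := fun x => (\1_A x)%:E)); first exact: mI.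
  exact: measurable_affine.
congr (_ * _)%E.
rewrite (lebesgue_integral_affine y Hm _ (mI _ mA))//.
  by rewrite normrN1 expr1n invr1 mul1e integral_indic// setIT.

Qed.

End Lebesgue.

(** * Isometries, balls and void regions *)

Section Householder.
Context (R : realType) (d : nat).
Local Notation T := (d.-tuple R).
Implicit Types (w x y h u : T).

Definition dotp x y : R := \sum_(i < d) tnth x i * tnth y i.

Definition hcoef w x : R := 2 * dotp w x / dotp w w.

(** The reflection in the hyperplane orthogonal to w, for w nonzero. Reflections already act
    transitively on unit vectors, which is all the rotational symmetry that omega_d calls for. *)
Definition householder w x : T := [tuple tnth x i - hcoef w x * tnth w i | i < d].

Lemma tnth_householder w x i :
  tnth (householder w x) i = tnth x i - hcoef w x * tnth w i.
Proof. by rewrite tnth_mktuple. Qed.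

Lemma hcoefD w h x : hcoef w (affine 1 h x) = hcoef w x + hcoef w h.
Proof.
rewrite /hcoef -mulrDl -mulrDr; congr (2 * _ / _).
rewrite /dotp -big_split/=; apply: eq_bigr => i _.
by rewrite tnth_affine mul1r mulrDr.
Qed.

Lemma hcoef_householder w x : dotp w w != 0 ->
  hcoef w (householder w x) = - hcoef w x.
Proof.
move=> w0.
have -> : hcoef w (householder w x) =
    2 * (dotp w x - hcoef w x * dotp w w) / dotp w w.
  congr (2 * _ / _); rewrite /dotp mulr_sumr -sumrB.
  by apply: eq_bigr => i _; rewrite tnth_householder; ring.
by rewrite /hcoef; field.
Qed.

Lemma edist_householder w x y : dotp w w != 0 ->
  edist (householder w x) (householder w y) = edist x y.
Proof.
move=> w0; congr Num.sqrt.
pose k := hcoef w x - hcoef w y.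
have E : \sum_(i < d) tnth w i * (tnth x i - tnth y i) = k / 2 * dotp w w.
  transitivity (dotp w x - dotp w y).
    by rewrite /dotp -sumrB; apply: eq_bigr => i _; rewrite mulrBr.
  by rewrite /k /hcoef; field.
transitivity (\sum_(i < d) ((tnth x i - tnth y i) ^+ 2
  - 2 * k * (tnth w i * (tnth x i - tnth y i)) + k ^+ 2 * (tnth w i * tnth w i))).
  by apply: eq_bigr => i _; rewrite !tnth_householder /k; ring.
by rewrite big_split sumrB/= -!mulr_sumr E -/(dotp w w); field.
Qed.

(** A reflection conjugates translations into translations; hence the image of Lebesgue measure
    under it is again translation invariant. *)
Lemma householder_affine w h x : dotp w w != 0 ->
  affine 1 h (householder w x) = householder w (affine 1 (householder w h) x).
Proof.
move=> w0; apply: eq_from_tnth => i.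
rewrite !(tnth_affine, tnth_householder) hcoefD hcoef_householder//; ring.
Qed.

Lemma measurable_householder w : measurable_fun setT (householder w).
Proof.
apply/measurable_fun_tnthP => i.
rewrite (_ : _ \o _ = fun x => tnth x i - hcoef w x * tnth w i); last first.
  by apply/funext => x /=; rewrite tnth_householder.
apply: measurable_funB; first exact: measurable_tnth.
apply: measurable_funM => //; apply: measurable_funM => //; apply: measurable_funM => //.
by apply: measurable_sum => j; apply: measurable_funM => //; exact: measurable_tnth.
Qed.

Lemma edist_origin x : edist (origin R d) x = Num.sqrt (dotp x x).
Proof.
congr Num.sqrt; apply: eq_bigr => i _; rewrite tnth_origin; ring.
Qed.

Lemma dotp_eq0 w : dotp w w = 0 -> w = origin R d.
Proof.
by move=> w0; apply/esym/eqP; rewrite -edist_eq0 edist_origin w0 sqrtr0.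
Qed.

Lemma householder_origin w : householder w (origin R d) = origin R d.
Proof.
apply: eq_from_tnth => i; rewrite tnth_householder /hcoef /dotp big1 ?tnth_origin.
  by rewrite !(mulr0, mul0r) subr0.
by move=> j _; rewrite tnth_origin mulr0.
Qed.

(* The reflection in the hyperplane bisecting u and v exchanges the two unit vectors. *)
Lemma householder_swap u v : dotp u u = 1 -> dotp v v = 1 -> u != v ->
  let w := affine (-1) u v in dotp w w != 0 /\ householder w v = u.
Proof.
move=> u1 v1 uv w.
have ww : dotp w w = 2 - 2 * dotp u v.
  transitivity (dotp u u + dotp v v - 2 * dotp u v); last by rewrite u1 v1; ring.
  rewrite /dotp mulr_sumr -big_split -sumrB/=.
  by apply: eq_bigr => i _; rewrite tnth_affine; ring.
have wv : dotp w v = dotp u v - 1.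
  rewrite -v1 /dotp -sumrB.
  by apply: eq_bigr => i _; rewrite tnth_affine; ring.
have w0 : dotp w w != 0.
  apply: contra uv => /eqP /dotp_eq0 w0; apply/eqP.
  apply: eq_from_tnth => i; have := tnth_affine (-1) u v i.
  by rewrite -/w w0 tnth_origin; lra.
split=> //; apply: eq_from_tnth => i.
rewrite tnth_householder /hcoef wv ww.
have w0' : 1 - dotp u v != 0.
  by apply: contra w0 => /eqP h; rewrite ww -(mulr1 2) -mulrA mul1r -mulrBr h mulr0.
have -> : 2 * (dotp u v - 1) / (2 - 2 * dotp u v) = -1.
  by rewrite (_ : 2 - 2 * dotp u v = 2 * (1 - dotp u v)); [field|ring].
by rewrite tnth_affine; ring.
Qed.

End Householder.

Section Balls.
Context (R : realType) (d : nat) (mu : {measure set (d.-tuple R) -> \bar R}).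
Hypothesis Hmu : is_lebesgue mu.
Local Notation T := (d.-tuple R).
Local Notation o := (origin R d).
Implicit Types (x y z u w h : T) (r : R) (A : set T).

Definition cball x r : set T := [set z | edist x z <= r].
Definition oball x r : set T := [set z | edist x z < r].

Lemma measurable_cball x r : measurable (cball x r).
Proof.
rewrite (_ : cball x r = (fun z => edist x z) @^-1` `]-oo, r]%classic); last first.
  by apply/seteqP; split => z; rewrite /= in_itv.
by apply: measurable_preimage => //; apply: measurable_edist.
Qed.

Lemma measurable_oball x r : measurable (oball x r).
Proof.
rewrite (_ : oball x r = (fun z => edist x z) @^-1` `]-oo, r[%classic); last first.
  by apply/seteqP; split => z; rewrite /= in_itv.
by apply: measurable_preimage => //; apply: measurable_edist.
Qed.

Lemma cball_box x r : cball x r `<=`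
  box [tuple tnth x i - r | i < d] [tuple tnth x i + r | i < d].
Proof.
move=> z zr i; rewrite !tnth_mktuple.
have := le_trans (coord_edist x z i) zr; rewrite ler_norml => /andP[? ?].
by apply/andP; split; lra.
Qed.

Lemma lebesgue_cball_lty x r : (mu (cball x r) < +oo)%E.
Proof.
have [r0|r0] := leP 0 r; last first.
  rewrite (_ : cball x r = set0) ?measure0//; apply/seteqP; split => z //=.
  by move=> /le_lt_trans/(_ r0); rewrite ltNge edist_ge0.
apply: (@le_lt_trans _ _ (mu (box [tuple tnth x i - r | i < d] [tuple tnth x i + r | i < d]))).
  by apply: le_measure; rewrite ?inE; [exact: measurable_cball|exact: measurable_box|exact: cball_box].
by rewrite lebesgue_box// ?ltry// => i; rewrite !tnth_mktuple; lra.
Qed.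

Definition ball_volume : R := fine (mu (cball o 1)).

Lemma ball_volumeE : mu (cball o 1) = ball_volume%:E.
Proof. by rewrite fineK// ge0_fin_numE// lebesgue_cball_lty. Qed.

Lemma ball_volume_gt0 : 0 < ball_volume.
Proof.
(* The cube of half-side a lies in the unit ball: each squared coordinate is at most a^2 <= a, and d
   a <= 1. *)
pose a : R := d.+1%:R^-1.
have a0 : 0 < a by rewrite invr_gt0.
rewrite -lte_fin -ball_volumeE.
apply: (@lt_le_trans _ _ (mu (box [tuple - a | i < d] [tuple a | i < d]))).
  rewrite lebesgue_box//; last by move=> i; rewrite !tnth_mktuple; lra.
  rewrite lte_fin; apply: prodr_gt0 => i _; rewrite !tnth_mktuple; lra.
apply: le_measure; rewrite ?inE; [exact: measurable_box|exact: measurable_cball|].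
move=> z H; rewrite /cball/= edist_origin -[leRHS](@sqrtr1 R) ler_wsqrtr//.
apply: (@le_trans _ _ (\sum_(i < d) a)).
  apply: ler_sum => i _; have := H i; rewrite !tnth_mktuple => /andP[h1 h2].
  have a1 : a <= 1 by rewrite invf_le1// ler1n.
  have : (tnth z i) ^+ 2 <= a ^+ 2 by rewrite -ler_sqrt ?sqr_ge0// sqrtr_sqr sqrtr_sqr (gtr0_norm a0) ler_norml h1 h2.
  by rewrite !expr2; nra.
rewrite sumr_const card_ord -mulr_natr /a mulrC ler_pdivrMr// mul1r ler_nat.
by rewrite leqnSn.
Qed.

(** The map z -> c (z - x), which moves x to the origin. *)
Definition rescale c x : T -> T := affine c (affine (- c) o x).

Lemma rescale_center c x : rescale c x x = o.
Proof. by apply: eq_from_tnth => i; rewrite !(tnth_affine, tnth_origin); ring. Qed.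

Lemma edist_rescale c x y z : edist (rescale c x y) (rescale c x z) = `|c| * edist y z.
Proof. exact: edist_affine. Qed.

Lemma edist_rescale_center c x z : edist o (rescale c x z) = `|c| * edist x z.
Proof. by rewrite -{1}(rescale_center c x) edist_rescale. Qed.

Lemma lebesgue_cball x r : 0 < r -> mu (cball x r) = (r ^+ d * ball_volume)%:E.
Proof.
move=> r0.
have rV0 : r^-1 != 0 by rewrite invr_eq0 gt_eqF.
rewrite (_ : cball x r = rescale r^-1 x @^-1` cball o 1).
  rewrite lebesgue_affine//; last exact: measurable_cball.
  by rewrite gtr0_norm ?invr_gt0// exprVn invrK ball_volumeE -EFinM.
apply/seteqP; split => z; rewrite /cball/= edist_rescale_center;
  by rewrite gtr0_norm ?invr_gt0// ler_pdivrMl// mulr1.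
Qed.

(** The open ball contains the closed balls of radius (1 - e) r, whose volume is at least 1 - d e
    times that of the closed ball of radius r by Bernoulli's inequality; then e tends to 0. *)
Lemma lebesgue_oball x r : (0 < d)%N -> 0 <= r -> mu (oball x r) = (r ^+ d * ball_volume)%:E.
Proof.
move=> d0; rewrite le_eqVlt => /predU1P[<-|r0].
  rewrite expr0n eqn0Ngt d0 mul0r (_ : oball x 0 = set0) ?measure0//.
  by apply/seteqP; split => z //=; rewrite /oball/= ltNge edist_ge0.
apply/eqP; rewrite eq_le; apply/andP; split.
  rewrite -(lebesgue_cball x r0); apply: le_measure; rewrite ?inE.
  - exact: measurable_oball.
  - exact: measurable_cball.
  - by move=> z; exact: ltW.
have V0 := ball_volume_gt0.
have rd : 0 < r ^+ d by rewrite exprn_gt0.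
have bd (e : R) : 0 < e < 1 -> (((1 - d%:R * e) * (r ^+ d * ball_volume))%:E <= mu (oball x r))%E.
  move=> /andP[e0 e1].
  have re0 : 0 < (1 - e) * r by rewrite mulr_gt0//; lra.
  apply: (@le_trans _ _ (mu (cball x ((1 - e) * r)))).
    rewrite lebesgue_cball// lee_fin exprMn mulrA ler_pM2r// ler_pM2r//.
    elim: (d) => [|m IH]; first by rewrite mul0r subr0 expr0.
    rewrite exprS; have : 0 <= 1 - e by lra.
    have : 0 <= m%:R :> R by [].
    rewrite -natr1; move: IH; move: (m%:R) ((1 - e) ^+ m) => M E; nra.
  apply: le_measure; rewrite ?inE; [exact: measurable_cball|exact: measurable_oball|].
  move=> z; rewrite /cball /oball/= => /le_lt_trans; apply.
  by rewrite -[ltRHS]mul1r ltr_pM2r//; lra.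
have fin : mu (oball x r) \is a fin_num.
  rewrite ge0_fin_numE//; apply: le_lt_trans (lebesgue_cball_lty x r).
  by apply: le_measure; rewrite ?inE; [exact: measurable_oball|exact: measurable_cball|move=> z; exact: ltW].
rewrite -(fineK fin) lee_fin; apply/ler_addgt0Pr => e e0.
set K := r ^+ d * ball_volume; have K0 : 0 < K by rewrite mulr_gt0.
have dR : 0 < d%:R :> R by rewrite ltr0n.
(* The second bound makes the loss d t K at most e; the first keeps t below 1. *)
pose t := Num.min (1 / 2) (e / (d%:R * K)).
have t0 : 0 < t by rewrite lt_min [X in _ && X]divr_gt0 ?mulr_gt0// andbT; lra.
have t1 : t < 1 by rewrite gt_min (_ : 1 / 2 < 1)//; lra.
have te : t * (d%:R * K) <= e by rewrite -ler_pdivlMr ?mulr_gt0// ge_min lexx orbT.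
have : (((1 - d%:R * t) * K)%:E <= (fine (mu (oball x r)))%:E)%E.
  by rewrite fineK//; apply: bd; rewrite t0.
by rewrite lee_fin; nra.
Qed.

Lemma lebesgue_sphere x r : (0 < d)%N -> mu [set z | edist x z = r] = 0.
Proof.
move=> d0.
have [r0|r0|r0] := ltgtP r 0.
- rewrite (_ : [set _ | _] = set0) ?measure0//; apply/seteqP; split => z //= h.
  by have := edist_ge0 x z; rewrite h leNgt r0.
- have E : [set z | edist x z = r] = cball x r `\` oball x r.
    apply/seteqP; split => z; rewrite /cball /oball/=; first by move=> ->; rewrite lexx ltxx.
    by move=> [h1 /negP]; rewrite -leNgt => h2; apply/eqP; rewrite eq_le h1.
  rewrite E measureD; [|exact: measurable_cball|exact: measurable_oball|exact: lebesgue_cball_lty].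
  rewrite setIidr; last by move=> z; exact: ltW.
  by rewrite [X in (X - _)%E](lebesgue_cball x r0) [X in (_ - X)%E](lebesgue_oball x d0 (ltW r0)) subee.
- rewrite r0 (_ : [set _ | _] = box x x); last first.
    apply/seteqP; split => z /=.
      by move/eqP; rewrite edist_eq0 => /eqP -> i; rewrite lexx.
    move=> h; apply/eqP; rewrite edist_eq0; apply/eqP/eq_from_tnth => i.
    by apply/eqP; rewrite eq_le.
  by rewrite lebesgue_box// (bigD1 (Ordinal d0))//= subrr mul0r.
Qed.

Lemma measurable_sphere x r : measurable [set z | edist x z = r].
Proof.
rewrite (_ : [set _ | _] = (fun z => edist x z) @^-1` [set r]) //.
by apply: measurable_preimage => //; apply: measurable_edist.
Qed.

(** The image measure is translation invariant, hence proportional to [mu]; the factor is 1 because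
    the unit ball around the origin is preserved. *)
Lemma lebesgue_householder w A : dotp w w != 0 -> measurable A ->
  mu (householder w @^-1` A) = mu A.
Proof.
move=> w0 mA.
have Hinv h C : measurable C ->
    mu (householder w @^-1` (affine 1 h @^-1` C)) = mu (householder w @^-1` C).
  move=> mC.
  rewrite (_ : _ @^-1` _ = affine 1 (householder w h) @^-1` (householder w @^-1` C)).
    rewrite lebesgue_translate//; apply: measurable_preimage => //.
    exact: measurable_householder.
  by apply/seteqP; split => z /=; rewrite householder_affine.
pose nu := image_measure mu (measurable_householder w).
have nuball k : nu (cball o k) = mu (cball o k).
  rewrite /nu /image_measure /pushforward; congr (mu _).
  have E z : edist o (householder w z) = edist o z.
    by rewrite -{1}(householder_origin w) edist_householder.
  by apply/seteqP; split => z; rewrite /cball/= E.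
have snu : sigma_finite setT nu.
  exists (fun k => cball o k%:R).
    apply/seteqP; split => // z _.
    exists (Num.Def.truncn (edist o z)).+1 => //.
    by rewrite /cball/= ltW// truncnS_gt.
  by move=> k; split; [exact: measurable_cball|rewrite nuball lebesgue_cball_lty].
have := translation_invariant_unique Hmu snu _ mA (measurable_cball o 1).
rewrite [X in (_ -> _ = _ * X)%E]nuball ball_volumeE => H.
have vn : ball_volume%:E != 0%E by rewrite gt_eqF// lte_fin ball_volume_gt0.
have {}H : (nu A * ball_volume%:E = mu A * ball_volume%:E)%E.
  by apply: H => h C mC; exact: Hinv.
have : (nu A * ball_volume%:E * (ball_volume^-1)%:E = mu A * ball_volume%:E * (ball_volume^-1)%:E)%E by rewrite H.
by rewrite -!muleA -EFinM mulfV ?mule1// gt_eqF// ball_volume_gt0.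
Qed.

(** A reflection fixing the origin carries u to the first basis vector used in [omega], so the
    direction between the centres is immaterial. *)
Lemma omega_sphere u : (0 < d)%N -> edist o u = 1 ->
  mu (cball o 1 `|` cball u 1) = (omega mu)%:E.
Proof.
move=> d0 u1.
have mU v : measurable (cball o 1 `|` cball v 1).
  by apply: measurableU; exact: measurable_cball.
have -> : omega mu = fine (mu (cball o 1 `|` cball (e1 R d) 1)).
  rewrite /omega; congr (fine (mu (_ `|` _)));
    by apply/seteqP; split => z; rewrite /cball/= edistC.
have finU v : mu (cball o 1 `|` cball v 1) \is a fin_num.
  rewrite ge0_fin_numE//; apply: (@le_lt_trans _ _ (mu (cball o 1) + mu (cball v 1))%E).
    by apply: measureU2; exact: measurable_cball.
  by rewrite lte_add_pinfty// lebesgue_cball_lty.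
rewrite fineK//.
have uu : dotp u u = 1.
  by have := u1; rewrite edist_origin => /(congr1 (fun t => t ^+ 2)); rewrite expr1n sqr_sqrtr// sumr_ge0// => i _; rewrite -expr2 sqr_ge0.
have ee : dotp (e1 R d) (e1 R d) = 1.
  rewrite /dotp; case: (d) d0 => // n _.
  rewrite big_ord_recl !tnth_mktuple/= mulr1 big1 ?addr0// => i _.
  by rewrite !tnth_mktuple/= mulr0.
have [<-//|eu] := eqVneq (e1 R d) u.
have [w0 Hu] := householder_swap ee uu eu.
rewrite -[RHS](lebesgue_householder w0 (mU _)); congr (mu _).
have E z : edist o (householder (affine (-1) (e1 R d) u) z) = edist o z.
  by rewrite -{1}(householder_origin (affine (-1) (e1 R d) u)) edist_householder.
have E' z : edist (e1 R d) (householder (affine (-1) (e1 R d) u) z) = edist u z.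
  by rewrite -{1}Hu edist_householder.
by apply/seteqP; split => z; rewrite /cball/= E E'.
Qed.

(* The region that has to be free of further sample points for the pair (x, y) to
   count: the ball around x (b = false) or the union of both balls (b = true). *)
Definition region (b : bool) x y : set T :=
  [set z | (edist x z < edist x y) || (b && (edist y z < edist x y))].

(** The volume of the region of a pair at distance 1, that is v_d or omega_d. *)
Definition kappa (b : bool) : R := if b then omega mu else ball_volume.

Lemma region_false x y : region false x y = oball x (edist x y).
Proof. by apply/seteqP; split => z; rewrite /region/= orbF. Qed.

Lemma region_true x y :
  region true x y = oball x (edist x y) `|` oball y (edist x y).
Proof. by apply/seteqP; split => z; rewrite /region/= => /orP. Qed.

Lemma measurable_region b x y : measurable (region b x y).
Proof.
case: b; last by rewrite region_false; exact: measurable_oball.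
by rewrite region_true; apply: measurableU; exact: measurable_oball.
Qed.

Lemma region_cball b x y : region b x y `<=` cball x (2 * edist x y).
Proof.
move=> z /orP[h|/andP[_ h]]; rewrite /cball/=; last first.
  by have := edist_triangle x y z; lra.
by have := edist_ge0 x y; lra.
Qed.

(** For two balls: spheres are null, so the balls may be closed, and rescaling by 1 / |x - y| brings
    the centres to distance 1. *)
Lemma lebesgue_region b x y : (0 < d)%N ->
  mu (region b x y) = (edist x y ^+ d * kappa b)%:E.
Proof.
move=> d0; case: b => /=; last by rewrite region_false lebesgue_oball// edist_ge0.
rewrite region_true.
have := edist_ge0 x y; rewrite le_eqVlt => /predU1P[<-|r0].
  rewrite expr0n eqn0Ngt d0 mul0r (_ : _ `|` _ = set0) ?measure0//.
  by apply/seteqP; split => z //=; rewrite /oball/= !ltNge !edist_ge0 => -[].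
set r := edist x y in r0 *.
have rV0 : r^-1 != 0 by rewrite invr_eq0 gt_eqF.
have mU : measurable (cball x r `|` cball y r) by apply: measurableU; exact: measurable_cball.
have mO : measurable (oball x r `|` oball y r) by apply: measurableU; exact: measurable_oball.
transitivity (mu (cball x r `|` cball y r)).
  apply/eqP; rewrite eq_le; apply/andP; split.
    apply: le_measure; rewrite ?inE// => z.
    by case=> h; [left|right]; exact: ltW.
  apply: (@le_trans _ _ (mu ((oball x r `|` oball y r) `|`
    ([set z | edist x z = r] `|` [set z | edist y z = r])))).
    apply: le_measure; rewrite ?inE//.
      apply: measurableU => //; apply: measurableU; exact: measurable_sphere.
    move=> z [|]; rewrite /cball/= le_eqVlt => /predU1P[h|h].
    - by right; left.
    - by left; left.
    - by right; right.
    - by left; right.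
  apply: (le_trans (measureU2 _ _ _)) => //.
    by apply: measurableU; exact: measurable_sphere.
  rewrite -[leRHS]adde0 leeD2l//.
  apply: (le_trans (measureU2 _ _ _)); [exact: measurable_sphere|exact: measurable_sphere|].
  by rewrite [X in (X + _)%E](lebesgue_sphere _ _ d0) [X in (_ + X)%E](lebesgue_sphere _ _ d0) adde0.
have u1 : edist o (rescale r^-1 x y) = 1.
  by rewrite edist_rescale_center gtr0_norm ?invr_gt0// mulVf// gt_eqF.
have E : cball x r `|` cball y r =
    rescale r^-1 x @^-1` (cball o 1 `|` cball (rescale r^-1 x y) 1).
  by apply/seteqP; split => z; rewrite /cball/= edist_rescale_center edist_rescale;
    rewrite gtr0_norm ?invr_gt0// !ler_pdivrMl// mulr1.
rewrite E lebesgue_affine//; last by apply: measurableU; exact: measurable_cball.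
by rewrite gtr0_norm ?invr_gt0// exprVn invrK omega_sphere// -EFinM.
Qed.

Lemma kappa_gt0 b : (0 < d)%N -> 0 < kappa b.
Proof.
move=> d0; case: b => /=; last exact: ball_volume_gt0.
have mE1 : edist o (e1 R d) = 1.
  rewrite edist_origin /dotp; case: (d) d0 => // n _.
  rewrite big_ord_recl !tnth_mktuple/= mulr1 big1 ?addr0 ?sqrtr1// => i _.
  by rewrite !tnth_mktuple/= mulr0.
rewrite -lte_fin -(omega_sphere d0 mE1); apply: (@lt_le_trans _ _ (mu (cball o 1))).
  by rewrite ball_volumeE lte_fin ball_volume_gt0.
apply: le_measure; rewrite ?inE; [exact: measurable_cball| |exact: subsetUl].
by apply: measurableU; exact: measurable_cball.
Qed.

End Balls.

(** * The Gamma function and radial integrals *)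

Section RealAux.
Context (R : realType).

(** Take logarithms and apply ln y <= y to y = s / (1 + 2 q): the shift by 1 + 2 q is chosen so that
    q y <= s / 2. *)
Lemma powR_expR_bound (q s : R) : 0 <= q -> 0 <= s ->
  s `^ q <= (1 + q * 2) `^ q * expR (s / 2).
Proof.
move=> q0 s0.
have [->|sn] := eqVneq s 0.
  have [->|qn] := eqVneq q 0; first by rewrite !powRr0 mul0r expR0 mulr1.
  by rewrite powR0// mulr_ge0 ?powR_ge0 ?expR_ge0.
have sp : 0 < s by rewrite lt_neqAle eq_sym sn.
have q1 : 0 < 1 + q * 2 by lra.
rewrite /powR (negbTE sn) gt_eqF// -expRD ler_expR.
have -> : s = s / (1 + q * 2) * (1 + q * 2) by rewrite divfK// gt_eqF.
set y := s / (1 + q * 2); have y0 : 0 < y by rewrite divr_gt0.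
rewrite lnM ?posrE//.
have := ln_sublinear y0 => hy.
have : q * ln y <= q * y by rewrite ler_wpM2l// ltW.
by move: hy (ln y) (ln _) => _ a b; nra.
Qed.

(** The integrand is twice the exponential density of rate 1/2. *)
Lemma integral_expR_half_lty :
  (\int[lebesgue_measure]_(x in `[0%R, +oo[) (expR (- x / 2))%:E < +oo :> \bar R)%E.
Proof.
have r0 : 0 < (2^-1 : R) by lra.
have pdf0 (x : R) : 0 <= exponential_pdf (2^-1) x by apply: exponential_pdf_ge0; exact: ltW.
have := @integral_exponential_pdf R _ r0 => E.
apply: (@le_lt_trans _ _ (\int[lebesgue_measure]_x (2 * exponential_pdf (2^-1 : R) x)%:E)%E).
  rewrite integral_mkcond; apply: ge0_le_integral => //=.
  - move=> x _; rewrite patchE; case: ifP => // _; by rewrite lee_fin expR_ge0.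
  - apply/(measurable_restrictT _ _).1 => //; apply/measurable_EFinP.
    apply: measurable_funTS; apply: measurableT_comp => //; apply: measurable_funM => //.
  - apply/measurable_EFinP; apply: measurable_funM => //; apply: measurable_exponential_pdf; exact: ltW.
  - move=> x _; rewrite patchE; case: ifPn => [|_].
      rewrite inE/= in_itv/= andbT => x0; rewrite lee_fin exponential_pdfE//.
      by rewrite mulrA mulfV// mul1r mulNr mulrC mulNr.
    by rewrite lee_fin mulr_ge0.
under eq_integral do rewrite EFinM.
rewrite ge0_integralZl//.
- by rewrite E mule1 ltry.
- by apply/measurable_EFinP; apply: measurable_exponential_pdf; exact: ltW.
- by move=> x _; rewrite lee_fin.
Qed.

(** [Gamma] is defined through [fine], which sends infinity to 0, so the content is that the
    integral converges: half of the exponential decay absorbs the power. *)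
Lemma GammaE (q : R) : 0 <= q ->
  (\int[lebesgue_measure]_(x in `[0%R, +oo[) (x `^ q * expR (- x))%:E)%E =
  (Gamma (1 + q))%:E.
Proof.
move=> q0.
have mf D : measurable_fun D (fun x : R => (x `^ q * expR (- x))%:E).
  apply/measurable_EFinP; apply: measurable_funTS; apply: measurable_funM.
    exact: measurable_powR.
  exact: measurableT_comp.
rewrite -integral_itv_obnd_cbnd//.
rewrite /Gamma (_ : 1 + q - 1 = q); last by ring.
rewrite fineK// ge0_fin_numE; last first.
  by apply: integral_ge0 => x _; rewrite lee_fin mulr_ge0 ?powR_ge0 ?expR_ge0.
rewrite integral_itv_obnd_cbnd//.
apply: (@le_lt_trans _ _ (\int[lebesgue_measure]_(x in `[0%R, +oo[)
    (((1 + q * 2) `^ q)%:E * (expR (- x / 2))%:E))%E).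
  apply: ge0_le_integral => //=.
  - by move=> x _; rewrite lee_fin mulr_ge0 ?powR_ge0 ?expR_ge0.
  - exact: mf.
  - apply: emeasurable_funM => //; apply/measurable_EFinP; apply: measurable_funTS.
    by apply: measurableT_comp => //; apply: measurable_funM.
  - move=> x; rewrite in_itv/= andbT => x0; rewrite -EFinM lee_fin.
    have -> : - x / 2 = x / 2 + - x by field.
    rewrite expRD mulrA ler_wpM2r ?expR_ge0//; exact: powR_expR_bound.
rewrite ge0_integralZl//.
- by rewrite lte_mul_pinfty ?integral_expR_half_lty ?lee_fin ?powR_ge0.
- apply/measurable_EFinP; apply: measurable_funTS.
  by apply: measurableT_comp => //; apply: measurable_funM.
- by rewrite lee_fin powR_ge0.
Qed.

End RealAux.

Section Radial.
Context (R : realType) (d : nat) (mu : {measure set (d.-tuple R) -> \bar R}).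
Hypotheses (Hmu : is_lebesgue mu) (d0 : (0 < d)%N).
Local Notation T := (d.-tuple R).
Local Notation o := (origin R d).
Local Notation V := (ball_volume mu).

Lemma dR0 : 0 < d%:R :> R. Proof. by rewrite ltr0n. Qed.

Lemma powR_root (s : R) : 0 <= s -> (s `^ (d%:R^-1)) ^+ d = s.
Proof.
move=> s0; rewrite -powR_mulrn ?powR_ge0// -powRrM mulVf ?powRr1//.
by rewrite gt_eqF// dR0.
Qed.

Lemma measurable_edist_origin : measurable_fun setT (fun u : T => edist o u).
Proof. by apply: measurable_edist. Qed.

Lemma measurable_edist_pow : measurable_fun setT (fun u : T => edist o u ^+ d).
Proof. apply: measurable_funX; exact: measurable_edist_origin. Qed.

Lemma ball_volume_ge0 : 0 <= V. Proof. by rewrite ltW// ball_volume_gt0. Qed.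

Lemma radial_ray (s : R) :
  mu ((fun u => edist o u ^+ d) @^-1` `]-oo, s[%classic) = (V * Num.max s 0)%:E.
Proof.
have [s0|s0] := leP s 0.
  rewrite ?max_r// mulr0 (_ : _ @^-1` _ = set0) ?measure0//.
  apply/seteqP; split => u //=; rewrite in_itv/= => /lt_le_trans/(_ s0).
  by rewrite ltNge exprn_ge0// edist_ge0.
rewrite ?max_l ?ltW// (_ : _ @^-1` _ = oball o (s `^ (d%:R^-1))).
  by rewrite (lebesgue_oball Hmu)// ?powR_ge0// powR_root ?ltW// mulrC.
have E u : (edist o u ^+ d < s) = (edist o u < s `^ (d%:R^-1)).
  rewrite -{1}(@powR_root s) ?ltW//.
  by rewrite (@ltr_pXn2r R d) ?nnegrE ?edist_ge0 ?powR_ge0.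
by apply/seteqP; split => u; rewrite /oball/= in_itv/= E.
Qed.

(** Polar coordinates without a Jacobian: since balls have volume V r^d, the map u -> |u|^d carries
    Lebesgue measure to V times Lebesgue measure on the half-line. Both measures are compared on the
    rays that generate the Borel sets. *)
Lemma radial_law (A : set R) : measurable A ->
  mu ((fun u => edist o u ^+ d) @^-1` A) =
  (\int[lebesgue_measure]_(s in A) (V * \1_(`[0%R, +oo[%classic) s)%:E)%E.
Proof.
move=> mA.
have mh : measurable_fun setT (fun s : R => (\1_(`[0%R, +oo[%classic) s)%:E : \bar R).
  by apply/measurable_EFinP; exact: measurable_indic.
have -> : (\int[lebesgue_measure]_(s in A) (V * \1_(`[0%R, +oo[%classic) s)%:E =
   V%:E * mrestr (@lebesgue_measure R) (measurable_itv `[0%R, +oo[) A)%E.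
  under eq_integral do rewrite EFinM.
  rewrite ge0_integralZl//.
  - by rewrite integral_indic// setIC.
  - exact: measurable_funTS mh.
  - by rewrite lee_fin ball_volume_ge0.
pose m2 := mscale (NngNum ball_volume_ge0) (mrestr (@lebesgue_measure R) (measurable_itv `[0%R, +oo[)).
pose G : set (set R) := [set A | exists x, A = `]-oo, x[%classic].
have E2 (s : R) : m2 `]-oo, s[%classic = (V * Num.max s 0)%:E.
  rewrite /m2 /mscale/= /mrestr.
  have -> : `]-oo, s[%classic `&` `[0%R, +oo[%classic = `[0%R, s[%classic.
    by apply/seteqP; split => x; rewrite /= !in_itv/= andbT; [case=> -> ->|case/andP=> -> ->].
  rewrite lebesgue_measure_itv/= lte_fin; case: (ltP 0 s) => s0.
    by rewrite sube0 -EFinM.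
  by rewrite mule0 mulr0.
rewrite -[RHS]/(m2 A).
pose phi (u : T) : measurableTypeR R := edist o u ^+ d.
have mphi : measurable_fun setT phi by exact: measurable_edist_pow.
apply: (@measure_unique _ R (measurableTypeR R) G (fun k => `]-oo, k%:R[%classic)
  _ _ _ _ (image_measure mu mphi) m2) mA => //.
- exact: RGenInftyO.measurableE.
- move=> _ _ [x ->] [y ->]; exists (Num.min x y).
  by apply/seteqP; split => z; rewrite /= !in_itv/= lt_min; [case=> -> ->|case/andP=> -> ->].
- by move=> k; exists k%:R.
- apply/seteqP; split => // x _; exists (Num.Def.truncn `|x|).+1 => //=.
  by rewrite in_itv/= (le_lt_trans (ler_norm x))// truncnS_gt.
- by move=> _ [s ->]; rewrite [RHS]E2; exact: radial_ray.
- by move=> k; rewrite [X in (X < _)%E]radial_ray ltry.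
Qed.

Lemma radial_integral (g : R -> R) : measurable_fun setT g -> (forall s, 0 <= g s) ->
  (\int[mu]_u (g (edist o u ^+ d)%R)%:E =
   V%:E * \int[lebesgue_measure]_(s in `[0%R, +oo[) (g s)%:E)%E.
Proof.
move=> mg g0.
have mgE : measurable_fun setT (fun s => (g s)%:E) by exact/measurable_EFinP.
have h0 (s : R) : 0 <= V * \1_(`[0%R, +oo[%classic) s by rewrite mulr_ge0// ball_volume_ge0.
have mh : measurable_fun setT (fun s : R => V * \1_(`[0%R, +oo[%classic) s).
  by apply: measurable_funM => //; exact: measurable_indic.
pose phi (u : T) : measurableTypeR R := edist o u ^+ d.
have mphi : measurable_fun setT phi by exact: measurable_edist_pow.
have si : sigma_finite setT (image_measure mu mphi).
  exists (fun k => `]-oo, k%:R[%classic).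
    apply/esym/seteqP; split => // x _; exists (Num.Def.truncn `|x|).+1 => //=.
    by rewrite in_itv/= (le_lt_trans (ler_norm x))// truncnS_gt.
  by move=> k; split => //; rewrite [X in (X < _)%E]radial_ray ltry.
have sl := @sigma_finiteT _ _ _ (@lebesgue_measure R).
transitivity (\int[image_measure mu mphi]_s (g s)%:E)%E.
  rewrite [RHS](ge0_integral_pushforward mphi)//.
  by move=> s _; rewrite lee_fin.
rewrite (ge0_integral_density sl si mh h0 mg g0 radial_law).
rewrite [in RHS]integral_mkcond -ge0_integralZl//.
- apply: eq_integral => s _; rewrite patchE indicE.
  by case: ifP => _; rewrite -?EFinM ?mulr1 ?mulr0 ?mule0// mulrC.
- exact/(measurable_restrictT _ _).1/measurable_funTS.
- by move=> s _; rewrite patchE; case: ifP => _ //; rewrite lee_fin.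
- by rewrite lee_fin ball_volume_ge0.
Qed.

(** Scaling u by a^(1/d) reduces to a = 1, and the variable s = |u|^d then gives the Gamma integral
    with exponent p / d. *)
Lemma radial_gamma (p a : R) : 0 <= p -> 0 < a ->
  (\int[mu]_u (edist o u `^ p * expR (- (a * edist o u ^+ d)))%:E =
   (V * Gamma (1 + p / d%:R) * a `^ (- 1 - p / d%:R))%:E)%E.
Proof.
move=> p0 a0.
pose c := a `^ (d%:R^-1).
have c0 : 0 < c by rewrite powR_gt0.
have cd : c ^+ d = a by rewrite powR_root// ltW.
pose f (u : T) : \bar R := ((edist o u / c) `^ p * expR (- (edist o u ^+ d)))%:E.
have mf : measurable_fun setT f.
  apply/measurable_EFinP; apply: measurable_funM.
    apply: (measurableT_comp (measurable_powR p)).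
    by apply: measurable_funM => //; exact: measurable_edist_origin.
  apply: measurableT_comp => //; apply: measurableT_comp => //.
  apply: measurable_funX; exact: measurable_edist_origin.
have f0 u : (0 <= f u)%E by rewrite lee_fin mulr_ge0 ?powR_ge0 ?expR_ge0.
have dc u : edist o (affine c o u) = c * edist o u.
  by rewrite affine_edist_translate// gtr0_norm.
transitivity (\int[mu]_u f (affine c o u))%E.
  apply: eq_integral => u _; rewrite /f dc exprMn cd.
  by rewrite mulrAC mulfV ?mul1r// gt_eqF.
rewrite lebesgue_integral_affine// ?gt_eqF//.
rewrite gtr0_norm// cd.
pose g (s : R) : R := a `^ (- (p / d%:R)) * (s `^ (p / d%:R) * expR (- s)).
have mg : measurable_fun setT (fun s : R => s `^ (p / d%:R) * expR (- s)).
  apply: measurable_funM; first exact: measurable_powR.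
  exact: measurableT_comp.
have pd0 : 0 <= p / d%:R by rewrite divr_ge0.
have -> : (\int[mu]_u f u = \int[mu]_u (g (edist o u ^+ d)%R)%:E)%E.
  apply: eq_integral => u _; rewrite /f /g; congr EFin; rewrite mulrA; congr (_ * _).
  rewrite powRM ?edist_ge0 ?invr_ge0 ?ltW// mulrC; congr (_ * _).
    rewrite -powR_inv1 ?powR_ge0// -!powRrM; congr (_ `^ _).
    by field; rewrite gt_eqF// dR0.
  rewrite -[edist o u ^+ d]powR_mulrn ?edist_ge0// -powRrM; congr (_ `^ _).
  by field; rewrite gt_eqF// dR0.
rewrite radial_integral//; last 2 first.
- by apply: measurable_funM.
- by move=> s; rewrite /g !mulr_ge0 ?powR_ge0 ?expR_ge0.
under [X in (_ * (_ * X))%E]eq_integral do rewrite EFinM.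
rewrite ge0_integralZl//; last 3 first.
- exact/measurable_EFinP/measurable_funTS.
- by move=> s _; rewrite lee_fin mulr_ge0 ?powR_ge0 ?expR_ge0.
- by rewrite lee_fin powR_ge0.
rewrite GammaE// -!EFinM; congr EFin.
rewrite powRB; last by rewrite (gt_eqF a0) implybT.
rewrite powR_inv1 ?ltW// powRN; ring.
Qed.

End Radial.

(** * Continuity of translations in L1 *)

Section TranslationContinuity.
Context (R : realType) (d : nat) (mu : {measure set (d.-tuple R) -> \bar R}).
Hypothesis Hmu : is_lebesgue mu.
Local Notation T := (d.-tuple R).
Local Notation o := (origin R d).
Implicit Types (g : T -> R) (h : T) (A : set T).

Definition tdiff g h : \bar R := (\int[mu]_x (`|g (affine 1 h x) - g x|)%:E)%E.

Definition translation_continuous g : Prop :=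
  forall e : R, 0 < e -> exists2 del : R, 0 < del &
    forall h, edist o h <= del -> (tdiff g h <= e%:E)%E.

Lemma measurable_translate g h : measurable_fun setT g ->
  measurable_fun setT (fun x => g (affine 1 h x)).
Proof. by move=> mg; apply: measurableT_comp => //; exact: measurable_affine. Qed.

Lemma measurable_tdiff g h : measurable_fun setT g ->
  measurable_fun setT (fun x => `|g (affine 1 h x) - g x|).
Proof.
move=> mg; apply: measurableT_comp => //; apply: measurable_funB => //.
exact: measurable_translate.
Qed.

(** The usual three-term splitting: translation invariance makes the first and last errors equal, so
    the property is closed under L1 limits. *)
Lemma tc_limit g : measurable_fun setT g ->
  (forall e : R, 0 < e -> exists g', [/\ measurable_fun setT g',
    translation_continuous g' & (\int[mu]_x (`|g x - g' x|)%:E <= e%:E)%E]) ->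
  translation_continuous g.
Proof.
move=> mg H e e0; have e3 : 0 < e / 3 by rewrite divr_gt0.
have [g' [mg' tg' gg']] := H _ e3.
have [del del0 Hd] := tg' _ e3; exists del => // h hd.
have mD : measurable_fun setT (fun x => `|g x - g' x|).
  by apply: measurableT_comp => //; exact: measurable_funB.
have mDh : measurable_fun setT (fun x => `|g (affine 1 h x) - g' (affine 1 h x)|).
  exact: measurable_translate mD.
have mt := measurable_tdiff h mg'.
apply: (@le_trans _ _ (\int[mu]_x (`|g (affine 1 h x) - g' (affine 1 h x)| +
   (`|g' (affine 1 h x) - g' x| + `|g x - g' x|))%:E)%E).
  apply: ge0_integral_leE => //.
  - exact: measurable_tdiff.
  - by apply: measurable_funD => //; exact: measurable_funD.
  - move=> x.
    have -> : g (affine 1 h x) - g x = (g (affine 1 h x) - g' (affine 1 h x)) +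
      ((g' (affine 1 h x) - g' x) + (g' x - g x)) by ring.
    apply: (le_trans (ler_normD _ _)); rewrite lerD2l.
    by apply: (le_trans (ler_normD _ _)); rewrite lerD2l distrC.
rewrite ge0_integral_addE//; last exact: measurable_funD.
  rewrite ge0_integral_addE//.
  rewrite (lebesgue_integral_translate h Hmu (f := fun x => (`|g x - g' x|)%:E))//; last exact/measurable_EFinP.
  have -> : e = e / 3 + (e / 3 + e / 3) by field.
  rewrite !EFinD; apply: leeD => //; apply: leeD => //; exact: Hd.
Qed.

Lemma tc_lin (a : R) g1 g2 : measurable_fun setT g1 -> measurable_fun setT g2 ->
  translation_continuous g1 -> translation_continuous g2 ->
  translation_continuous (fun x => g1 x + a * g2 x).
Proof.
move=> m1 m2 t1 t2 e e0.
have e2 : 0 < e / 2 by rewrite divr_gt0.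
have a1 : 0 < `|a| + 1 by rewrite ltr_wpDl.
have [d1 d10 H1] := t1 _ e2.
have [d2 d20 H2] := t2 _ (divr_gt0 e2 a1).
exists (Num.min d1 d2); first by rewrite lt_min d10.
move=> h; rewrite le_min => /andP[/H1 {}H1 /H2 {}H2].
have mt1 := measurable_tdiff h m1; have mt2 := measurable_tdiff h m2.
apply: (@le_trans _ _ (\int[mu]_x (`|g1 (affine 1 h x) - g1 x| +
   (`|a| + 1) * `|g2 (affine 1 h x) - g2 x|)%:E)%E).
  apply: ge0_integral_leE => //.
  - apply: (@measurable_tdiff (fun x => g1 x + a * g2 x)).
    by apply: measurable_funD => //; exact: measurable_funM.
  - by apply: measurable_funD => //; exact: measurable_funM.
  - move=> x.
    have -> : g1 (affine 1 h x) + a * g2 (affine 1 h x) - (g1 x + a * g2 x) =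
      (g1 (affine 1 h x) - g1 x) + a * (g2 (affine 1 h x) - g2 x) by ring.
    apply: (le_trans (ler_normD _ _)); rewrite lerD2l normrM ler_wpM2r//.
    by rewrite lerDl.
rewrite ge0_integral_addE//; last exact: measurable_funM.
rewrite ge0_integral_scaleE//.
have -> : e = e / 2 + (`|a| + 1) * (e / 2 / (`|a| + 1)).
  by rewrite mulrCA mulfV ?gt_eqF//; field.
rewrite [leRHS](_ : _ = (e / 2)%:E + (`|a| + 1)%:E * (e / 2 / (`|a| + 1))%:E)%E; last first.
  by rewrite -EFinM -EFinD.
apply: leeD => //.
by rewrite lee_pmul2l// lte_fin.
Qed.

(** Shortening every side of a box by little costs little volume. The maximum with 0 covers sides
    that are shorter than the amount removed. *)
Lemma prod_shrink (I : Type) (s : seq I) (w : I -> R) (e : R) : 0 < e ->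
  (forall i, 0 <= w i) ->
  exists2 t : R, 0 < t & forall t', 0 <= t' <= t ->
    \prod_(i <- s) w i - \prod_(i <- s) Num.max 0 (w i - t') <= e.
Proof.
move=> e0 w0; elim: s e e0 => [|a s IH] e e0.
  by exists 1 => // t' _; rewrite !big_nil subrr ltW.
have wa : 0 < w a + 1 by rewrite ltr_wpDl.
have P0 : 0 <= \prod_(i <- s) w i by apply: prodr_ge0.
set W := \prod_(i <- s) w i in P0 *.
have W1 : 0 < W + 1 by rewrite ltr_wpDl.
have e2 : 0 < e / 2 by rewrite divr_gt0.
have [t t0 Ht] := IH _ (divr_gt0 e2 wa).
exists (Num.min t (e / 2 / (W + 1))); first by rewrite lt_min t0 divr_gt0.
move=> t' /andP[t'0]; rewrite le_min => /andP[tt' tW].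
rewrite !big_cons -/W.
have := Ht t'; rewrite t'0 tt' => /(_ isT).
have Q0 : 0 <= \prod_(i <- s) Num.max 0 (w i - t').
  by apply: prodr_ge0 => i _; rewrite le_max lexx.
have QW : \prod_(i <- s) Num.max 0 (w i - t') <= W.
  apply: ler_prod => i _; rewrite le_max lexx/= ge_max w0/=; lra.
move: Q0 QW; rewrite -/W; set Q := \prod_(i <- s) _ => Q0 QW.
rewrite ler_pdivlMr// => h1.
move: tW; rewrite ler_pdivlMr// => h2.
have m1 : w a - t' <= Num.max 0 (w a - t') by rewrite le_max lexx orbT.
have : (w a - t') * Q <= Num.max 0 (w a - t') * Q by rewrite ler_wpM2r.
have wa0 := w0 a => h3.
have h4 : t' * Q <= t' * (W + 1) by rewrite ler_wpM2l//; lra.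
have h5 : w a * (W - Q) <= e / 2.
  by apply: le_trans h1; rewrite mulrC ler_wpM2l ?subr_ge0//; lra.
move: h3 h4 h5; set M := Num.max _ _; nra.
Qed.

(** The integrand is the indicator of a symmetric difference, whose two halves have equal measure by
    translation invariance. *)
Lemma tdiff_indic A h : measurable A -> (mu A < +oo)%E ->
  (tdiff \1_A h = (mu A - mu (A `&` affine 1 h @^-1` A)) + (mu A - mu (A `&` affine 1 h @^-1` A)))%E.
Proof.
move=> mA fA.
have mB : measurable (affine 1 h @^-1` A).
  by apply: measurable_preimage => //; exact: measurable_affine.
have fB : (mu (affine 1 h @^-1` A) < +oo)%E by rewrite lebesgue_translate.
set B := affine 1 h @^-1` A in mB fB *.
rewrite /tdiff (_ : (fun x => _) = (fun x => (\1_(B `\` A) x)%:E + (\1_(A `\` B) x)%:E)%E); last first.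
  apply/funext => x; rewrite -EFinD; congr EFin.
  have -> : \1_A (affine 1 h x) = \1_B x :> R by exact: indic_congr.
  have [ha|ha] := pselect (A x); have [hb|hb] := pselect (B x); rewrite !indicE.
  - by rewrite (mem_set ha) (mem_set hb) subrr normr0 !memNset ?addr0//; case.
  - rewrite (memNset hb) (mem_set ha) sub0r normrN normr1 memNset ?add0r; last by case.
    by rewrite mem_set.
  - rewrite (mem_set hb) (memNset ha) subr0 normr1 mem_set// memNset ?addr0//; by case.
  - by rewrite (memNset hb) (memNset ha) subrr normr0 !memNset ?addr0//; case.
have mI C : measurable C -> measurable_fun setT (fun x : T => (\1_C x)%:E : \bar R).
  by move=> mC; apply/measurable_EFinP; exact: measurable_indic.
rewrite ge0_integralD//; [|apply: mI; exact: measurableD|apply: mI; exact: measurableD].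
rewrite !integral_indic ?setIT//; [|exact: measurableD|exact: measurableD].
rewrite !measureD// (setIC B A) [X in (X - _ + _)%E](lebesgue_translate h Hmu mA).
by [].
Qed.

(** A box and its translate by h both contain the box shortened by |h| at each end, so [prod_shrink]
    is applied with 2 |h|. *)
Lemma tc_box a b : (forall i, tnth a i <= tnth b i) ->
  translation_continuous \1_(box a b).
Proof.
move=> ab e e0; have e2 : 0 < e / 2 by rewrite divr_gt0.
have w0 i : 0 <= tnth b i - tnth a i by rewrite subr_ge0.
have [t t0 Ht] := prod_shrink (index_enum 'I_d) e2 w0.
exists (t / 2); first by rewrite divr_gt0.
move=> h ht.
rewrite tdiff_indic; [|exact: measurable_box|by rewrite lebesgue_box// ltry].
pose s := edist o h; have s0 : 0 <= s := edist_ge0 _ _.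
have := Ht (2 * s); rewrite mulr_ge0//= -ler_pdivlMl// mulrC => /(_ ht) Hs.
have bh i : `|tnth h i| <= s.
  by have := coord_edist o h i; rewrite tnth_origin sub0r normrN.
have le1 : ((\prod_(i < d) Num.max 0 (tnth b i - tnth a i - 2 * s))%:E <=
    mu (box a b `&` affine 1 h @^-1` box a b))%E.
  (* If some side is shorter than 2 |h|, its factor in the product is 0 and the bound is trivial. *)
  have [ok|nok] := pselect (forall i, 2 * s <= tnth b i - tnth a i); last first.
    have [i] : exists i, tnth b i - tnth a i < 2 * s.
      apply: contrapT => H; apply: nok => i; rewrite leNgt; apply/negP => h'.
      by apply: H; exists i.
    move=> hi; rewrite (bigD1 i)//= max_l ?mul0r ?lee_fin//.
    by rewrite subr_le0 ltW.
  pose a' := [tuple tnth a i + s | i < d]; pose b' := [tuple tnth b i - s | i < d].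
  apply: (@le_trans _ _ (mu (box a' b'))).
    rewrite lebesgue_box//; last by move=> i; rewrite !tnth_mktuple; have := ok i; lra.
    rewrite lee_fin; apply: ler_prod => i _; rewrite !tnth_mktuple le_max lexx/=.
    by have := ok i; rewrite ge_max => h'; apply/andP; split; lra.
  apply: le_measure; rewrite ?inE; first exact: measurable_box.
    apply: measurableI; first exact: measurable_box.
    by apply: measurable_preimage; [exact: measurable_affine|exact: measurable_box].
  move=> x H; split=> i; have := H i; have := bh i; rewrite ?tnth_affine !tnth_mktuple.
    by move=> _ /andP[? ?]; apply/andP; split; lra.
  by rewrite ler_norml mul1r => /andP[? ?] /andP[? ?]; apply/andP; split; lra.
have : (mu (box a b) - mu (box a b `&` affine 1 h @^-1` box a b) <= (e / 2)%:E)%E.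
  rewrite lebesgue_box// leeBlDr; last first.
    rewrite ge0_fin_numE//; apply: (@le_lt_trans _ _ (mu (box a b))).
      apply: le_measure; rewrite ?inE//; last exact: measurable_box.
      apply: measurableI; first exact: measurable_box.
      by apply: measurable_preimage; [exact: measurable_affine|exact: measurable_box].
    by rewrite lebesgue_box// ltry.
  apply: (le_trans _ (leeD2l (e / 2)%:E le1)).
  by rewrite -EFinD lee_fin -lerBlDr.
move=> hb; have -> : e = e / 2 + e / 2 by field.
by rewrite EFinD; apply: leeD.
Qed.

Lemma tc_ext g1 g2 : g1 =1 g2 -> translation_continuous g1 -> translation_continuous g2.
Proof. by move=> /funext ->. Qed.

Lemma tc_indic0 : translation_continuous \1_(set0 : set T).
Proof.
move=> e e0; exists 1 => // h _; rewrite /tdiff.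
under eq_integral do rewrite !indic0 subrr normr0.
by rewrite integral0 lee_fin ltW.
Qed.

Lemma tc_nondecreasing (H : (set T)^nat) :
  (forall n, measurable (H n)) -> nondecreasing_seq H ->
  (mu (\bigcup_n H n) < +oo)%E -> (forall n, translation_continuous \1_(H n)) ->
  translation_continuous \1_(\bigcup_n H n).
Proof.
move=> mH ndH fH tH; set U := \bigcup_n H n in fH *.
have mU : measurable U by exact: bigcupT_measurable.
apply: tc_limit; first exact: measurable_indic.
move=> e e0.
have fU : mu U \is a fin_num by rewrite ge0_fin_numE.
have HU n : H n `<=` U by move=> x Hx; exists n.
have leU n : (mu (H n) <= mu U)%E by apply: le_measure; rewrite ?inE.
have fn n : mu (H n) \is a fin_num by rewrite ge0_fin_numE// (le_lt_trans (leU n)).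
have cv : mu (H n) @[n --> \oo] --> (fine (mu U))%:E.
  by rewrite fineK//; exact: nondecreasing_cvg_mu.
move: cv => /fine_cvgP[_] /cvgrPdist_le/(_ _ e0)[n _ /(_ n (leqnn n))] /= Hn.
exists \1_(H n); split; [exact: measurable_indic|exact: tH|].
rewrite (_ : (fun x => _) = (fun x => (\1_(U `\` H n) x)%:E)); last first.
  apply/funext => x; congr EFin; rewrite setDE indic_setI indic_setC.
  have -> : \1_(H n) x = \1_U x * \1_(H n) x :> R.
    by rewrite -indic_setI (setIidr (HU n)).
  by rewrite !indicE; case: (x \in U); case: (x \in H n); rewrite /=
    ?(mul0r, mulr0, mul1r, subr0, subrr, normr0, normr1).
rewrite integral_indic ?setIT//; last exact: measurableD.
have -> : mu (U `\` H n) = (fine (mu U) - fine (mu (H n)))%:E.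
  by rewrite EFinB !fineK// measureD// (setIidr (HU n)).
rewrite lee_fin.
exact: le_trans (ler_norm _) Hn.
Qed.

(** Dynkin induction starting from boxes. The intersection with a fixed cube keeps all measures
    finite, so that increasing unions are L1 limits and the complement is a difference of two good
    indicators. *)
Lemma tc_indic_cbox A k : measurable A ->
  translation_continuous \1_(A `&` @cbox R d k).
Proof.
set M := @cbox R d k; have mM : measurable M by exact: measurable_cbox.
have mI C : measurable C -> measurable_fun setT (\1_(C `&` M) : T -> R).
  by move=> mC; apply: measurable_indic; exact: measurableI.
have tM : translation_continuous \1_M.
  rewrite /M; case: (@cbox_boxes R d k) => [->|[a [b [ab ->]]]]; first exact: tc_indic0.
  exact: tc_box.
move=> mA.
apply: (@dynkin_induction _ T (@boxes R d) (fun A => translation_continuous \1_(A `&` M))).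
- exact: measurable_boxes.
- exact: boxes_setI.
- by rewrite setTI.
- move=> B bB; have [->|[a [b [ab ->]]]] := boxes_setI bB (@cbox_boxes R d k).
    exact: tc_indic0.
  exact: tc_box.
- move=> S mS tS; apply: (tc_ext (g1 := fun x => \1_M x + (-1) * \1_(S `&` M) x)).
    by move=> x; rewrite !indic_setI indic_setC; ring.
  by apply: tc_lin => //; first [exact: measurable_indic|exact: mI].
- move=> F mF tF HF.
  pose G n := \big[setU/set0]_(i < n.+1) F i.
  have mG n : measurable (G n) by apply: bigsetU_measurable.
  have -> : \bigcup_k0 F k0 `&` M = \bigcup_n (G n `&` M).
    by rewrite -setI_bigcupl bigcup_bigsetU_bigcup.
  apply: tc_nondecreasing => [n| | |n].
  + exact: measurableI.
  + move=> m n mn; apply/subsetPset; apply: setSI.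
    exact: subset_bigsetU.
  + apply: (@le_lt_trans _ _ (mu M)); last exact: lebesgue_cbox.
    apply: le_measure; rewrite ?inE//; last by move=> x [n _ []].
    by apply: bigcupT_measurable => n; exact: measurableI.
  + elim: n => [|n IH]; first by rewrite /G big_ord_recr/= big_ord0 set0U; exact: HF.
    apply: (tc_ext (g1 := fun x => \1_(G n `&` M) x + 1 * \1_(F n.+1 `&` M) x)); last first.
      by apply: tc_lin => //; exact: mI.
    move=> x; rewrite mul1r !indic_setI.
    have -> : G n.+1 = G n `|` F n.+1 by rewrite /G big_ord_recr.
    have E0 : G n `&` F n.+1 = set0.
      apply/seteqP; split => // y; rewrite /G -bigcup_mkord => -[[i /= i_n Fi] Fn].
      have i_eq : i = n.+1 by apply: (tF i n.+1 I I); exists y.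
      by rewrite i_eq ltnn in i_n.
    rewrite indic_setU E0 indic0 subr0; ring.
- by rewrite -measurable_boxes.
Qed.

Lemma tc_indic A : measurable A -> (mu A < +oo)%E -> translation_continuous \1_A.
Proof.
move=> mA fA.
have E : A = \bigcup_k (A `&` @cbox R d k) by rewrite -setI_bigcupr cbox_cover setIT.
rewrite E; apply: tc_nondecreasing => [n| | |n].
- by apply: measurableI => //; exact: measurable_cbox.
- by move=> m n mn; apply/subsetPset; apply: setIS; exact: cbox_nd.
- by rewrite -E.
- exact: tc_indic_cbox.
Qed.

(** The sum is e times the number of levels k e, k < N, lying below y. The third clause says that no
    level is missed before y is reached; it carries the induction. *)
Lemma step_approximation (e y : R) N : 0 < e -> 0 <= y ->
  let s := \sum_(k < N) e * ((k%:R * e < y)%R)%:R in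
  [/\ Num.min y (N%:R * e) <= s, s <= Num.min y (N%:R * e) + e &
     N%:R * e <= y -> s = N%:R * e].
Proof.
move=> e0 y0; elim: N => [|N [IH1 IH2 IH3]] /=.
  by rewrite big_ord0 mul0r min_r// add0r; split => //; exact: ltW.
rewrite big_ord_recr/=; move: IH1 IH2 IH3; set s := \sum_(k < N) _ => IH1 IH2 IH3.
have -> : N.+1%:R * e = N%:R * e + e by rewrite -natr1 mulrDl mul1r.
have [Ny|yN] := ltP (N%:R * e) y.
  rewrite (IH3 (ltW Ny)) mulr1; split=> [| |//]; first by rewrite ge_min lexx orbT.
  by rewrite lerD2r le_min (ltW Ny)/= lerDl ltW.
rewrite mulr0 addr0; move: IH1 IH2; rewrite min_l// => IH1 IH2.
by rewrite min_l; [split => // h|]; lra.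
Qed.

(** A bounded function is approximated uniformly by combinations of indicators of its superlevel
    sets; on a set of finite measure this is approximation in L1. *)
Lemma tc_bounded g (C : R) A : measurable_fun setT g -> measurable A ->
  (mu A < +oo)%E -> (forall x, 0 <= g x <= C) -> (forall x, ~ A x -> g x = 0) ->
  translation_continuous g.
Proof.
move=> mg mA fA gC gA; apply: tc_limit => // e e0.
pose m := fine (mu A); have m0 : 0 <= m by exact: fine_ge0.
have mE : mu A = m%:E by rewrite fineK// ge0_fin_numE.
(* The mesh: a uniform error c on a set of measure m costs c m <= e, and m + 1 is positive even if m
   = 0. *)
pose c := e / (m + 1); have c0 : 0 < c by rewrite divr_gt0// ltr_wpDl.
pose N := (Num.Def.truncn (`|C| / c)).+1.
have NC : `|C| <= N%:R * c by rewrite -ler_pdivrMr// ltW// truncnS_gt.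
pose s (n : nat) (x : T) := \sum_(k < n) c * ((k%:R * c < g x)%R)%:R.
pose L (k : nat) := [set x | k%:R * c < g x].
have mL k : measurable (L k).
  rewrite (_ : L k = g @^-1` `]k%:R * c, +oo[%classic).
    exact: measurable_preimage.
  by apply/seteqP; split => x; rewrite /L/= in_itv/= andbT.
have sE n : s n.+1 = (fun x => s n x + c * \1_(L n) x).
  apply/funext => x; rewrite /s big_ord_recr/=; congr (_ + _ * _).
  rewrite indicE (_ : (x \in L n) = (n%:R * c < g x))//.
  by apply/idP/idP; rewrite inE.
have ms n : measurable_fun setT (s n).
  elim: n => [|n IH]; first by rewrite (_ : s 0%N = cst 0)//; apply/funext => x; rewrite /s big_ord0.
  rewrite sE; apply: measurable_funD => //; apply: measurable_funM => //.
have ts n : translation_continuous (s n).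
  elim: n => [|n IH].
    apply: (tc_ext _ tc_indic0) => x; by rewrite indic0 /s big_ord0.
  rewrite sE; apply: tc_lin => //.
  apply: tc_indic => //; apply: le_lt_trans fA.
  apply: le_measure; rewrite ?inE// => x; rewrite /L/= => h; apply: contrapT => /gA h0.
  by move: h; rewrite h0 ltNge mulr_ge0// ltW.
exists (s N); split => //.
apply: (@le_trans _ _ (\int[mu]_x (c * \1_A x)%:E)%E).
  apply: ge0_integral_leE => //.
  - by apply: measurableT_comp => //; exact: measurable_funB.
  - by apply: measurable_funM => //; exact: measurable_indic.
  - move=> x; have /andP[g0 gc] := gC x.
    have [hA|hA] := pselect (A x); last first.
      rewrite indicE (memNset hA) mulr0 (gA _ hA) /s big1 ?subrr ?normr0//.
      by move=> k _; rewrite (gA _ hA) ltNge mulr_ge0 ?mulr0// ltW.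
    rewrite indicE (mem_set hA) mulr1.
    have [] := step_approximation N c0 g0; rewrite -/(s N x).
    have gN : g x <= N%:R * c by apply: (le_trans gc); apply: le_trans (ler_norm _) NC.
    by rewrite min_l// => h1 h2 _; rewrite ler_norml; apply/andP; split; lra.
rewrite ge0_integral_scaleE//; last exact: ltW.
rewrite integral_indic// setIT mE -EFinM lee_fin /c.
by rewrite mulrAC ler_pdivrMr ?ltr_wpDl// ler_pM2l//; lra.
Qed.

End TranslationContinuity.

(** * Asymptotics of the void integrals *)

Section Elementary.
Context (R : realType).
Implicit Types (a b t x y : R).

Lemma expRN_lipschitz x y : 0 <= x -> 0 <= y -> `|expR (- x) - expR (- y)| <= `|x - y|.
Proof.
wlog xy : x y / x <= y.
  move=> H x0 y0; have [xy|/ltW xy] := leP x y; first exact: H.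
  by rewrite distrC (distrC x); exact: H.
move=> x0 y0.
have e1 : expR (- y) <= expR (- x) by rewrite ler_expR lerN2.
rewrite ger0_norm ?subr_ge0// distrC ger0_norm ?subr_ge0//.
have ex1 : expR (- x) <= 1 by rewrite -expR0 ler_expR oppr_le0.
have -> : expR (- y) = expR (- x) * expR (- (y - x)) by rewrite -expRD; congr expR; ring.
have := expR_ge1Dx (- (y - x)) => h.
have ex0 : 0 <= expR (- x) := expR_ge0 _.
rewrite -{1}(mulr1 (expR (- x))) -mulrBr.
apply: (@le_trans _ _ (expR (- x) * (y - x))).
  by rewrite ler_wpM2l//; lra.
by rewrite -[leRHS]mul1r ler_wpM2r// subr_ge0.
Qed.

Lemma exprn_sub_le a b n : 0 <= b -> b <= a -> a <= 1 ->
  a ^+ n - b ^+ n <= n%:R * (a - b).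
Proof.
move=> b0 ba a1; elim: n => [|n IH]; first by rewrite !expr0 subrr mul0r.
have a0 : 0 <= a := le_trans b0 ba.
rewrite !exprS -natr1 mulrDl mul1r.
have bn : b ^+ n <= 1 by rewrite exprn_ile1//; exact: le_trans a1.
have bn0 : 0 <= b ^+ n by rewrite exprn_ge0.
have abn : 0 <= a ^+ n - b ^+ n by rewrite subr_ge0 lerXn2r// nnegrE.
have -> : a * a ^+ n - b * b ^+ n = a * (a ^+ n - b ^+ n) + (a - b) * b ^+ n by ring.
apply: lerD; last by rewrite -[leRHS]mulr1 ler_wpM2l// subr_ge0.
apply: le_trans IH; rewrite -[leRHS]mul1r; exact: ler_wpM2r.
Qed.

Lemma onem_expRN t : 0 <= t <= 1 -> 0 <= expR (- t) - (1 - t) <= t ^+ 2.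
Proof.
move=> /andP[t0 t1]; apply/andP; split.
  by have := expR_ge1Dx (- t); lra.
have h := expR_ge1Dx t.
have p : 0 < 1 + t by lra.
have : expR (- t) <= (1 + t)^-1.
  by rewrite expRN lef_pV2// posrE ?expR_gt0.
have : (1 + t)^-1 <= 1 - t + t ^+ 2.
  by rewrite -[leLHS]mul1r ler_pdivrMr//; nra.
by move=> h1 h2; have := le_trans h2 h1; lra.
Qed.

(** The Poisson limit with explicit error: the first term compares 1 - t with exp(- t), the second
    compares n t with its limit s. *)
Lemma onemX_expRN t s n : 0 <= t <= 1 -> 0 <= s ->
  `|(1 - t) ^+ n - expR (- s)| <= n%:R * t ^+ 2 + `|n%:R * t - s|.
Proof.
move=> /[dup] t01 /andP[t0 t1] s0.
have /andP[h1 h2] := onem_expRN t01.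
have e1 : expR (- t) <= 1 by rewrite -expR0 ler_expR oppr_le0.
have E : expR (- (n%:R * t)) = expR (- t) ^+ n.
  by rewrite -expRM_natl mulrN mulrC.
apply: (@le_trans _ _ (`|(1 - t) ^+ n - expR (- (n%:R * t))| + `|expR (- (n%:R * t)) - expR (- s)|)).
  by apply: (le_trans _ (ler_normD _ _)); rewrite addrA subrK.
apply: lerD; last by apply: expRN_lipschitz => //; rewrite mulr_ge0.
rewrite E distrC ger0_norm; last first.
  by rewrite subr_ge0 lerXn2r ?nnegrE ?expR_ge0//; lra.
apply: (@le_trans _ _ (n%:R * (expR (- t) - (1 - t)))); last by rewrite ler_wpM2l.
by apply: exprn_sub_le => //; lra.
Qed.

Lemma onemX_le_expRN t n : 0 <= t <= 1 -> (1 - t) ^+ n <= expR (- (n%:R * t)).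
Proof.
move=> /[dup] t01 /andP[t0 t1]; have /andP[h1 h2] := onem_expRN t01.
rewrite (_ : expR (- (n%:R * t)) = expR (- t) ^+ n); last by rewrite -expRM_natl mulrN mulrC.
by rewrite lerXn2r ?nnegrE ?expR_ge0//; lra.
Qed.

End Elementary.

Lemma measurable_ltr_set (R : realType) d (T : measurableType d) (h1 h2 : T -> R) :
  measurable_fun setT h1 -> measurable_fun setT h2 -> measurable [set x | h1 x < h2 x].
Proof.
move=> m1 m2.
rewrite (_ : [set _ | _] = (fun x => h2 x - h1 x) @^-1` `]0, +oo[%classic).
  by apply: measurable_preimage => //; exact: measurable_funB.
by apply/seteqP; split => x; rewrite /= in_itv/= andbT subr_gt0.
Qed.

Lemma measurable_integral_fst_snd d1 d2 (T1 : measurableType d1) (T2 : measurableType d2)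
  (R : realType) (m : {measure set T2 -> \bar R}) (f : T1 * T2 -> R) :
  sigma_finite setT m -> measurable_fun setT f -> (forall x, 0 <= f x) ->
  measurable_fun setT (fun x => \int[m]_y (f (x, y))%:E)%E.
Proof.
move=> s mf f0; apply: (measurable_integral_snd s (f := fun z => (f z)%:E)).
  exact/measurable_EFinP.
by move=> x; rewrite lee_fin.
Qed.

Lemma integral_dist d (T : measurableType d) (R : realType)
    (m : {measure set T -> \bar R}) (f g : T -> R) (a b : R) :
  measurable_fun setT f -> measurable_fun setT g ->
  (forall x, 0 <= f x) -> (forall x, 0 <= g x) ->
  (\int[m]_x (f x)%:E = a%:E)%E -> (\int[m]_x (g x)%:E = b%:E)%E ->
  ((`|a - b|)%:E <= \int[m]_x (`|f x - g x|)%:E)%E.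
Proof.
move=> mf mg f0 g0 fa gb.
have mfg : measurable_fun setT (fun x => `|f x - g x|).
  by apply: measurableT_comp => //; exact: measurable_funB.
have H (h k : T -> R) (x y : R) : measurable_fun setT h -> measurable_fun setT k ->
    measurable_fun setT (fun x => `|h x - k x|) ->
    (forall x, 0 <= h x) -> (forall x, 0 <= k x) ->
    (\int[m]_x (h x)%:E = x%:E)%E -> (\int[m]_x (k x)%:E = y%:E)%E ->
    ((x - y)%:E <= \int[m]_x (`|h x - k x|)%:E)%E.
  move=> mh mk mhk h0 k0 hx ky.
  rewrite EFinB leeBlDl// -hx -ky -ge0_integral_addE//.
  apply: ge0_integral_leE => //.
    exact: measurable_funD.
  by move=> z; rewrite -lerBlDl ler_norm.
case: (leP b a) => ab.
  rewrite ger0_norm ?subr_ge0//; exact: H.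
rewrite ltr0_norm ?subr_lt0// opprB.
under eq_integral do rewrite distrC.
by apply: H => //; under eq_fun do rewrite distrC.
Qed.

(* What the proof uses of condition (C1); that the support is bounded is derived later
   from its convexity and finite volume. *)
Record density_on_convex (R : realType) (d : nat) (mu F : {measure set (d.-tuple R) -> \bar R})
    (f : d.-tuple R -> R) (K : set (d.-tuple R)) (c C D : R) : Prop := DensityOnConvex {
  doc_lebesgue : is_lebesgue mu;
  doc_dim : (0 < d)%N;
  doc_measurable : measurable_fun setT f;
  doc_ge0 : forall x, 0 <= f x;
  doc_le : forall x, f x <= C;
  doc_out : forall x, ~ K x -> f x = 0;
  doc_c : 0 < c;
  doc_ge : forall x, K x -> c <= f x;
  doc_K : measurable K;
  doc_finK : (mu K < +oo)%E;
  doc_convex : forall x y (t : R), K x -> K y -> 0 <= t <= 1 ->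
    K [tuple (1 - t) * tnth x i + t * tnth y i | i < d];
  doc_D : 0 < D;
  doc_diam : forall x y, K x -> K y -> edist x y < D;
  doc_F : forall A, measurable A -> F A = (\int[mu]_(x in A) (f x)%:E)%E;
  doc_F1 : F setT = 1%E }.

(** * Probabilities of regions under the density *)

Section VoidProbabilities.
Context (R : realType) (d : nat) (mu F : {measure set (d.-tuple R) -> \bar R}).
Local Notation T := (d.-tuple R).
Local Notation o := (origin R d).
Variables (f : T -> R) (K : set T) (c C D : R).
Hypothesis G : density_on_convex mu F f K c C D.

Let Hmu := doc_lebesgue G.
Let d0 := doc_dim G.
Let mf := doc_measurable G.
Let f0 := doc_ge0 G.
Let fC := doc_le G.
Let fK := doc_out G.
Let c0 := doc_c G.
Let cK := doc_ge G.
Let mK := doc_K G.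
Let finK := doc_finK G.
Let convK := doc_convex G.
Let D0 := doc_D G.
Let diamK := doc_diam G.
Let HF := doc_F G.
Let F1 := doc_F1 G.

Lemma F_le1 A : measurable A -> (F A <= 1)%E.
Proof. by move=> mA; rewrite -F1; apply: le_measure; rewrite ?inE. Qed.

Lemma F_fin A : measurable A -> F A \is a fin_num.
Proof. by move=> mA; rewrite ge0_fin_numE// (le_lt_trans (F_le1 mA))// ltry. Qed.

Lemma F_sigma_finite : sigma_finite setT F.
Proof.
exists (fun=> setT); first by rewrite bigcup_const.
by move=> _; split => //; rewrite F1 ltry.
Qed.

Lemma F_indic A : measurable A -> F A = (\int[mu]_x (f x * \1_A x)%:E)%E.
Proof.
move=> mA; rewrite HF// integral_mkcond; apply: eq_integral => x _.
by rewrite patchE indicE; case: ifP => _; rewrite ?mulr1 ?mulr0.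
Qed.

Lemma F_le_mu A : measurable A -> (F A <= C%:E * mu A)%E.
Proof.
move=> mA; have C0 : 0 <= C := le_trans (f0 o) (fC o).
rewrite F_indic// -(setIT A) -(integral_indic mu measurableT mA) setIT.
rewrite -ge0_integral_scaleE//.
apply: ge0_integral_leE => //.
- by apply: measurable_funM => //; exact: measurable_indic.
- by apply: measurable_funM => //; exact: measurable_indic.
- by move=> x; rewrite mulr_ge0.
- by move=> x; rewrite ler_wpM2r.
Qed.

Lemma integral_f : (\int[mu]_x (f x)%:E = 1)%E.
Proof. by rewrite -F1 HF. Qed.

Lemma muK_gt0 : (0 < mu K)%E.
Proof.
rewrite lt_neqAle measure_ge0 andbT; apply/negP => /eqP K0.
have : (F setT <= C%:E * mu K)%E.
  apply: le_trans (F_le_mu mK); rewrite !F_indic//.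
  apply: ge0_integral_leE => //.
  - by apply: measurable_funM => //; exact: measurable_indic.
  - by apply: measurable_funM => //; exact: measurable_indic.
  - by move=> x; rewrite mulr_ge0.
  - move=> x; have [hK|hK] := pselect (K x); last by rewrite fK// !mul0r.
    by rewrite !indicE !mem_set.
by rewrite F1 -K0 mule0 leNgt lte_fin ltr01.
Qed.

Local Notation k := (fine (mu K)).

Lemma muKE : mu K = k%:E.
Proof. by rewrite fineK// ge0_fin_numE. Qed.

Lemma fine_muK_gt0 : 0 < k.
Proof. by rewrite -lte_fin -muKE muK_gt0. Qed.

(** The constant for which a ball of radius r <= D around a point of K has probability at least
    [lowc] r^d: the copy of K shrunk by r / D has volume (r / D)^d |K|, and f >= c on it. *)
Definition lowc : R := c * (D ^- d * k).

Lemma lowc_gt0 : 0 < lowc.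
Proof. by rewrite !mulr_gt0 ?fine_muK_gt0// invr_gt0 exprn_gt0. Qed.

(* The homothety of ratio r / D centred at x maps K into the part of K within r of x. *)
Lemma F_oball_ge x r : K x -> 0 < r -> r <= D -> ((lowc * r ^+ d)%:E <= F (oball x r))%E.
Proof.
move=> Kx r0 rD.
have DrV : D / r != 0 by rewrite mulf_neq0 ?invr_eq0 ?gt_eqF.
pose h : T := affine (1 - D / r) o x.
have Dr0 : 0 < D / r by rewrite divr_gt0.
(* The affine map is the inverse of the homothety, so A is the shrunken copy of K. *)
set A := affine (D / r) h @^-1` K.
have mA : measurable A by apply: measurable_preimage => //; exact: measurable_affine.
have AK : A `<=` K `&` oball x r.
  move=> z Az; have zE : z = [tuple (1 - r / D) * tnth x i + r / D * tnth (affine (D / r) h z) i | i < d].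
    apply: eq_from_tnth => i; rewrite tnth_mktuple !tnth_affine tnth_origin.
    by field; rewrite !gt_eqF.
  split.
    rewrite zE; apply: convK => //; apply/andP; split; first by rewrite divr_ge0 ?ltW.
    by rewrite ler_pdivrMr// mul1r.
  have := diamK Kx Az; rewrite /oball/=.
  have -> : edist x (affine (D / r) h z) = D / r * edist x z.
    rewrite -[in RHS](gtr0_norm Dr0) -(edist_affine (D / r) h); congr (edist _ _).
    by apply: eq_from_tnth => i; rewrite !tnth_affine tnth_origin; ring.
  by rewrite mulrAC ltr_pdivrMr// ltr_pM2l.
have mO : measurable (oball x r) by exact: measurable_oball.
have muA : mu A = ((r / D) ^+ d * k)%:E.
  by rewrite /A lebesgue_affine// muKE -EFinM gtr0_norm// -exprVn invf_div.
apply: (@le_trans _ _ (c%:E * mu A)%E).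
  by rewrite muA -EFinM lee_fin /lowc expr_div_n le_eqVlt; apply/orP; left; apply/eqP; ring.
rewrite F_indic// -(setIT A) -(integral_indic mu measurableT mA).
rewrite -ge0_integral_scaleE//; last exact: ltW.
apply: ge0_integral_leE => //.
- by apply: measurable_funM => //; exact: measurable_indic.
- by apply: measurable_funM => //; exact: measurable_indic.
- by move=> z; rewrite mulr_ge0// ltW.
- move=> z; have [hA|hA] := pselect (A z).
    have [Kz Oz] := AK _ hA; rewrite !indicE !mem_set// !mulr1; exact: cK.
  by rewrite indicE (memNset hA) mulr0 mulr_ge0.
Qed.

Definition q b x y : R := fine (F (region b x y)).

Lemma qE b x y : F (region b x y) = (q b x y)%:E.
Proof. by rewrite fineK// F_fin//; exact: measurable_region. Qed.

Lemma q01 b x y : 0 <= q b x y <= 1.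
Proof. by rewrite -!lee_fin -qE measure_ge0 F_le1//; exact: measurable_region. Qed.

Lemma q_le b x y : q b x y <= C * (edist x y ^+ d * kappa mu b).
Proof.
have := F_le_mu (measurable_region b x y).
by rewrite (lebesgue_region Hmu)// qE -EFinM lee_fin.
Qed.

Lemma q_ge b x y : K x -> K y -> lowc * edist x y ^+ d <= q b x y.
Proof.
move=> Kx Ky; have := edist_ge0 x y; rewrite le_eqVlt => /predU1P[<-|r0].
  by rewrite expr0n eqn0Ngt d0 mulr0; have /andP[] := q01 b x y.
rewrite -lee_fin -qE; apply: (le_trans (F_oball_ge Kx r0 (ltW (diamK Kx Ky)))).
apply: le_measure; rewrite ?inE; [exact: measurable_oball|exact: measurable_region|].
by move=> z; rewrite /oball /region/= => ->.
Qed.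

Lemma measurable_q b : measurable_fun setT (fun z : T * T => q b z.1 z.2).
Proof.
apply: (measurableT_comp (fine_measurable measurableT)).
pose Q : set ((T * T) * T) := [set w | region b w.1.1 w.1.2 w.2].
have mQ : measurable Q.
  have m11 : measurable_fun setT (fun w : (T * T) * T => w.1.1) by exact: measurableT_comp.
  have m12 : measurable_fun setT (fun w : (T * T) * T => w.1.2) by exact: measurableT_comp.
  have A1 : measurable [set w : (T * T) * T | edist w.1.1 w.2 < edist w.1.1 w.1.2].
    by apply: measurable_ltr_set; exact: measurable_edist.
  have A2 : measurable [set w : (T * T) * T | edist w.1.2 w.2 < edist w.1.1 w.1.2].
    by apply: measurable_ltr_set; exact: measurable_edist.
  case: b @Q; last first.
    by rewrite (_ : [set _ | _] = [set w : (T * T) * T | edist w.1.1 w.2 < edist w.1.1 w.1.2])//;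
      apply/seteqP; split => w; rewrite /region/= orbF.
  rewrite (_ : [set _ | _] = [set w : (T * T) * T | edist w.1.1 w.2 < edist w.1.1 w.1.2] `|`
    [set w : (T * T) * T | edist w.1.2 w.2 < edist w.1.1 w.1.2]).
    exact: measurableU.
  by apply/seteqP; split => w; rewrite /region/= => /orP.
have := measurable_section_measure F_sigma_finite mQ.
by apply: eq_measurable_fun => -[x y] _.
Qed.

Lemma measurable_q2 b dO (O : measurableType dO) (g h : O -> T) :
  measurable_fun setT g -> measurable_fun setT h ->
  measurable_fun setT (fun w => q b (g w) (h w)).
Proof.
move=> mg mh; apply: (measurableT_comp (measurable_q b) (g := fun w => (g w, h w))).
exact: measurable_fun_pair.
Qed.

Lemma region_translate b rho x u h :
  region b x (affine rho x u) (affine 1 x h) <-> region b o (affine rho o u) h.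
Proof.
have E1 : edist x (affine 1 x h) = edist o h.
  by rewrite affine_edist_translate// normr1 mul1r.
have E2 : edist x (affine rho x u) = edist o (affine rho o u).
  by rewrite !affine_edist_translate.
have E3 : edist (affine rho x u) (affine 1 x h) = edist (affine rho o u) h.
  have -> : affine rho x u = affine 1 x (affine rho o u).
    by apply: eq_from_tnth => i; rewrite !tnth_affine tnth_origin; ring.
  by rewrite edist_affine normr1 mul1r.
by rewrite /region/= E1 E2 E3.
Qed.

(** After translation to x, the two numbers compared are the integrals of f(x + h) and of the
    constant f(x) over the same set of displacements h. *)
Lemma q_deviation b rho u x : 0 < rho ->
  ((`|q b x (affine rho x u) - f x * (kappa mu b * (rho * edist o u) ^+ d)|)%:E <=
   \int[mu]_h (\1_(region b o (affine rho o u)) h * `|f (affine 1 h x) - f x|)%:E)%E.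
Proof.
move=> rho0; set S := region b o (affine rho o u).
have mS : measurable S by exact: measurable_region.
have mfx : measurable_fun setT (fun h => f (affine 1 h x)).
  apply: measurableT_comp => //; exact: measurable_affine2.
have mI : measurable_fun setT (\1_S : T -> R) by exact: measurable_indic.
have H1 : (\int[mu]_h (f (affine 1 h x) * \1_S h)%:E = (q b x (affine rho x u))%:E)%E.
  pose g y : \bar R := (f y * \1_(region b x (affine rho x u)) y)%:E.
  have mg : measurable_fun setT g.
    apply/measurable_EFinP; apply: measurable_funM => //.
    by apply: measurable_indic; exact: measurable_region.
  have g0 y : (0 <= g y)%E by rewrite lee_fin mulr_ge0.
  rewrite -qE (F_indic (measurable_region _ _ _)) -(lebesgue_integral_translate x Hmu mg g0).
  apply: eq_integral => h _; congr ((f _ * _)%:E).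
    by apply: eq_from_tnth => i; rewrite !tnth_affine; ring.
  by apply/esym/indic_congr; exact: region_translate.
have H2 : (\int[mu]_h (f x * \1_S h)%:E = (f x * (kappa mu b * (rho * edist o u) ^+ d))%:E)%E.
  rewrite ge0_integral_scaleE// integral_indic// setIT /S (lebesgue_region Hmu)//.
  by rewrite affine_edist_translate// gtr0_norm// -EFinM [kappa _ _ * _]mulrC.
apply: le_trans (integral_dist _ _ _ _ H1 H2) _ => //.
- exact: measurable_funM.
- exact: measurable_funM.
- by move=> h; rewrite mulr_ge0.
- by move=> h; rewrite mulr_ge0.
- rewrite le_eqVlt; apply/orP; left; apply/eqP; apply: eq_integral => h _; congr EFin.
  by rewrite -mulrBl normrM mulrC ger0_norm.
Qed.

End VoidProbabilities.

Section VoidIntegralLimit.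
Context (R : realType) (d : nat) (mu F : {measure set (d.-tuple R) -> \bar R}).
Local Notation T := (d.-tuple R).
Local Notation o := (origin R d).
Variables (f : T -> R) (K : set T) (c C D : R).
Hypothesis G : density_on_convex mu F f K c C D.

Let Hmu := doc_lebesgue G.
Let d0 := doc_dim G.
Let mf := doc_measurable G.
Let f0 := doc_ge0 G.
Let fC := doc_le G.
Let smu := lebesgue_sigma_finite Hmu.
Local Notation q := (q F).
Local Notation kappa := (kappa mu).
Local Notation lowc := (lowc mu K c D).

Lemma C_ge0 : 0 <= C. Proof. exact: le_trans (f0 o) (fC o). Qed.

Lemma f_translation_continuous : translation_continuous mu f.
Proof.
apply: (tc_bounded (C := C) Hmu mf (doc_K G) (doc_finK G)); last exact: (doc_out G).
by move=> x; rewrite f0 fC.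
Qed.

(* The length scale at which a ball has probability of order 1 / m. *)
Definition scale (m : nat) : R := m%:R `^ (- d%:R^-1).

Lemma scale_gt0 m : (0 < m)%N -> 0 < scale m.
Proof. by move=> m0; rewrite powR_gt0// ltr0n. Qed.

Lemma scaleX m : (0 < m)%N -> m%:R * scale m ^+ d = 1 :> R.
Proof.
move=> m0; rewrite /scale powRN exprVn powR_root// ?ler0n// mulfV//.
by rewrite pnatr_eq0 -lt0n.
Qed.

Lemma scale_cvg0 (e : R) : 0 < e -> exists m0 : nat, forall m, (m0 <= m)%N -> scale m <= e.
Proof.
move=> e0.
exists (Num.Def.truncn (e ^- d)).+1 => m m0m.
have mp : (0 < m)%N by apply: leq_trans m0m.
rewrite -(@ler_pXn2r _ d d0) ?nnegrE ?powR_ge0 ?(ltW e0)//.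
have mR : 0 < m%:R :> R by rewrite ltr0n.
rewrite -(ler_pM2l mR) scaleX// -ler_pdivrMr ?exprn_gt0// mul1r.
have : e ^- d < m%:R.
  by apply: (lt_le_trans (truncnS_gt _)); rewrite ler_nat.
exact: ltW.
Qed.

(** The integrand of J(m) after the substitution y = x + m^(-1/d) u, apart from the weight |u|^p and
    the powers of the scale; [void_limit] is its limit as m grows. *)
Definition void_local b m x u : R :=
  f x * f (affine (scale m) x u) * (1 - q b x (affine (scale m) x u)) ^+ m.

Definition void_limit b x u : R := f x ^+ 2 * expR (- (f x * kappa b * edist o u ^+ d)).

Let q0 b x y : 0 <= q b x y. Proof. by have /andP[] := q01 G b x y. Qed.
Let q1 b x y : 0 <= 1 - q b x y. Proof. by have /andP[_ ?] := q01 G b x y; rewrite subr_ge0. Qed.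
Let kap0 b : 0 <= kappa b. Proof. exact/ltW/(kappa_gt0 Hmu). Qed.

Lemma void_local_ge0 b m x u : 0 <= void_local b m x u.
Proof. by rewrite !mulr_ge0// exprn_ge0. Qed.

Lemma void_limit_ge0 b x u : 0 <= void_limit b x u.
Proof. by rewrite mulr_ge0 ?expR_ge0// sqr_ge0. Qed.

Lemma measurable_void_local b m :
  measurable_fun setT (fun z : T * T => void_local b m z.1 z.2).
Proof.
have ma : measurable_fun setT (fun z : T * T => affine (scale m) z.1 z.2).
  exact: measurable_affine2.
apply: measurable_funM; first apply: measurable_funM.
- exact: measurableT_comp.
- exact: measurableT_comp.
- apply: measurable_funX; apply: measurable_funB => //.
  exact: (measurable_q2 G).
Qed.

Lemma measurable_void_limit b :
  measurable_fun setT (fun z : T * T => void_limit b z.1 z.2).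
Proof.
have mf1 : measurable_fun setT (fun z : T * T => f z.1) by exact: measurableT_comp.
apply: measurable_funM; first exact: measurable_funX.
apply: measurableT_comp => //; apply: measurableT_comp => //.
apply: measurable_funM; first exact: measurable_funM.
by apply: measurable_funX; apply: measurable_edist.
Qed.

(** The domination, uniform in m: the probability of the region is at least [lowc] |u|^d / m, since
    m times the d-th power of the scale is 1. *)
Lemma void_local_bound b m x u : (0 < m)%N ->
  void_local b m x u <= C * expR (- (lowc * edist o u ^+ d)) * f x.
Proof.
move=> m0; rewrite /void_local; set y := affine _ x u.
have E0 : 0 <= C * expR (- (lowc * edist o u ^+ d)) * f x.
  by rewrite !mulr_ge0 ?expR_ge0// C_ge0.
have [Kx|Kx] := pselect (K x); last by rewrite (doc_out G Kx) !mul0r mulr0.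
have [Ky|Ky] := pselect (K y); last by rewrite (doc_out G Ky) mulr0 mul0r.
rewrite -[leRHS]mulrA [expR _ * _]mulrC mulrA [C * _]mulrC.
apply: ler_pM => //; [exact: mulr_ge0|exact: exprn_ge0|exact: ler_wpM2l|].
apply: (le_trans (onemX_le_expRN _ (q01 G b x y))).
rewrite ler_expR lerN2.
have := q_ge G b Kx Ky; rewrite /y affine_edist_translate exprMn.
rewrite (gtr0_norm (scale_gt0 m0)) => h.
have mR : 0 <= m%:R :> R by [].
have := ler_wpM2l mR h; apply: le_trans.
have -> : m%:R * (lowc * (scale m ^+ d * edist o u ^+ d)) =
    (m%:R * scale m ^+ d) * (lowc * edist o u ^+ d) by ring.
by rewrite scaleX// mul1r.
Qed.

(** One term for each approximation: f(y) by f(x), then (1 - t)^m by an exponential, where m t is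
    bounded by C kappa |u|^d, and finally t by f(x) times the volume of the region. *)
Lemma void_deviation b m x u : (0 < m)%N ->
  `|void_local b m x u - void_limit b x u| <=
    C * `|f (affine 1 (affine (scale m) o u) x) - f x| +
    C * ((C * (kappa b * edist o u ^+ d)) ^+ 2 / m%:R) * f x +
    C ^+ 2 * (m%:R * `|q b x (affine (scale m) x u) -
      f x * (kappa b * (scale m * edist o u) ^+ d)|).
Proof.
move=> m0; rewrite /void_local /void_limit; set B := C * (kappa b * _).
have -> : affine 1 (affine (scale m) o u) x = affine (scale m) x u.
  by apply: eq_from_tnth => i; rewrite !tnth_affine tnth_origin; ring.
set y := affine (scale m) x u; set t := q b x y.
have mR : 0 < m%:R :> R by rewrite ltr0n.
have t01 : 0 <= t <= 1 := q01 G b x y.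
set s := f x * kappa b * edist o u ^+ d.
have s0 : 0 <= s by rewrite !mulr_ge0// exprn_ge0// edist_ge0.
have sE : f x * (kappa b * (scale m * edist o u) ^+ d) = s / m%:R.
  rewrite exprMn; apply: (mulIf (lt0r_neq0 mR)); rewrite divfK ?gt_eqF//.
  transitivity ((m%:R * scale m ^+ d) * s); first by rewrite /s; ring.
  by rewrite scaleX// mul1r.
have tB : m%:R * t <= B.
  have := q_le G b x y; rewrite -/t /y affine_edist_translate (gtr0_norm (scale_gt0 m0)) => h.
  apply: (le_trans (ler_wpM2l (ltW mR) h)).
  have -> : m%:R * (C * ((scale m * edist o u) ^+ d * kappa b)) = (m%:R * scale m ^+ d) * B.
    by rewrite exprMn /B; ring.
  by rewrite scaleX// mul1r.
have h := onemX_expRN m t01 s0.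
have -> : f x * f y * (1 - t) ^+ m - f x ^+ 2 * expR (- s) =
   f x * (1 - t) ^+ m * (f y - f x) + f x ^+ 2 * ((1 - t) ^+ m - expR (- s)) by ring.
apply: (le_trans (ler_normD _ _)); rewrite -addrA; apply: lerD.
  rewrite normrM ler_wpM2r// ger0_norm; last first.
    by rewrite mulr_ge0// exprn_ge0//; case/andP: t01 => _; rewrite subr_ge0.
  rewrite -[leRHS]mulr1; apply: ler_pM => //.
    by rewrite exprn_ge0//; case/andP: t01 => _; rewrite subr_ge0.
  by apply: exprn_ile1; case/andP: t01 => ? ?; lra.
rewrite normrM ger0_norm ?sqr_ge0//.
apply: (le_trans (ler_wpM2l (sqr_ge0 _) h)).
have -> : m%:R * `|t - f x * (kappa b * (scale m * edist o u) ^+ d)| = `|m%:R * t - s|.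
  rewrite sE -{1}(gtr0_norm mR) -normrM mulrBr; congr `|_ - _|.
  by rewrite mulrCA mulfV ?mulr1// gt_eqF.
rewrite mulrDr; apply: lerD.
  have -> : f x ^+ 2 * (m%:R * t ^+ 2) = f x * (f x * (m%:R * t ^+ 2)) by ring.
  rewrite [leRHS]mulrC; apply: ler_wpM2l => //.
  apply: ler_pM => //; first by rewrite mulr_ge0// sqr_ge0.
  rewrite ler_pdivlMr//.
  have -> : m%:R * t ^+ 2 * m%:R = (m%:R * t) ^+ 2 by ring.
  rewrite lerXn2r// ?nnegrE.
    by rewrite mulr_ge0//; case/andP: t01.
  by rewrite !mulr_ge0 ?C_ge0 ?exprn_ge0 ?edist_ge0.
by rewrite ler_wpM2r// lerXn2r ?nnegrE// C_ge0.
Qed.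

Lemma void_L1_limit b u (e : R) : 0 < e -> exists m0 : nat, forall m, (m0 <= m)%N ->
  (\int[mu]_x (`|void_local b m x u - void_limit b x u|)%:E <= e%:E)%E.
Proof.
move=> e0.
pose S0 : R := kappa b * edist o u ^+ d.
pose B : R := C * S0.
have S00 : 0 <= S0 by rewrite mulr_ge0// exprn_ge0// edist_ge0.
have C0 := C_ge0.
(* With e' = e / M the two translation errors, C e' and C^2 S0 e', add up to at most e / 3. *)
pose M : R := 3 * (1 + C + C ^+ 2 * S0).
have M1 : 0 < M by rewrite mulr_gt0//; have := mulr_ge0 (sqr_ge0 C) S00; lra.
pose e' := e / M.
have e'0 : 0 < e' by rewrite divr_gt0.
have [del del0 Hdel] := f_translation_continuous e'0.
have ru0 : 0 < 2 * edist o u + 1 by have := edist_ge0 o u; lra.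
have [m1 Hm1] := scale_cvg0 (divr_gt0 del0 ru0).
(* The last bound makes the Poisson error C B^2 / m at most e / 3. *)
exists (maxn (maxn 1 m1) (Num.Def.truncn (3 * C * B ^+ 2 / e)).+1) => m.
rewrite !geq_max => /andP[/andP[mp /Hm1 sm] mB].
have mR : 0 < m%:R :> R by rewrite ltr0n.
have s0 := scale_gt0 mp.
set h0 := affine (scale m) o u.
have eh0 : edist o h0 = scale m * edist o u.
  by rewrite affine_edist_translate gtr0_norm.
(* The factor 2 is that of [region_cball]: every displacement h in S has length at most 2 |h0|,
   hence at most del. *)
have sdel : 2 * edist o h0 <= del.
  rewrite eh0; have := sm; rewrite ler_pdivlMr// => h; apply: le_trans h.
  by rewrite mulrCA ler_pM2l//; have := edist_ge0 o u; lra.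
set S := region b o h0; have mS : measurable S by exact: measurable_region.
have muS : mu S = (scale m ^+ d * S0)%:E.
  by rewrite (lebesgue_region Hmu)// eh0 exprMn /S0; congr EFin; ring.
have mql : measurable_fun setT (fun x => `|q b x (affine (scale m) x u) -
      f x * (kappa b * (scale m * edist o u) ^+ d)|).
  apply: measurableT_comp => //; apply: measurable_funB; last exact: measurable_funM.
  by apply: (measurable_q2 G) => //; exact: measurable_affine2.
have mt := measurable_tdiff h0 mf.
have mv : measurable_fun setT (fun x => `|void_local b m x u - void_limit b x u|).
  apply: measurableT_comp => //; apply: measurable_funB.
    exact: (measurableT_comp (measurable_void_local b m) (g := fun x => (x, u))).
  exact: (measurableT_comp (measurable_void_limit b) (g := fun x => (x, u))).
have K0 : 0 <= C * (B ^+ 2 / m%:R) by rewrite mulr_ge0// divr_ge0 ?sqr_ge0.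
apply: (@le_trans _ _ (\int[mu]_x (C * `|f (affine 1 h0 x) - f x| + C * (B ^+ 2 / m%:R) * f x +
    C ^+ 2 * (m%:R * `|q b x (affine (scale m) x u) -
      f x * (kappa b * (scale m * edist o u) ^+ d)|))%:E)%E).
  apply: ge0_integral_leE => //.
    apply: measurable_funD; first apply: measurable_funD; apply: measurable_funM => //.
    exact: measurable_funM.
  by move=> x; exact: void_deviation.
rewrite ge0_integral_addE//; last 4 first.
- by apply: measurable_funD; exact: measurable_funM.
- by apply: measurable_funM => //; exact: measurable_funM.
- by move=> x; rewrite addr_ge0// mulr_ge0.
- by move=> x; rewrite mulr_ge0 ?sqr_ge0// mulr_ge0.
rewrite ge0_integral_addE//; last 4 first.
- exact: measurable_funM.
- exact: measurable_funM.
- by move=> x; rewrite mulr_ge0.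
- by move=> x; rewrite mulr_ge0.
rewrite !ge0_integral_scaleE//; last 2 first.
- exact: measurable_funM.
- exact: sqr_ge0.
rewrite (integral_f G) mule1.
have T1 : (C%:E * \int[mu]_x (`|f (affine 1 h0 x) - f x|)%:E <= (C * e')%:E)%E.
  rewrite EFinM; apply: lee_wpmul2l; first by rewrite lee_fin.
  by apply: Hdel; have := edist_ge0 o h0; lra.
have T3 : (\int[mu]_x (`|q b x (affine (scale m) x u) -
      f x * (kappa b * (scale m * edist o u) ^+ d)|)%:E <= (scale m ^+ d * S0 * e')%:E)%E.
  have mSt : measurable_fun setT (fun z : T * T => \1_S z.2 * `|f (affine 1 z.2 z.1) - f z.1|).
    apply: measurable_funM.
      by apply: measurableT_comp => //; exact: measurable_indic.
    apply: measurableT_comp => //; apply: measurable_funB; last exact: measurableT_comp.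
    by apply: measurableT_comp => //; exact: measurable_affine2.
  apply: (@le_trans _ _ (\int[mu]_x \int[mu]_h (\1_S h * `|f (affine 1 h x) - f x|)%:E)%E).
    apply: ge0_le_integral => //.
    - exact/measurable_EFinP.
    - exact: (measurable_integral_fst_snd smu mSt).
    - by move=> x _; exact: (q_deviation G).
  (* Integrating over x first leaves, for each h in S, a translation difference of f, which is at
     most e'. The volume of S is S0 / m and cancels the factor m of the deviation bound. *)
  rewrite (tonelli_exchange smu smu (f := fun z : T * T => (\1_S z.2 * `|f (affine 1 z.2 z.1) - f z.1|)%:E))//; last first.
    exact/measurable_EFinP.
  apply: (@le_trans _ _ (\int[mu]_h (e' * \1_S h)%:E)%E).
    apply: ge0_le_integral => //.
    - by move=> h _; apply: integral_ge0 => x _; rewrite lee_fin.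
    - have mSt' : measurable_fun setT (fun z : T * T => \1_S z.1 * `|f (affine 1 z.1 z.2) - f z.2|).
        exact: (measurableT_comp mSt (@measurable_swap _ _ T T)).
      exact: (measurable_integral_fst_snd smu mSt').
    - by apply/measurable_EFinP; apply: measurable_funM => //; exact: measurable_indic.
    - move=> h _ /=; rewrite ge0_integral_scaleE//; last exact: measurable_tdiff.
      have [hS|hS] := pselect (S h); last by rewrite indicE memNset// mul0e mulr0.
      rewrite indicE mem_set// mul1e mulr1; apply: Hdel.
      by have := region_cball hS; rewrite /cball/=; lra.
  rewrite ge0_integral_scaleE//; last exact: ltW.
  by rewrite integral_indic// setIT muS -EFinM mulrC.
apply: (@le_trans _ _ ((C * e')%:E + (C * (B ^+ 2 / m%:R))%:E +
    (C ^+ 2)%:E * (m%:R%:E * (scale m ^+ d * S0 * e')%:E))%E).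
  apply: leeD; first exact: leeD.
  apply: lee_wpmul2l; first by rewrite lee_fin sqr_ge0.
  exact: lee_wpmul2l.
rewrite -!EFinM -!EFinD lee_fin.
have -> : m%:R * (scale m ^+ d * S0 * e') = S0 * e'.
  by rewrite !mulrA scaleX// mul1r.
have h2 : C * (B ^+ 2 / m%:R) <= e / 3.
  rewrite mulrA ler_pdivrMr//.
  have : 3 * C * B ^+ 2 / e <= m%:R.
    by apply: (@le_trans _ _ (Num.Def.truncn (3 * C * B ^+ 2 / e)).+1%:R); [rewrite ltW// truncnS_gt|rewrite ler_nat].
  rewrite ler_pdivrMr// => h; move: h; set XX := B ^+ 2; nra.
have h3 : C * e' + C ^+ 2 * (S0 * e') <= e / 3.
  have -> : e = e' * M by rewrite /e' divfK// gt_eqF.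
  rewrite /M.
  have -> : e' * (3 * (1 + C + C ^+ 2 * S0)) / 3 = e' * (1 + C + C ^+ 2 * S0) by field.
  rewrite -subr_ge0.
  have -> : e' * (1 + C + C ^+ 2 * S0) - (C * e' + C ^+ 2 * (S0 * e')) = e' by ring.
  exact: ltW.
by move: h2 h3; lra.
Qed.

End VoidIntegralLimit.

Section VoidIntegral.
Context (R : realType) (d : nat) (mu F : {measure set (d.-tuple R) -> \bar R}).
Local Notation T := (d.-tuple R).
Local Notation o := (origin R d).
Local Notation V := (ball_volume mu).
Variables (f : T -> R) (K : set T) (c C D : R).
Hypothesis G : density_on_convex mu F f K c C D.

Let Hmu := doc_lebesgue G.
Let d0 := doc_dim G.
Let mf := doc_measurable G.
Let f0 := doc_ge0 G.
Let fC := doc_le G.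
Let smu := lebesgue_sigma_finite Hmu.
Local Notation q := (q F).
Local Notation kappa := (kappa mu).
Local Notation lowc := (lowc mu K c D).
Local Notation void_local := (void_local F f).
Local Notation void_limit := (void_limit mu f).

Let mvl b m u : measurable_fun setT (fun x => void_local b m x u).
Proof. exact: (measurableT_comp (measurable_void_local G b m) (g := fun x => (x, u))). Qed.

Let mvt b u : measurable_fun setT (fun x => void_limit b x u).
Proof. exact: (measurableT_comp (measurable_void_limit G b) (g := fun x => (x, u))). Qed.

Let vl0 b m x u : 0 <= void_local b m x u. Proof. exact: (void_local_ge0 G). Qed.
Let vt0 b x u : 0 <= void_limit b x u. Proof. exact: void_limit_ge0. Qed.
Let C0 : 0 <= C. Proof. exact: (C_ge0 G). Qed.

Lemma integral_void_local_le b m u : (0 < m)%N ->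
  (\int[mu]_x (void_local b m x u)%:E <= (C * expR (- (lowc * edist o u ^+ d)))%:E)%E.
Proof.
move=> m0; rewrite -[leRHS]mule1 -(integral_f G) -ge0_integral_scaleE//; last first.
  by rewrite mulr_ge0// expR_ge0.
apply: ge0_integral_leE => //; first exact: measurable_funM.
by move=> x; exact: (void_local_bound G).
Qed.

Lemma integral_void_limit_le b u : (\int[mu]_x (void_limit b x u)%:E <= C%:E)%E.
Proof.
rewrite -[leRHS]mule1 -(integral_f G) -ge0_integral_scaleE//.
apply: ge0_integral_leE => //; first exact: measurable_funM.
move=> x; rewrite /void_limit expr2 -mulrA [leRHS]mulrC ler_wpM2l//.
rewrite -[leRHS]mulr1; apply: ler_pM => //; rewrite ?expR_ge0//.
rewrite -expR0 ler_expR oppr_le0 !mulr_ge0// ?exprn_ge0 ?edist_ge0//.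
exact/ltW/(kappa_gt0 Hmu).
Qed.

Lemma integral_void_local_cvg b u :
  (\int[mu]_x (void_local b n.+1 x u)%:E @[n --> \oo] --> \int[mu]_x (void_limit b x u)%:E)%E.
Proof.
pose A n := fine (\int[mu]_x (void_local b n.+1 x u)%:E)%E.
pose B := fine (\int[mu]_x (void_limit b x u)%:E)%E.
have AE n : (\int[mu]_x (void_local b n.+1 x u)%:E = (A n)%:E)%E.
  rewrite fineK// ge0_fin_numE; first by apply: (le_lt_trans (integral_void_local_le b u (ltn0Sn n))); rewrite ltry.
  by apply: integral_ge0 => x _; rewrite lee_fin.
have BE : (\int[mu]_x (void_limit b x u)%:E = B%:E)%E.
  rewrite fineK// ge0_fin_numE; first by apply: (le_lt_trans (integral_void_limit_le b u)); rewrite ltry.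
  by apply: integral_ge0 => x _; rewrite lee_fin.
rewrite BE; under eq_fun do rewrite AE.
apply: cvg_EFin; first by near=> n.
apply/cvgrPdist_le => e e0.
have [m0 Hm] := void_L1_limit G b u e0.
exists m0 => // n /= m0n; rewrite distrC -lee_fin.
apply: le_trans (integral_dist (mvl b n.+1 u) (mvt b u) _ _ (AE n) BE) _ => //.
by apply: Hm; exact: leq_trans m0n (leqnSn n).
Unshelve. all: by end_near. Qed.

Definition void_integral b (p : R) m : \bar R :=
  (\int[mu]_x \int[mu]_y (f x * f y * (edist x y `^ p * (1 - q b x y) ^+ m))%:E)%E.

Lemma measurable_edist_powR (p : R) dO (O : measurableType dO) (g h : O -> T) :
  measurable_fun setT g -> measurable_fun setT h ->
  measurable_fun setT (fun w => edist (g w) (h w) `^ p).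
Proof.
move=> mg mh; apply: (measurableT_comp (measurable_powR p)).
exact: measurable_edist.
Qed.

Let q1 b x y : 0 <= 1 - q b x y. Proof. by have /andP[_ ?] := q01 G b x y; rewrite subr_ge0. Qed.

Lemma scale_powR (p : R) m : (0 < m)%N ->
  m%:R `^ (1 + p / d%:R) * (scale R d m ^+ d * scale R d m `^ p) = 1.
Proof.
move=> m0; have mR : 0 < m%:R :> R by rewrite ltr0n.
rewrite powRD; last by rewrite (gt_eqF mR) implybT.
rewrite powRr1 ?ltW//.
have -> : scale R d m `^ p = (m%:R `^ (p / d%:R))^-1.
  by rewrite -powRN /scale -powRrM; congr powR; rewrite mulNr mulrC.
rewrite mulrACA mulfV ?mulr1; last by rewrite gt_eqF// powR_gt0.
by rewrite (scaleX G).
Qed.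

(** The Jacobian m^(-1) and the factor m^(-p/d) from the weight are exactly compensated by m^(1 +
    p/d). *)
Lemma void_integral_rescale b (p : R) m : (0 < m)%N ->
  ((m%:R `^ (1 + p / d%:R))%:E * void_integral b p m =
   \int[mu]_u ((edist o u `^ p)%:E * \int[mu]_x (void_local b m x u)%:E))%E.
Proof.
move=> m0; set rho := scale R d m; have rho0 : 0 < rho by exact: (scale_gt0 R d m0).
pose h (z : T * T) : R := edist o z.2 `^ p * void_local b m z.1 z.2.
have mh : measurable_fun setT h.
  apply: measurable_funM; first exact: measurable_edist_powR.
  exact: (measurable_void_local G).
have h0 z : 0 <= h z by rewrite mulr_ge0 ?powR_ge0.
have inner x : (\int[mu]_y (f x * f y * (edist x y `^ p * (1 - q b x y) ^+ m))%:E =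
    (rho ^+ d * rho `^ p)%:E * \int[mu]_u (h (x, u))%:E)%E.
  pose g (y : T) : \bar R := (f x * f y * (edist x y `^ p * (1 - q b x y) ^+ m))%:E.
  have mg : measurable_fun setT g.
    apply/measurable_EFinP; apply: measurable_funM; first exact: measurable_funM.
    apply: measurable_funM; first exact: measurable_edist_powR.
    by apply: measurable_funX; apply: measurable_funB => //; exact: (measurable_q2 G).
  have g0 y : (0 <= g y)%E by rewrite lee_fin !mulr_ge0 ?powR_ge0 ?exprn_ge0.
  have := lebesgue_integral_affine x Hmu (lt0r_neq0 rho0) mg g0.
  rewrite (gtr0_norm rho0) => E.
  have -> : (\int[mu]_y g y = (rho ^+ d)%:E * \int[mu]_u g (affine rho x u))%E.
    by rewrite E muleA -EFinM mulfV ?mul1e// gt_eqF// exprn_gt0.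
  have -> : (\int[mu]_u g (affine rho x u) = (rho `^ p)%:E * \int[mu]_u (h (x, u))%:E)%E.
    rewrite -ge0_integral_scaleE ?powR_ge0//; last first.
      exact: (measurableT_comp mh (g := pair x)).
    apply: eq_integral => u _; rewrite /g /h /void_local -/rho; congr EFin => /=.
    rewrite affine_edist_translate (gtr0_norm rho0) powRM ?edist_ge0 ?ltW//; ring.
  by rewrite muleA -EFinM.
rewrite /void_integral; under eq_integral do rewrite inner.
have mI : measurable_fun setT (fun x => \int[mu]_u (h (x, u))%:E)%E.
  exact: measurable_integral_fst_snd.
have K0 : 0 <= rho ^+ d * rho `^ p by rewrite mulr_ge0 ?powR_ge0// exprn_ge0// ltW.
rewrite ge0_integralZl//; last first.
  by move=> x _; apply: integral_ge0 => u _; rewrite lee_fin.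
rewrite muleA -EFinM scale_powR// mul1e.
rewrite (tonelli_exchange smu smu (f := fun z => (h z)%:E))//; last exact/measurable_EFinP.
by apply: eq_integral => u _; rewrite -ge0_integral_scaleE ?powR_ge0.
Qed.

(** Integrate over u first: for fixed x in K this is [radial_gamma] with a = f(x) kappa, and the
    powers of f(x) combine to 2 - 1 - p/d = (d - p)/d. *)
Lemma void_limit_value b (p : R) : 0 <= p ->
  (\int[mu]_u ((edist o u `^ p)%:E * \int[mu]_x (void_limit b x u)%:E) =
   (V * Gamma (1 + p / d%:R) * kappa b `^ (- 1 - p / d%:R))%:E *
   \int[mu]_(x in K) (f x `^ ((d%:R - p) / d%:R))%:E)%E.
Proof.
move=> p0.
have dR : 0 < d%:R :> R by rewrite ltr0n.
pose h (z : T * T) : R := edist o z.1 `^ p * void_limit b z.2 z.1.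
have mh : measurable_fun setT h.
  apply: measurable_funM; first exact: measurable_edist_powR.
  exact: (measurableT_comp (measurable_void_limit G b) (@measurable_swap _ _ T T)).
have h0 z : 0 <= h z by rewrite mulr_ge0 ?powR_ge0.
transitivity (\int[mu]_u \int[mu]_x (h (u, x))%:E)%E.
  by apply: eq_integral => u _; rewrite -ge0_integral_scaleE ?powR_ge0.
rewrite (tonelli_exchange smu smu (f := fun z => (h z)%:E))//; last exact/measurable_EFinP.
set W := V * Gamma (1 + p / d%:R) * kappa b `^ (- 1 - p / d%:R).
have W0 : 0 <= W.
  rewrite !mulr_ge0 ?powR_ge0 ?(ball_volume_ge0 Hmu)//.
  by rewrite /Gamma fine_ge0// integral_ge0// => t _; rewrite lee_fin mulr_ge0 ?powR_ge0 ?expR_ge0.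
have mfp : measurable_fun setT (fun x => f x `^ ((d%:R - p) / d%:R)).
  exact: (measurableT_comp (measurable_powR _)).
rewrite [in RHS]integral_mkcond -ge0_integralZl//; last 2 first.
- apply/(measurable_restrictT _ _).1; first exact: (doc_K G).
  exact/measurable_EFinP/measurable_funTS.
- by move=> x _; rewrite patchE; case: ifP => // _; rewrite lee_fin powR_ge0.
apply: eq_integral => x _; rewrite patchE.
have [Kx|Kx] := pselect (K x); last first.
  rewrite memNset// mule0; under eq_integral do rewrite /h /void_limit (doc_out G Kx) expr0n mul0r mulr0.
  by rewrite integral0.
rewrite mem_set//.
have fx0 : 0 < f x := lt_le_trans (doc_c G) (doc_ge G Kx).
have kap0 : 0 < kappa b := kappa_gt0 Hmu b d0.
have fk0 : 0 < f x * kappa b by rewrite mulr_gt0.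
transitivity (\int[mu]_u ((f x ^+ 2) * (edist o u `^ p * expR (- (f x * kappa b * edist o u ^+ d))))%:E)%E.
  by apply: eq_integral => u _; rewrite /h /void_limit/=; congr EFin; ring.
rewrite ge0_integral_scaleE ?sqr_ge0//; last 2 first.
- apply: measurable_funM; first exact: measurable_edist_powR.
  apply: measurableT_comp => //; apply: measurableT_comp => //; apply: measurable_funM => //.
  exact: measurable_edist_pow.
- by move=> u; rewrite mulr_ge0 ?powR_ge0 ?expR_ge0.
rewrite (radial_gamma Hmu d0 p0 fk0) -!EFinM; congr EFin.
rewrite powRM ?ltW// /W.
have -> : f x `^ ((d%:R - p) / d%:R) = f x ^+ 2 * f x `^ (-1 - p / d%:R).
  rewrite -[f x ^+ 2]powR_mulrn ?ltW// -powRD; last by rewrite (gt_eqF fx0) implybT.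
  by congr powR; field; rewrite gt_eqF.
ring.
Qed.

Lemma void_integral_cvg b (p : R) : 0 <= p ->
  ((n.+1%:R `^ (1 + p / d%:R))%:E * void_integral b p n.+1 @[n --> \oo] -->
   (V * Gamma (1 + p / d%:R) * kappa b `^ (- 1 - p / d%:R))%:E *
   \int[mu]_(x in K) (f x `^ ((d%:R - p) / d%:R))%:E)%E.
Proof.
move=> p0; under eq_fun do rewrite void_integral_rescale//.
rewrite -void_limit_value//.
pose g (u : T) : \bar R := (C * (edist o u `^ p * expR (- (lowc * edist o u ^+ d))))%:E.
have mg' : measurable_fun setT (fun u : T => edist o u `^ p * expR (- (lowc * edist o u ^+ d))).
  apply: measurable_funM; first exact: measurable_edist_powR.
  apply: measurableT_comp => //; apply: measurableT_comp => //; apply: measurable_funM => //.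
  exact: measurable_edist_pow.
have g0 (u : T) : 0 <= edist o u `^ p * expR (- (lowc * edist o u ^+ d)).
  by rewrite mulr_ge0 ?powR_ge0 ?expR_ge0.
apply: (@dominated_cvg _ _ _ mu setT measurableT _ _ g) => //.
- move=> n; apply: emeasurable_funM.
    by apply/measurable_EFinP; exact: measurable_edist_powR.
  have mv : measurable_fun setT (fun z : T * T => void_local b n.+1 z.2 z.1).
    exact: (measurableT_comp (measurable_void_local G b n.+1) (@measurable_swap _ _ T T)).
  exact: (measurable_integral_fst_snd smu mv).
- by move=> u _; apply: cvgeZl => //; exact: integral_void_local_cvg.
- apply/integrableP; split; first by apply/measurable_EFinP; exact: measurable_funM.
  have gE u : `|g u|%E = g u by rewrite gee0_abs// lee_fin mulr_ge0.
  under eq_integral do rewrite gE /g.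
  rewrite ge0_integral_scaleE//.
  by rewrite (radial_gamma Hmu d0 p0 (lowc_gt0 G)) -EFinM ltry.
- move=> n u _; rewrite gee0_abs; last first.
    rewrite mule_ge0 ?lee_fin ?powR_ge0//.
    by apply: integral_ge0 => x _; rewrite lee_fin.
  rewrite /g mulrCA EFinM; apply: lee_wpmul2l; first by rewrite lee_fin powR_ge0.
  exact: integral_void_local_le.
Qed.

(** The exponent may have either sign, so a power of f on K is bounded by the corresponding power of
    C or of c; the sum of both serves in all cases. *)
Lemma void_value_fin (p : R) :
  (\int[mu]_(x in K) (f x `^ ((d%:R - p) / d%:R))%:E < +oo)%E.
Proof.
set s := (d%:R - p) / d%:R.
pose M := C `^ s + c `^ s.
have mfp : measurable_fun K (fun x => (f x `^ s)%:E).
  by apply/measurable_EFinP/measurable_funTS; exact: (measurableT_comp (measurable_powR _)).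
apply: (@le_lt_trans _ _ (\int[mu]_(x in K) (cst M%:E x))%E).
  apply: ge0_le_integral => //; first exact: (doc_K G).
  - by move=> x _; rewrite lee_fin powR_ge0.
  - move=> x Kx; rewrite lee_fin /M.
    have fx0 : 0 < f x := lt_le_trans (doc_c G) (doc_ge G Kx).
    have [s0|s0] := leP 0 s.
      apply: (@le_trans _ _ (C `^ s)); last by rewrite lerDl powR_ge0.
      by apply: ge0_ler_powR; rewrite ?nnegrE ?C0 ?(ltW fx0).
    apply: (@le_trans _ _ (c `^ s)); last by rewrite lerDr powR_ge0.
    rewrite -[s]opprK !(powRN _ (- s)) lef_pV2 ?posrE ?powR_gt0 ?(doc_c G)//.
    apply: ge0_ler_powR; rewrite ?nnegrE ?(ltW fx0) ?(ltW (doc_c G)) ?(doc_ge G)//.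
    by rewrite oppr_ge0 ltW.
rewrite integral_cst; last exact: (doc_K G).
by rewrite lte_mul_pinfty ?(doc_finK G)// lee_fin addr_ge0 ?powR_ge0.
Qed.

End VoidIntegral.

(** * Independent samples *)

Section Rectangles.
Context (d : measure_display) (T : measurableType d) (n : nat).

Definition rect (A : 'I_n -> set T) : set (n.-tuple T) := [set x | forall i, A i (tnth x i)].

Definition rects : set (set (n.-tuple T)) :=
  [set B | exists2 A, (forall i, measurable (A i)) & B = rect A].

Lemma measurable_rect A : (forall i, measurable (A i)) -> measurable (rect A).
Proof.
move=> mA; rewrite (_ : rect A = \bigcap_(i in [set: 'I_n]) ((fun x => tnth x i) @^-1` A i)).
  apply: fin_bigcap_measurable => // i _; apply: measurable_preimage => //.
  exact: measurable_tnth.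
by apply/seteqP; split => x H i; [move=> _; exact: H|exact: (H i I)].
Qed.

Lemma measurable_rects : @measurable _ (n.-tuple T) = <<s rects >>.
Proof.
apply/seteqP; split; last first.
  apply: smallest_sub; first exact: sigma_algebra_measurable.
  by move=> A [B mB ->]; exact: measurable_rect.
pose S := g_sigma_algebraType rects.
have mid : measurable_fun [set: S] (fun x : S => (x : n.-tuple T)).
  apply/measurable_fun_tnthP => i _ Y mY; rewrite setTI.
  apply: sub_sigma_algebra; exists (fun j => if j == i then Y else setT).
    by move=> j; case: ifP.
  apply/seteqP; split => x /=; first by move=> Yx j; case: eqP => [->|].
  by move=> /(_ i); rewrite eqxx.
by move=> A mA; have := mid measurableT A mA; rewrite setTI.
Qed.

Lemma rects_setI : setI_closed rects.
Proof.
move=> _ _ [A mA ->] [B mB ->]; exists (fun i => A i `&` B i).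
  by move=> i; exact: measurableI.
by apply/seteqP; split => x /=; [move=> [h1 h2] i; split|move=> h; split => i; case: (h i)].
Qed.

Lemma rects_setT : rects setT.
Proof. by exists (fun=> setT) => //; apply/seteqP; split. Qed.

Lemma rect_measure_unique (R : realType) (m1 m2 : {measure set (n.-tuple T) -> \bar R}) :
  (m1 setT < +oo)%E ->
  (forall A, (forall i, measurable (A i)) -> m1 (rect A) = m2 (rect A)) ->
  forall B, measurable B -> m1 B = m2 B.
Proof.
move=> fin H B mB; apply: (measure_unique rects (fun=> setT)) => //.
- exact: measurable_rects.
- exact: rects_setI.
- by move=> _; exact: rects_setT.
- by rewrite bigcup_const.
- by move=> A [A' mA' ->]; exact: H.
Qed.

End Rectangles.

Section Independence.
Context (R : realType) (d : measure_display) (T : measurableType d).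
Context (dO : measure_display) (O : measurableType dO) (P : probability O R).
Variable X : nat -> O -> T.
Hypothesis mX : forall i, measurable_fun setT (X i).
Hypothesis indep : forall (s : seq nat) (A : nat -> set T), uniq s ->
  (forall i, measurable (A i)) ->
  P (\bigcap_(i in [set` s]) (X i @^-1` A i)) =
  (\big[*%E/1%E]_(i <- s) P (X i @^-1` A i))%E.

Definition subsample n (t : n.-tuple nat) (w : O) : n.-tuple T :=
  [tuple X (tnth t i) w | i < n].

Lemma tnth_subsample n (t : n.-tuple nat) w i : tnth (subsample t w) i = X (tnth t i) w.
Proof. by rewrite tnth_mktuple. Qed.

Lemma measurable_subsample n (t : n.-tuple nat) : measurable_fun setT (subsample t).
Proof.
apply/measurable_fun_tnthP => i; rewrite (_ : _ \o _ = X (tnth t i))//.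
by apply/funext => w; rewrite /= tnth_subsample.
Qed.

(** The hypothesis [indep] takes sets indexed by sample numbers, whereas a rectangle is indexed by
    positions in t. This is the constraint put on sample number k; it is the whole space when k does
    not occur in t. *)
Let cyl n (t : n.-tuple nat) (A : 'I_n -> set T) (k : nat) : set T :=
  [set x | forall i, tnth t i = k -> A i x].

Let measurable_cyl n (t : n.-tuple nat) A k : (forall i, measurable (A i)) ->
  measurable (cyl t A k).
Proof.
move=> mA; rewrite (_ : cyl t A k = \bigcap_(i in [set: 'I_n])
  (if tnth t i == k then A i else setT)).
  by apply: fin_bigcap_measurable => // i _; case: ifP.
apply/seteqP; split => x H i.
  by move=> _; case: eqP => // ik; exact: H.
by move=> ik; have := H i I; rewrite ik eqxx.
Qed.

Let subsample_rect n (t : n.-tuple nat) A :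
  subsample t @^-1` rect A = \bigcap_(k in [set` (t : seq nat)]) (X k @^-1` cyl t A k).
Proof.
apply/seteqP; split => w /=.
  move=> H k /= kt i ik; have := H i; by rewrite tnth_subsample ik.
move=> H i; rewrite tnth_subsample; apply: (H (tnth t i)) => //=.
exact: mem_tnth.
Qed.

Lemma independent_rect n1 n2 (t1 : n1.-tuple nat) (t2 : n2.-tuple nat) A B :
  uniq (t1 ++ t2) -> (forall i, measurable (A i)) -> (forall i, measurable (B i)) ->
  P (subsample t1 @^-1` rect A `&` subsample t2 @^-1` rect B) =
  (P (subsample t1 @^-1` rect A) * P (subsample t2 @^-1` rect B))%E.
Proof.
move=> u12 mA mB; have /and3P[u1 h12 u2] : [&& uniq t1, ~~ has (mem t1) t2 & uniq t2].
  by move: u12; rewrite cat_uniq.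
have E1 k : k \in (t1 : seq nat) -> cyl t2 B k = setT.
  move=> kt; apply/seteqP; split => // x _ i ik; exfalso.
  by move/hasPn: h12 => /(_ k); rewrite -{1}ik mem_tnth => /(_ isT)/=; rewrite kt.
have E2 k : k \in (t2 : seq nat) -> cyl t1 A k = setT.
  move=> kt; apply/seteqP; split => // x _ i ik; exfalso.
  by move/hasPn: h12 => /(_ k kt)/=; rewrite -ik mem_tnth.
rewrite !subsample_rect !indep//; [|by move=> k; exact: measurable_cyl..].
have -> : \bigcap_(k in [set` (t1 : seq nat)]) (X k @^-1` cyl t1 A k) `&`
    \bigcap_(k in [set` (t2 : seq nat)]) (X k @^-1` cyl t2 B k) =
    \bigcap_(k in [set` (t1 ++ t2 : seq nat)]) (X k @^-1` (cyl t1 A k `&` cyl t2 B k)).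
  apply/seteqP; split => w /=.
    move=> [H1 H2] k /=; rewrite mem_cat => /orP[kt|kt].
      by split; [exact: H1|rewrite E1].
    by split; [rewrite E2|exact: H2].
  by move=> H; split => k /= kt; case: (H k); rewrite //= mem_cat kt ?orbT.
rewrite indep//; last by move=> k; apply: measurableI; exact: measurable_cyl.
rewrite big_cat/=; congr (_ * _)%E; apply: eq_big_seq => k kt.
  by rewrite E1// setIT.
by rewrite E2// setTI.
Qed.

(** Two applications of uniqueness of finite measures: first in B with a rectangle in place of A,
    then in A with B arbitrary. *)
Lemma independent_subsamples n1 n2 (t1 : n1.-tuple nat) (t2 : n2.-tuple nat) A B :
  uniq (t1 ++ t2) -> measurable A -> measurable B ->
  P (subsample t1 @^-1` A `&` subsample t2 @^-1` B) =
  (P (subsample t1 @^-1` A) * P (subsample t2 @^-1` B))%E.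
Proof.
move=> u12 mA mB.
have mU := measurable_subsample t1; have mV := measurable_subsample t2.
have finP C : measurable C -> P C \is a fin_num.
  by move=> mC; rewrite ge0_fin_numE// (le_lt_trans (probability_le1 P mC))// ltry.
have step1 A' : (forall i, measurable (A' i)) ->
    P (subsample t1 @^-1` rect A' `&` subsample t2 @^-1` B) =
    (P (subsample t1 @^-1` rect A') * P (subsample t2 @^-1` B))%E.
  move=> mA'.
  have mE : measurable (subsample t1 @^-1` rect A').
    by apply: measurable_preimage => //; exact: measurable_rect.
  pose m1 := image_measure (mrestr P mE) mV.
  have p0 : 0 <= fine (P (subsample t1 @^-1` rect A')) by exact: fine_ge0.
  pose m2 := mscale (NngNum p0) (image_measure P mV).
  have m2E C : m2 C = (P (subsample t1 @^-1` rect A') * P (subsample t2 @^-1` C))%E.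
    by rewrite /m2 /mscale/= fineK// finP.
  rewrite setIC -m2E; apply: (rect_measure_unique (m1 := m1) (m2 := m2)) mB => //.
    apply: (@le_lt_trans _ _ (P (subsample t1 @^-1` rect A'))).
      rewrite -[X in (X <= _)%E]/(P (subsample t2 @^-1` setT `&` subsample t1 @^-1` rect A')).
    by apply: le_measure; rewrite ?inE ?preimage_setT ?setTI.
    by rewrite (le_lt_trans (probability_le1 P mE))// ltry.
  move=> B' mB'; transitivity (P (subsample t1 @^-1` rect A') * P (subsample t2 @^-1` rect B'))%E.
    by rewrite -independent_rect// setIC.
  exact/esym/m2E.
have mE : measurable (subsample t2 @^-1` B) by exact: measurable_preimage.
pose m1 := image_measure (mrestr P mE) mU.
have p0 : 0 <= fine (P (subsample t2 @^-1` B)) by exact: fine_ge0.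
pose m2 := mscale (NngNum p0) (image_measure P mU).
have m2E C : m2 C = (P (subsample t1 @^-1` C) * P (subsample t2 @^-1` B))%E.
  by rewrite /m2 /mscale/= fineK ?finP// muleC.
rewrite -m2E; apply: (rect_measure_unique (m1 := m1) (m2 := m2)) mA => //.
  apply: (@le_lt_trans _ _ (P (subsample t2 @^-1` B))).
    rewrite -[X in (X <= _)%E]/(P (subsample t1 @^-1` setT `&` subsample t2 @^-1` B)).
    by apply: le_measure; rewrite ?inE ?preimage_setT ?setTI.
  by rewrite (le_lt_trans (probability_le1 P mE))// ltry.
by move=> A' mA'; rewrite [RHS]m2E -step1.
Qed.

Lemma probability_sigma_finite (m : {measure set O -> \bar R}) : m setT = 1%E ->
  sigma_finite setT m.
Proof.
by move=> m1; exists (fun=> setT); [rewrite bigcup_const|move=> _; rewrite m1 ltry].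
Qed.

Lemma sigma_finite_image d' (T' : measurableType d') (Y : O -> T')
  (mY : measurable_fun setT Y) : sigma_finite setT (image_measure P mY).
Proof.
exists (fun=> setT); first by rewrite bigcup_const.
by move=> _; split => //; rewrite [X in (X < _)%E]probability_setT ltry.
Qed.

(* Independence in integral form: the second group of sample points may be replaced by
   an independent copy, i.e. integrated over a separate w'. *)
Lemma decouple n1 n2 (t1 : n1.-tuple nat) (t2 : n2.-tuple nat)
    (g : n1.-tuple T * n2.-tuple T -> R) :
  uniq (t1 ++ t2) -> measurable_fun setT g -> (forall z, 0 <= g z) ->
  (\int[P]_w (g (subsample t1 w, subsample t2 w))%:E =
   \int[P]_w \int[P]_w' (g (subsample t1 w, subsample t2 w'))%:E)%E.
Proof.
move=> u12 mg g0.
have mU := measurable_subsample t1; have mV := measurable_subsample t2.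
have mUV : measurable_fun setT (fun w => (subsample t1 w, subsample t2 w)).
  exact: measurable_fun_pair.
have mgE : measurable_fun setT (fun z => (g z)%:E) by exact/measurable_EFinP.
have gE0 z : (0 <= (g z)%:E)%E by rewrite lee_fin.
transitivity (\int[image_measure P mUV]_z (g z)%:E)%E.
  by rewrite [RHS](ge0_integral_pushforward mUV).
rewrite (sigma_finite_product_unique (sigma_finite_image mU) (sigma_finite_image mV)
  (m' := image_measure P mUV))//; last first.
  by move=> A B mA mB; rewrite -[RHS]independent_subsamples.
transitivity (\int[image_measure P mU]_x \int[P]_w' (g (x, subsample t2 w'))%:E)%E.
  apply: eq_integral => x _.
  rewrite [LHS](ge0_integral_pushforward mV P (f := fun y => (g (x, y))%:E))//.
  exact: (measurableT_comp mgE (g := pair x)).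
rewrite [LHS](ge0_integral_pushforward mU P (f := fun x => \int[P]_w' (g (x, subsample t2 w'))%:E)%E)//.
- have mg' : measurable_fun setT (fun z : n1.-tuple T * O => g (z.1, subsample t2 z.2)).
    apply: (measurableT_comp mg); apply: measurable_fun_pair => //.
    exact: measurableT_comp.
  apply: (measurable_integral_fst_snd _ mg') => //.
  by apply: probability_sigma_finite; exact: probability_setT.
- by move=> x _; apply: integral_ge0 => w' _; rewrite lee_fin.
Qed.

Section Identical.
Variable F : {measure set T -> \bar R}.
Hypothesis law : forall i A, measurable A -> P (X i @^-1` A) = F A.

Lemma law_setT : F setT = 1%E.
Proof. by rewrite -(law 0)// preimage_setT probability_setT. Qed.

Lemma law_fin A : measurable A -> F A \is a fin_num.
Proof.
move=> mA; rewrite -(law 0)// ge0_fin_numE//.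
rewrite (le_lt_trans (probability_le1 P _)) ?ltry//.
exact: measurable_preimage.
Qed.

Lemma law_integral i (g : T -> R) : measurable_fun setT g -> (forall x, 0 <= g x) ->
  (\int[P]_w (g (X i w))%:E = \int[F]_x (g x)%:E)%E.
Proof.
move=> mg g0; rewrite (@ge0_change_variables _ _ _ _ R P F (X i) 1 (fun x => (g x)%:E))//.
- by rewrite mul1e.
- by move=> A mA; rewrite mul1e; exact: law.
- exact/measurable_EFinP.
Qed.

Lemma law_sigma_finite : sigma_finite setT F.
Proof.
exists (fun=> setT); first by rewrite bigcup_const.
by move=> _; split => //; rewrite law_setT ltry.
Qed.

Lemma law_integral2 i j (g : T * T -> R) : i != j -> measurable_fun setT g ->
  (forall x, 0 <= g x) ->
  (\int[P]_w (g (X i w, X j w))%:E = \int[F]_x \int[F]_y (g (x, y))%:E)%E.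
Proof.
move=> ij mg g0.
pose g' (z : 1.-tuple T * 1.-tuple T) := g (tnth z.1 ord0, tnth z.2 ord0).
have mg' : measurable_fun setT g'.
  apply: (measurableT_comp mg); apply: measurable_fun_pair.
    by apply: (measurableT_comp (measurable_tnth ord0)).
  by apply: (measurableT_comp (measurable_tnth ord0)).
have := @decouple 1 1 [tuple i] [tuple j] g' _ mg' (fun z => g0 _).
rewrite /g'/= => H.
have {}H : (\int[P]_w (g (X i w, X j w))%:E = \int[P]_w \int[P]_w' (g (X i w, X j w'))%:E)%E.
  have := H; rewrite inE ij => /(_ isT).
  by under eq_integral do rewrite !tnth_subsample;
     under [RHS]eq_integral do under eq_integral do rewrite !tnth_subsample.
rewrite H.
pose k x := fine (\int[F]_y (g (x, y))%:E)%E.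
transitivity (\int[P]_w \int[F]_y (g (X i w, y))%:E)%E.
  apply: eq_integral => w _; rewrite (@law_integral j (fun y => g (X i w, y)))//.
  by apply: (measurableT_comp mg (g := pair (X i w))).
rewrite (@ge0_change_variables _ _ _ _ R P F (X i) 1 (fun x => \int[F]_y (g (x, y))%:E))%E//.
- by rewrite mul1e.
- by move=> A mA; rewrite mul1e; exact: law.
- exact: (measurable_integral_fst_snd law_sigma_finite).
- by move=> x; apply: integral_ge0 => y _; rewrite lee_fin.
Qed.

Lemma void_probability (s : seq nat) (B : set T) : uniq s -> measurable B ->
  (\int[P]_w (\prod_(k <- s) \1_B (X k w))%:E = (fine (F B) ^+ size s)%:E)%E.
Proof.
move=> us mB.
have -> : (fun w => (\prod_(k <- s) \1_B (X k w))%:E : \bar R) =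
    fun w => (\1_(\bigcap_(k in [set` s]) (X k @^-1` B)) w)%:E.
  apply/funext => w; congr EFin.
  elim: s us => [|a s IH] /=.
    by move=> _; rewrite big_nil set_nil bigcap_set0 indicT.
  move=> /andP[_ /IH {}IH]; rewrite big_cons IH.
  rewrite -[\1_B _]/(\1_(X a @^-1` B) w) -indic_setI; apply: indic_congr; split.
    by move=> [h1 h2] k /=; rewrite inE => /orP[/eqP->//|ks]; exact: h2.
  move=> h; split; first by apply: (h a); rewrite /= inE eqxx.
  by move=> k /= ks; apply: h; rewrite /= inE ks orbT.
rewrite integral_indic//; last first.
  apply: bigcap_measurableType => k _; exact: measurable_preimage.
rewrite setIT [LHS](indep (A := fun=> B))//.
under eq_bigr do rewrite law//.
elim: (s) => [|a s' IH]; first by rewrite big_nil expr0.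
by rewrite big_cons IH/= exprS EFinM fineK// law_fin.
Qed.

(** Given the points numbered by t, those numbered by s are independent with law F, so the chance
    that all of them lie in the section of B is a power of one probability. *)
Lemma integral_void n (t : n.-tuple nat) (s : seq nat) (g : n.-tuple T -> R)
    (B : set (n.-tuple T * T)) :
  uniq (t ++ s) -> measurable_fun setT g -> (forall u, 0 <= g u) -> measurable B ->
  (\int[P]_w (g (subsample t w) * \prod_(k <- s) \1_B (subsample t w, X k w))%:E =
   \int[P]_w (g (subsample t w) *
     fine (F [set z | B (subsample t w, z)]) ^+ size s)%:E)%E.
Proof.
move=> uts mg g0 mB.
pose h (z : n.-tuple T * (size s).-tuple T) : R :=
  g z.1 * \prod_(i < size s) \1_B (z.1, tnth z.2 i).
have mh : measurable_fun setT h.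
  apply: measurable_funM; first exact: measurableT_comp.
  apply: measurable_prod => i _.
  apply: (measurableT_comp (measurable_indic mB)).
  apply: measurable_fun_pair => //.
  exact: (measurableT_comp (measurable_tnth i)).
have h0 z : 0 <= h z by rewrite mulr_ge0// prodr_ge0.
have := decouple (t1 := t) (t2 := in_tuple s) uts mh h0.
have E w w' : \prod_(i < size s) \1_B (subsample t w, tnth (subsample (in_tuple s) w') i) =
    \prod_(k <- s) \1_B (subsample t w, X k w') :> R.
  rewrite [RHS](big_nth 0%N) big_mkord; apply: eq_bigr => i _.
  by rewrite tnth_subsample (tnth_nth 0%N).
rewrite /h/=; under eq_integral do rewrite E; move=> ->.
apply: eq_integral => w _; under eq_integral do rewrite E.
have mB' : measurable [set z | B (subsample t w, z)].
  exact: (measurable_preimage (f := pair (subsample t w))).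
have us : uniq s by move: uts; rewrite cat_uniq => /and3P[].
rewrite ge0_integral_scaleE//; last 2 first.
- apply: measurable_prod => k _.
  apply: (measurableT_comp (measurable_indic mB)).
  exact: measurable_fun_pair.
- by move=> w'; rewrite prodr_ge0.
have E2 w' : \prod_(k <- s) \1_B (subsample t w, X k w') =
    \prod_(k <- s) \1_[set z | B (subsample t w, z)] (X k w') :> R.
  by apply: eq_bigr => k _; exact: indic_congr.
under eq_integral do rewrite E2.
by rewrite void_probability// -EFinM.
Qed.

End Identical.
End Independence.

(** * Combinatorics of nearest neighbours *)

Section VoidSums.
Context (R : realType) (d : nat).
Local Notation T := (d.-tuple R).
Implicit Types (x : nat -> T) (b : bool) (p : R).

Lemma prod_indic (S : Type) (s : seq nat) (B : set S) (y : nat -> S) :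
  \prod_(k <- s) \1_B (y k) = (`[< forall k, k \in s -> B (y k) >])%:R :> R.
Proof.
elim: s => [|a s IH].
  by rewrite big_nil; case: asboolP => // h; exfalso; exact: h.
rewrite big_cons IH; have [Ba|Ba] := pselect (B (y a)); last first.
  rewrite indicE memNset// mul0r; case: asboolP => // h; exfalso; apply: Ba; apply: h.
  by rewrite inE eqxx.
rewrite indicE mem_set// mul1r; congr (_%:R); congr nat_of_bool; apply/asboolP/asboolP => h k.
  by rewrite inE => /orP[/eqP->//|]; exact: h.
by move=> ks; apply: h; rewrite inE ks orbT.
Qed.

Definition others n (l : seq nat) : seq nat := [seq k <- iota 0 n | k \notin l].

Lemma mem_others n l k : (k \in others n l) = (k < n)%N && (k \notin l).
Proof. by rewrite mem_filter mem_iota/= add0n andbC. Qed.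

Lemma uniq_others n l : uniq l -> uniq (l ++ others n l).
Proof.
move=> ul; rewrite cat_uniq ul filter_uniq ?iota_uniq// andbT/=.
by apply/hasPn => k; rewrite mem_others => /andP[].
Qed.

Lemma size_others n l : uniq l -> (forall k, k \in l -> (k < n)%N) ->
  size (others n l) = (n - size l)%N.
Proof.
move=> ul ln; have : perm_eq (l ++ others n l) (iota 0 n).
  apply: uniq_perm; [exact: uniq_others|exact: iota_uniq|].
  move=> k; rewrite mem_cat mem_others mem_iota/= add0n.
  by have [/ln->|] := boolP (k \in l); rewrite ?andbT.
by move=> /perm_size; rewrite size_cat size_iota => E; apply/esym; rewrite -{1}E addKn.
Qed.

Definition void b n x i j : R :=
  \prod_(k <- others n [:: i; j]) \1_(~` region b (x i) (x j)) (x k).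

(** The boolean form of [void]: the product is made for integration, the boolean for the
    combinatorics of neighbours. *)
Definition is_void b n x i j : bool :=
  `[< forall k, (k < n)%N -> k != i -> k != j -> ~ region b (x i) (x j) (x k) >].

Lemma voidE b n x i j : void b n x i j = (is_void b n x i j)%:R.
Proof.
rewrite /void prod_indic /is_void; congr (_%:R); congr nat_of_bool.
apply/asboolP/asboolP => h k.
  by move=> kn ki kj; apply: h; rewrite mem_others kn !inE negb_or ki.
by rewrite mem_others !inE negb_or => /and3P[kn ki kj]; exact: h.
Qed.

Lemma void_ge0 b n x i j : 0 <= void b n x i j.
Proof. by rewrite voidE ler0n. Qed.

Definition nn_term b p n x i j : R := edist (x i) (x j) `^ p * void b n x i j.

Definition nn_sum b p n x : R := \sum_(i < n) \sum_(j < n | j != i) nn_term b p n x i j.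

Lemma nn_term_ge0 b p n x i j : 0 <= nn_term b p n x i j.
Proof. by rewrite mulr_ge0 ?powR_ge0 ?void_ge0. Qed.

Lemma nn_sum_ge0 b p n x : 0 <= nn_sum b p n x.
Proof. by apply: sumr_ge0 => i _; apply: sumr_ge0 => j _; exact: nn_term_ge0. Qed.

Lemma is_void_nearest b n x i j k : is_void b n x i j -> (k < n)%N -> k != i ->
  edist (x i) (x j) <= edist (x i) (x k).
Proof.
move=> /asboolP h kn ki; have [->//|kj] := eqVneq k j.
by rewrite leNgt; apply/negP => lt; apply: (h k kn ki kj); rewrite /region/= lt.
Qed.

Lemma is_nn_void n (x : nat -> T) (i j : 'I_n) : uniq [seq x k | k <- iota 0 n] ->
  is_nn [seq x k | k <- iota 0 n] (x i) (x j) = (j != i) && is_void false n x i j.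
Proof.
move=> ux; have inj k l : (k < n)%N -> (l < n)%N -> (x k == x l) = (k == l).
  move=> kn ln; apply/eqP/eqP => [|->//] xkl.
  have /(_ k l) := (@uniqP _ (x 0%N) _ ux); rewrite !inE size_map size_iota.
  by move=> /(_ kn ln); rewrite !(nth_map 0%N) ?size_iota// !nth_iota// => /(_ xkl).
rewrite /is_nn map_f ?mem_iota//= inj//; congr andb.
rewrite all_map; apply/allP/asboolP => h k.
  move=> kn ki kj; have := h k; rewrite mem_iota/= add0n inj// (negbTE ki)/= => /(_ kn) le.
  by rewrite /region/= orbF ltNge le.
rewrite mem_iota/= add0n => kn; rewrite inj//; have [//|ki/=] := eqVneq k (i : nat).
by apply: (is_void_nearest (b := false)) kn ki; exact/asboolP.
Qed.

Lemma is_void_true n x (i j : nat) : (i < n)%N -> (j < n)%N -> i != j ->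
  is_void true n x i j = is_void false n x i j && is_void false n x j i.
Proof.
move=> ni nj ij; apply/asboolP/andP => [h|[/asboolP h1 /asboolP h2] k kn ki kj].
  split; apply/asboolP => k kn k1 k2; rewrite /region/= orbF => lt.
    by apply: (h k) => //; rewrite /region/= lt.
  by apply: (h k) => //; rewrite /region/= [edist (x i) (x j)]edistC lt orbT.
rewrite /region/= => /orP[lt|]; first by apply: (h1 k) => //; rewrite /region/= lt.
by rewrite [edist (x i) (x j)]edistC => lt; apply: (h2 k) => //; rewrite /region/= lt.
Qed.

(* Inclusion-exclusion over the two possible orientations of an edge: [nn_sum true] sums
   over the mutual nearest neighbours. *)
Lemma NN_weight_nn_sum p n (O : Type) (X : nat -> O -> T) w : uniq (sample X n w) ->
  NN_weight p (sample X n w) = nn_sum false p n (X^~ w) - 2^-1 * nn_sum true p n (X^~ w).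
Proof.
move=> us; rewrite /NN_weight undup_id//.
rewrite /sample big_map -{1}[n]subn0 -/(index_iota 0 n) big_mkord.
under eq_bigr => i _ do rewrite big_map -{1}[n]subn0 -/(index_iota 0 n) big_mkord.
set x := X^~ w; pose r (i j : nat) := edist (x i) (x j) `^ p.
have E (i : 'I_n) : \sum_(j < n | nn_edge (sample X n w) (x i) (x j)) r i j =
    \sum_(j < n | j != i) (nn_term false p n x i j + nn_term false p n x j i
      - nn_term true p n x i j).
  rewrite big_mkcond [RHS]big_mkcond; apply: eq_bigr => j _.
  rewrite /nn_edge !(is_nn_void (x := x))// [i == j]eq_sym.
  case: eqVneq => //= ji; rewrite /nn_term !voidE [edist (x j) _]edistC.
  rewrite is_void_true// 1?eq_sym//.
  by case: (is_void _ _ _ _ _); case: (is_void _ _ _ _ _); rewrite /= /r /=; ring.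
rewrite (eq_bigr _ (fun i _ => E i)).
rewrite /nn_sum; under eq_bigr do rewrite !big_split/= sumrN.
rewrite !big_split/= sumrN.
have -> : \sum_(i < n) \sum_(j < n | j != i) nn_term false p n x j i =
    \sum_(i < n) \sum_(j < n | j != i) nn_term false p n x i j.
  rewrite (exchange_big_dep xpredT)//=; apply: eq_bigr => i _.
  by apply: eq_bigl => j; rewrite eq_sym.
by field.
Qed.

Definition no_ties n x := forall i j k, (i < n)%N -> (j < n)%N -> (k < n)%N ->
  uniq [:: i; j; k] -> edist (x i) (x j) != edist (x i) (x k).

Lemma is_void_inj b n x i j k : no_ties n x -> (i < n)%N -> (j < n)%N -> (k < n)%N ->
  j != i -> k != i -> is_void b n x i j -> is_void b n x i k -> j = k.
Proof.
move=> nt ni nj nk ji ki vj vk; apply/eqP; apply/negP => /negP jk.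
have := nt i j k ni nj nk; rewrite /= !inE negb_or [i == j]eq_sym [i == k]eq_sym ji ki jk.
move=> /(_ isT)/eqP; apply; apply/eqP; rewrite eq_le.
by rewrite (is_void_nearest vj)// (is_void_nearest vk).
Qed.

Lemma sum_void_le1 b n x (i : 'I_n) : no_ties n x ->
  \sum_(j < n | j != i) void b n x i j <= 1.
Proof.
move=> nt; have ni := ltn_ord i.
have [[j /andP[ji vj]]|h] := pselect (exists j : 'I_n, (j != i) && is_void b n x i j).
  rewrite (bigD1 j)//= big1 ?addr0; first by rewrite voidE vj.
  move=> k /andP[ki kj]; rewrite voidE; case: (boolP (is_void _ _ _ _ _)) => // vk.
  by move: kj; rewrite (_ : k = j) ?eqxx//; apply/val_inj; exact: (is_void_inj nt ni (ltn_ord k) (ltn_ord j) ki ji vk vj).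
rewrite big1// => j ji; rewrite voidE; case: (boolP (is_void _ _ _ _ _)) => // vj.
by exfalso; apply: h; exists j; rewrite ji.
Qed.

(** The region of a pair lies within twice its length of its first point, hence the factor 2:
    regions of far pairs are disjoint. *)
Definition far_term b p n x i j k l : R :=
  ((uniq [:: i; j; k; l]) && (2 * (edist (x i) (x j) + edist (x k) (x l)) < edist (x i) (x k))%R)%:R *
  (nn_term b p n x i j * nn_term b p n x k l).

(** The constant 4: if two pairs are not far and the edge at i is the longer one, then x_k is within
    2 (|x_i - x_j| + |x_k - x_l|) <= 4 |x_i - x_j| of x_i. *)
Definition near_term b p n x i j k : R :=
  (edist (x i) (x k) <= 4 * edist (x i) (x j))%R%:R * nn_term b p n x i j.

Lemma far_term_ge0 b p n x i j k l : 0 <= far_term b p n x i j k l.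
Proof. by rewrite mulr_ge0// mulr_ge0 ?nn_term_ge0. Qed.

Lemma near_term_ge0 b p n x i j k : 0 <= near_term b p n x i j k.
Proof. by rewrite mulr_ge0 ?nn_term_ge0. Qed.

Lemma mul_le_sqr_add (u v s t : R) : 0 <= v -> u <= v -> 0 <= s -> 0 <= t ->
  u * v <= s + t + v ^+ 2.
Proof. by move=> v0 uv s0 t0; apply: ler_wpDl; [exact: addr_ge0|rewrite expr2 ler_wpM2r]. Qed.

(* Without ties a pair of void events at distinct i and k is either far, hence with
   disjoint regions, or one of the two edges is long enough to see the other point. *)
Lemma nn_term_mul_le b p n x i j k l : no_ties n x -> 0 <= p ->
  (i < n)%N -> (j < n)%N -> (k < n)%N -> (l < n)%N -> j != i -> l != k ->
  nn_term b p n x i j * nn_term b p n x k l <= far_term b p n x i j k l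
    + ((i == k) && (j == l))%:R * nn_term b (2 * p) n x i j
    + (k != i)%:R * near_term b (2 * p) n x i j k * void b n x k l
    + (i != k)%:R * near_term b (2 * p) n x k l i * void b n x i j.
Proof.
move=> nt p0 ni nj nk nl ji lk.
have pos (B : bool) (a : R) : 0 <= a -> 0 <= B%:R * a by move=> ?; rewrite mulr_ge0.
have w0 i' j' p' : 0 <= nn_term b p' n x i' j' := nn_term_ge0 _ _ _ _ _ _.
have n0 i' j' k' p' : 0 <= near_term b p' n x i' j' k' := near_term_ge0 _ _ _ _ _ _ _.
have v0 i' j' : 0 <= void b n x i' j' := void_ge0 _ _ _ _ _.
have f0 := far_term_ge0 b p n x i j k l.
have R0 : 0 <= far_term b p n x i j k l
    + ((i == k) && (j == l))%:R * nn_term b (2 * p) n x i j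
    + (k != i)%:R * near_term b (2 * p) n x i j k * void b n x k l
    + (i != k)%:R * near_term b (2 * p) n x k l i * void b n x i j.
  by rewrite !addr_ge0// ?pos// mulr_ge0 ?pos.
have [vij|vij] := boolP (is_void b n x i j); last first.
  have -> : nn_term b p n x i j = 0 by rewrite /nn_term voidE (negbTE vij) mulr0.
  by rewrite mul0r.
have [vkl|vkl] := boolP (is_void b n x k l); last first.
  have -> : nn_term b p n x k l = 0 by rewrite /nn_term voidE (negbTE vkl) mulr0.
  by rewrite mulr0.
have sq i' j' : edist (x i') (x j') `^ (2 * p) = (edist (x i') (x j') `^ p) ^+ 2.
  by rewrite mulrC powRrM -powR_mulrn ?powR_ge0.
have [ik|ik] := eqVneq i k.
  move: lk vkl; rewrite -ik => li vil; have jl := is_void_inj nt ni nj nl ji li vij vil.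
  rewrite -jl eqxx/= !mul0r !addr0 mul1r.
  by rewrite {1 2 3}/nn_term voidE vij !mulr1 sq -expr2 lerDr far_term_ge0.
rewrite /= mul0r addr0 !mul1r [void b n x k l]voidE [void b n x i j]voidE vij vkl !mulr1.
have [far|near] := boolP ((uniq [:: i; j; k; l]) &&
    (2 * (edist (x i) (x j) + edist (x k) (x l)) < edist (x i) (x k))).
  by rewrite /far_term far mul1r -addrA lerDl addr_ge0.
have {}near : edist (x i) (x k) <= 2 * (edist (x i) (x j) + edist (x k) (x l)).
  have e0 i' j' : 0 <= edist (x i') (x j') := edist_ge0 _ _.
  rewrite leNgt; apply/negP => far; move/negP: near; apply; rewrite far andbT/= !inE !negb_or.
  (* The inequality defining far pairs itself excludes every coincidence of indices between them. *)
  have il : i != l.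
    by apply/eqP => il; move: far; rewrite -il [edist (x k) (x i)]edistC; have := e0 i j; have := e0 i k; lra.
  have jk : j != k by apply/eqP => jk; move: far; rewrite jk; have := e0 k l; have := e0 i k; lra.
  have jl : j != l.
    apply/eqP => jl; have := edist_triangle (x i) (x l) (x k).
    by move: far; rewrite jl [edist (x l) (x k)]edistC; have := e0 k l; have := e0 i l; lra.
  by rewrite [i == j]eq_sym ji ik il jk jl [k == l]eq_sym lk.
have e0 i' j' : is_void b n x i' j' ->
    nn_term b (2 * p) n x i' j' = (edist (x i') (x j') `^ p) ^+ 2.
  by move=> v; rewrite /nn_term voidE v mulr1 sq.
have e1 i' j' : is_void b n x i' j' -> nn_term b p n x i' j' = edist (x i') (x j') `^ p.
  by move=> v; rewrite /nn_term voidE v mulr1.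
have near1 i' j' k' : is_void b n x i' j' -> edist (x i') (x k') <= 4 * edist (x i') (x j') ->
    near_term b (2 * p) n x i' j' k' = (edist (x i') (x j') `^ p) ^+ 2.
  by move=> v le; rewrite /near_term le e0// mul1r.
rewrite (e1 _ _ vij) (e1 _ _ vkl).
(* The longer edge sees the first point of the other one, and the square of its weight bounds the
   product. *)
have [le|lt] := lerP (edist (x i) (x j)) (edist (x k) (x l)).
  have hk : edist (x k) (x i) <= 4 * edist (x k) (x l) by rewrite edistC; clear -near le; lra.
  rewrite (near1 _ _ _ vkl hk); apply: mul_le_sqr_add => //; first exact: powR_ge0.
  exact: (ge0_ler_powR p0 (edist_ge0 _ _) (edist_ge0 _ _) le).
have hi : edist (x i) (x k) <= 4 * edist (x i) (x j) by clear -near lt; lra.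
rewrite (near1 _ _ _ vij hi) mulrC addrAC; apply: mul_le_sqr_add => //; first exact: powR_ge0.
exact: (ge0_ler_powR p0 (edist_ge0 _ _) (edist_ge0 _ _) (ltW lt)).
Qed.

Definition far_sum b p n x : R :=
  \sum_(i < n) \sum_(j < n | j != i) \sum_(k < n) \sum_(l < n | l != k) far_term b p n x i j k l.

Definition near_sum b p n x : R :=
  \sum_(i < n) \sum_(j < n | j != i) \sum_(k < n | (k != i) && (k != j)) near_term b p n x i j k.

Lemma exchange_pairs (I : finType) (Q : I -> I -> bool) (g : I -> I -> I -> I -> R) :
  \sum_i \sum_(j | Q i j) \sum_k \sum_(l | Q k l) g i j k l =
  \sum_i \sum_(j | Q i j) \sum_k \sum_(l | Q k l) g k l i j.
Proof.
rewrite [LHS]pair_big_dep [RHS]pair_big_dep/=.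
transitivity (\sum_(u : I * I | Q u.1 u.2) \sum_(v : I * I | Q v.1 v.2) g u.1 u.2 v.1 v.2).
  by apply: eq_bigr => u _; rewrite pair_big_dep.
by rewrite exchange_big/=; apply: eq_bigr => u _; rewrite pair_big_dep.
Qed.

(** The constant 3 counts the coinciding pairs once and, for each of the two symmetric near sums,
    the terms whose third point is the other end of the edge; [near_sum] keeps three distinct
    indices. *)
Lemma nn_sum_sqr_le b p n x : no_ties n x -> 0 <= p ->
  nn_sum b p n x ^+ 2 <= far_sum b p n x + 3 * nn_sum b (2 * p) n x
    + 2 * near_sum b (2 * p) n x.
Proof.
move=> nt p0.
pose S := \sum_(i < n) \sum_(j < n | j != i) \sum_(k < n)
  (k != i)%:R * near_term b (2 * p) n x i j k.
have SE : S <= nn_sum b (2 * p) n x + near_sum b (2 * p) n x.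
  rewrite -big_split/=; apply: ler_sum => i _; rewrite -big_split/=; apply: ler_sum => j ji.
  rewrite (bigD1 j)//= ji mul1r lerD//.
    by rewrite /near_term ler_piMl ?nn_term_ge0// lern1 leq_b1.
  rewrite [leRHS]big_mkcond [leLHS]big_mkcond/=; apply: ler_sum => k _.
  by case: eqVneq => //= ki; case: eqVneq => //= _; rewrite ?mul0r ?mul1r.
have D1 : \sum_(i < n) \sum_(j < n | j != i) \sum_(k < n) \sum_(l < n | l != k)
    ((i == k) && (j == l))%:R * nn_term b (2 * p) n x i j = nn_sum b (2 * p) n x.
  apply: eq_bigr => i _; apply: eq_bigr => j ji.
  rewrite (bigD1 i)//= (bigD1 j)//= !eqxx mul1r big1 ?addr0; last first.
    by move=> l /andP[_ lj]; rewrite eq_sym (negbTE lj) mul0r.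
  rewrite big1 ?addr0// => k ki; rewrite big1// => l _.
  by rewrite eq_sym (negbTE ki) mul0r.
(* Without ties the sum over l of the void indicators at k is at most 1, which removes one of the
   four summations. *)
have S1 : \sum_(i < n) \sum_(j < n | j != i) \sum_(k < n) \sum_(l < n | l != k)
    (k != i)%:R * near_term b (2 * p) n x i j k * void b n x k l <= S.
  apply: ler_sum => i _; apply: ler_sum => j ji; apply: ler_sum => k _.
  rewrite -mulr_sumr ler_piMr//; first by rewrite mulr_ge0// near_term_ge0.
  exact: sum_void_le1.
have S2 : \sum_(i < n) \sum_(j < n | j != i) \sum_(k < n) \sum_(l < n | l != k)
    (i != k)%:R * near_term b (2 * p) n x k l i * void b n x i j <= S.
  apply: le_trans S1; rewrite le_eqVlt; apply/orP; left; apply/eqP.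
  exact: (exchange_pairs (fun i j : 'I_n => j != i) (fun i j k l : 'I_n =>
    (i != k)%:R * near_term b (2 * p) n x k l i * void b n x i j)).
have := lerD S1 S2.
suff : nn_sum b p n x ^+ 2 <= far_sum b p n x + nn_sum b (2 * p) n x +
   \sum_(i < n) \sum_(j < n | j != i) \sum_(k < n) \sum_(l < n | l != k)
    (k != i)%:R * near_term b (2 * p) n x i j k * void b n x k l +
    \sum_(i < n) \sum_(j < n | j != i) \sum_(k < n) \sum_(l < n | l != k)
    (i != k)%:R * near_term b (2 * p) n x k l i * void b n x i j by lra.
rewrite -D1 /far_sum -!big_split/= expr2 {1}/nn_sum mulr_suml.
apply: ler_sum => i _; rewrite -!big_split/= mulr_suml; apply: ler_sum => j ji.
rewrite -!big_split/= mulr_sumr; apply: ler_sum => k _.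
rewrite -!big_split/= mulr_sumr; apply: ler_sum => l lk.
exact: nn_term_mul_le.
Qed.

End VoidSums.

(** * First and second moments *)

Lemma integral_sum_cond d (T : measurableType d) (R : realType)
    (m : {measure set T -> \bar R}) (I : finType) (Q : pred I) (h : I -> T -> R) :
  (forall i, measurable_fun setT (h i)) -> (forall i x, 0 <= h i x) ->
  (\int[m]_x (\sum_(i | Q i) h i x)%:E = \sum_(i | Q i) \int[m]_x (h i x)%:E)%E.
Proof.
move=> mh h0; under eq_integral do rewrite big_mkcond -sumEFin.
rewrite ge0_integral_sum//; last 2 first.
- by move=> i; case: (Q i) => //; exact/measurable_EFinP.
- by move=> i x _; case: (Q i) => //; rewrite lee_fin.
by rewrite [RHS]big_mkcond; apply: eq_bigr => i _; case: (Q i) => //; rewrite integral0.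
Qed.

Lemma integral_sum_le d (T : measurableType d) (R : realType)
    (m : {measure set T -> \bar R}) (I : finType) (Q : pred I) (h : I -> T -> R) (c : R) :
  (forall i, measurable_fun setT (h i)) -> (forall i x, 0 <= h i x) -> 0 <= c ->
  (forall i, Q i -> \int[m]_x (h i x)%:E <= c%:E)%E ->
  (\int[m]_x (\sum_(i | Q i) h i x)%:E <= (#|I|%:R * c)%:E)%E.
Proof.
move=> mh h0 c0 hc; rewrite integral_sum_cond//.
apply: (@le_trans _ _ (\sum_(i : I) c%:E)%E).
  rewrite big_mkcond/=; apply: lee_sum => i _; case: ifP => Qi; first exact: hc.
  by rewrite lee_fin.
by rewrite sumEFin sumr_const mulr_natl.
Qed.

Lemma measurable_sum_cond d (T : measurableType d) (R : realType) (I : finType) (Q : pred I)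
    (h : I -> T -> R) : (forall i, measurable_fun setT (h i)) ->
  measurable_fun setT (fun x => \sum_(i | Q i) h i x).
Proof.
move=> mh; under eq_fun do rewrite big_mkcond; apply: measurable_sum => i.
by case: (Q i).
Qed.

Lemma ae_nat d (T : measurableType d) (R : realType) (m : {measure set T -> \bar R})
    (Q : nat -> T -> Prop) :
  (forall n, {ae m, forall x, Q n x}) -> {ae m, forall x, forall n, Q n x}.
Proof.
move=> h; have := negligible_bigcup h; apply: negligibleS => x /= nQ.
by apply: contrapT => H; apply: nQ => n; apply: contrapT => nQ; apply: H; exists n.
Qed.

Lemma measurable_eqr_set d (T : measurableType d) (R : realType) (h1 h2 : T -> R) :
  measurable_fun setT h1 -> measurable_fun setT h2 -> measurable [set x | h1 x = h2 x].
Proof.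
move=> m1 m2; rewrite [X in measurable X](_ : _ =
  ~` ([set x | h1 x < h2 x] `|` [set x | h2 x < h1 x])).
  by apply: measurableC; apply: measurableU; exact: measurable_ltr_set.
apply/seteqP; split => x /=; first by move=> ->; rewrite ltxx => -[].
by move=> h; apply/eqP; rewrite eq_le !leNgt; apply/andP; split; apply/negP => lt; apply: h; [right|left].
Qed.

Lemma indic_pred (R : realType) (T : Type) (Q : pred T) x : \1_[set y | Q y] x = (Q x)%:R :> R.
Proof.
by rewrite indicE; congr (_%:R); congr nat_of_bool; apply/idP/idP => [/set_mem|/mem_set].
Qed.

Section Moments.
Context (R : realType) (d : nat) (mu F : {measure set (d.-tuple R) -> \bar R}).
Local Notation T := (d.-tuple R).
Local Notation V := (ball_volume mu).
Variables (f : T -> R) (K : set T) (c C D : R).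
Hypothesis G : density_on_convex mu F f K c C D.
Context (dO : measure_display) (O : measurableType dO) (P : probability O R).
Variable X : nat -> O -> T.
Hypothesis mX : forall i, measurable_fun setT (X i).
Hypothesis indep : forall (s : seq nat) (A : nat -> set T), uniq s ->
  (forall i, measurable (A i)) ->
  P (\bigcap_(i in [set` s]) (X i @^-1` A i)) =
  (\big[*%E/1%E]_(i <- s) P (X i @^-1` A i))%E.
Hypothesis law : forall i A, measurable A -> P (X i @^-1` A) = F A.
Let Hmu := doc_lebesgue G.
Let d0 := doc_dim G.
Let mf := doc_measurable G.
Let f0 := doc_ge0 G.
Let smu := lebesgue_sigma_finite Hmu.
Let sF := F_sigma_finite G.
Local Notation J := (void_integral mu F f).
Local Notation q := (q F).
Let q1 b x y : 0 <= 1 - q b x y. Proof. by have /andP[_ ?] := q01 G b x y; rewrite subr_ge0. Qed.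

Lemma integral_F_F (g : T * T -> R) : measurable_fun setT g -> (forall z, 0 <= g z) ->
  (\int[F]_x \int[F]_y (g (x, y))%:E = \int[mu]_x \int[mu]_y (f x * f y * g (x, y))%:E)%E.
Proof.
move=> mg g0.
have mg1 x : measurable_fun setT (fun y => g (x, y)) by exact: (measurableT_comp mg (g := pair x)).
have HF := doc_F G.
under eq_integral do rewrite (ge0_integral_density smu sF mf f0 (mg1 _) (fun=> g0 _) HF).
rewrite (@tonelli_exchange _ _ _ _ _ F mu sF smu (fun z => (g z * f z.2)%:E)); last 2 first.
- by apply/measurable_EFinP; apply: measurable_funM => //; exact: measurableT_comp.
- by move=> z; rewrite lee_fin mulr_ge0.
under eq_integral => y _.
  rewrite (@ge0_integral_density _ _ _ mu F f (fun x => g (x, y) * f y))//; last 2 first.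
  - by apply: measurable_funM => //; exact: (measurableT_comp mg (g := fun x => (x, y))).
  - by move=> x; rewrite mulr_ge0.
  over.
rewrite -(@tonelli_exchange _ _ _ _ _ mu mu smu smu (fun z => (g z * f z.2 * f z.1)%:E)); last 2 first.
- apply/measurable_EFinP; apply: measurable_funM; last exact: measurableT_comp.
  by apply: measurable_funM => //; exact: measurableT_comp.
- by move=> z; rewrite lee_fin !mulr_ge0.
by apply: eq_integral => x _; apply: eq_integral => y _; congr EFin; rewrite /=; ring.
Qed.

Lemma measurable_region_set b dQ (Q : measurableType dQ) (u v z : Q -> T) :
  measurable_fun setT u -> measurable_fun setT v -> measurable_fun setT z ->
  measurable [set w | ~ region b (u w) (v w) (z w)].
Proof.
move=> mu' mv mz; rewrite [X in measurable X](_ : _ = ~` (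
    [set w | edist (u w) (z w) < edist (u w) (v w)] `|`
    (if b then [set w | edist (v w) (z w) < edist (u w) (v w)] else set0))).
  apply: measurableC; apply: measurableU; first by apply: measurable_ltr_set; exact: measurable_edist.
  by case: b => //; apply: measurable_ltr_set; exact: measurable_edist.
apply/seteqP; split => w /= h1 h2; apply: h1; rewrite /region/=; case: b h2 => /=.
- by move=> [->//|->]; rewrite orbT.
- by move=> [->//|//].
- by move=> /orP[]; [left|right].
- by rewrite /region/= orbF => h; left.
Qed.

Lemma measurable_void b n i j : measurable_fun setT (fun w => void b n (X^~ w) i j).
Proof.
apply: measurable_prod => k _.
exact: (measurable_indic (measurable_region_set b (mX i) (mX j) (mX k))).
Qed.

Lemma measurable_nn_term b p n i j : measurable_fun setT (fun w => nn_term b p n (X^~ w) i j).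
Proof.
by apply: measurable_funM; [exact: measurable_edist_powR|exact: measurable_void].
Qed.

Lemma measurable_nn_sum b p n : measurable_fun setT (fun w => nn_sum b p n (X^~ w)).
Proof.
apply: measurable_sum_cond => i; apply: measurable_sum_cond => j.
exact: measurable_nn_term.
Qed.

Lemma F_setC A : measurable A -> fine (F (~` A)) = 1 - fine (F A).
Proof.
move=> mA; have : (1 = F A + F (~` A))%E.
  by rewrite -(doc_F1 G) -(setUv A); apply: measureU => //; [exact: measurableC|exact: setICr].
rewrite -(fineK (F_fin G mA)) -(fineK (F_fin G (measurableC mA))) -EFinD => -[->].
by rewrite addrC addKr.
Qed.

Let mtn n (i : 'I_n) : measurable_fun setT (fun z : n.-tuple T * T => tnth z.1 i).
Proof. exact: (measurableT_comp (measurable_tnth i)). Qed.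

(** Given the points numbered by t, a tie places X k on a fixed sphere, which is null for F because
    F has a bounded density. *)
Lemma ae_tie_free n (t : n.-tuple nat) k (i : 'I_n) (r : n.-tuple T -> R) :
  uniq (t ++ [:: k]) -> measurable_fun setT r ->
  {ae P, forall w, edist (X (tnth t i) w) (X k w) <> r (subsample X t w)}.
Proof.
move=> ut mr.
pose B : set (n.-tuple T * T) := [set z | edist (tnth z.1 i) z.2 = r z.1].
have mB : measurable B.
  apply: measurable_eqr_set; first by apply: measurable_edist => //; exact: mtn.
  exact: measurableT_comp.
have mk : measurable_fun setT (fun w => (subsample X t w, X k w)).
  by apply: measurable_fun_pair => //; exact: measurable_subsample.
have mA : measurable [set w | B (subsample X t w, X k w)].
  exact: (measurable_preimage mk mB).
have F0 u : F [set z | B (u, z)] = 0%E.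
  apply/eqP; rewrite eq_le measure_ge0 andbT.
  have := F_le_mu G (measurable_sphere (tnth u i) (r u)).
  by rewrite [X in (_ <= _ * X)%E](lebesgue_sphere Hmu _ _ d0) mule0; exact.
have := integral_void mX indep law ut (measurable_cst (1 : R)) (fun=> ler01) mB.
under eq_integral do rewrite mul1r big_seq1.
under [X in _ = X -> _]eq_integral do rewrite F0 mul1r expr1.
rewrite integral0 => H.
have : P.-negligible [set w | B (subsample X t w, X k w)].
  by apply/negligibleP => //; rewrite -[RHS]H [RHS]integral_indic// setIT.
apply: negligibleS => w /= /contrapT E.
by rewrite /B/= tnth_subsample.
Qed.

Lemma ae_no_ties n : {ae P, forall w, no_ties n (X^~ w) /\ uniq (sample X n w)}.
Proof.
have T3 : {ae P, forall w, forall i j k, uniq [:: i; j; k] ->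
    edist (X i w) (X j w) <> edist (X i w) (X k w)}.
  apply: ae_nat => i; apply: ae_nat => j; apply: ae_nat => k.
  have [u|u] := boolP (uniq [:: i; j; k]); last exact: aeW.
  have := @ae_tie_free 2 [tuple i; j] k ord0 (fun t => edist (tnth t ord0) (tnth t ord_max)) u.
  move=> /(_ (measurable_edist (measurable_tnth _) (measurable_tnth _))).
  apply: filterS => w; rewrite !tnth_subsample => h _ E; exact: h.
(* A sphere of radius 0: the sample points are almost surely distinct. *)
have T2 : {ae P, forall w, forall i k, i != k -> edist (X i w) (X k w) <> 0}.
  apply: ae_nat => i; apply: ae_nat => k.
  have [->|ik] := eqVneq i k; first exact: aeW.
  have := @ae_tie_free 1 [tuple i] k ord0 (fun=> 0); rewrite /= inE ik => /(_ isT).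
  by move=> /(_ (measurable_cst _)); apply: filterS.
apply: filterS2 T3 T2 => w t3 t2; split.
  by move=> i j k _ _ _ u; apply/eqP; exact: t3.
rewrite map_inj_in_uniq ?iota_uniq// => i j _ _ E; apply/eqP; apply/negP => /negP ij.
by apply: (t2 i j ij); rewrite E edistxx.
Qed.

(** The conditional mean of the weight of a pair, given its two points, when m further points must
    avoid its region. *)
Definition pair_void b p m (z : T * T) : R := edist z.1 z.2 `^ p * (1 - q b z.1 z.2) ^+ m.

Lemma pair_void_ge0 b p m z : 0 <= pair_void b p m z.
Proof. by rewrite mulr_ge0 ?powR_ge0// exprn_ge0. Qed.

Lemma measurable_pair_void b p m dQ (Q : measurableType dQ) (u v : Q -> T) :
  measurable_fun setT u -> measurable_fun setT v ->
  measurable_fun setT (fun w => pair_void b p m (u w, v w)).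
Proof.
move=> mu' mv; apply: measurable_funM; first exact: measurable_edist_powR.
by apply: measurable_funX; apply: measurable_funB => //; exact: (measurable_q2 G).
Qed.

Lemma integral_pair_void b p m i j : i != j ->
  (\int[P]_w (pair_void b p m (X i w, X j w))%:E = J b p m)%E.
Proof.
move=> ij; have mh : measurable_fun setT (pair_void b p m).
  have := measurable_pair_void b p m (measurable_fst (T1 := T) (T2 := T)) measurable_snd.
  by apply: eq_measurable_fun => -[].
rewrite (law_integral2 mX indep law ij mh); last exact: pair_void_ge0.
exact: integral_F_F mh (pair_void_ge0 _ _ _).
Qed.

Lemma integral_nn_term b p n i j : (i < n)%N -> (j < n)%N -> i != j ->
  (\int[P]_w (nn_term b p n (X^~ w) i j)%:E = J b p (n - 2))%E.
Proof.
move=> ni nj ij; pose t := [tuple i; j].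
have ut : uniq t by rewrite /= inE ij.
pose g (u : 2.-tuple T) := edist (tnth u ord0) (tnth u ord_max) `^ p.
have mg : measurable_fun setT g by apply: measurable_edist_powR => //; exact: measurable_tnth.
pose B := [set z : 2.-tuple T * T | ~ region b (tnth z.1 ord0) (tnth z.1 ord_max) z.2].
have mB : measurable B by apply: measurable_region_set => //; exact: mtn.
have := integral_void mX indep law (uniq_others n ut) mg (fun=> powR_ge0 _ _) mB.
rewrite size_others//; last by move=> k; rewrite !inE => /orP[] /eqP->.
have E w : g (subsample X t w) * \prod_(k <- others n t) \1_B (subsample X t w, X k w) =
    nn_term b p n (X^~ w) i j.
  rewrite /nn_term /void /g !tnth_subsample; congr (_ * _).
  by apply: eq_bigr => k _; apply: indic_congr; rewrite /B/= !tnth_subsample.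
under eq_integral do rewrite E; move=> ->.
transitivity (\int[P]_w (pair_void b p (n - 2) (X i w, X j w))%:E)%E.
  apply: eq_integral => w _; congr EFin; rewrite /pair_void /g !tnth_subsample; congr (_ * _ ^+ _).
  rewrite -F_setC; last exact: measurable_region.
  by congr (fine (F _)); apply/seteqP; split => z; rewrite /B/= !tnth_subsample.
exact: integral_pair_void.
Qed.

(* The two regions are disjoint, and 1 - s - t <= (1 - s) (1 - t). *)
Lemma far_void_le b x y u v m : 2 * (edist x y + edist u v) < edist x u ->
  fine (F [set z | ~ region b x y z /\ ~ region b u v z]) ^+ m <=
  (1 - q b x y) ^+ m * (1 - q b u v) ^+ m.
Proof.
move=> far; have mA := measurable_region b x y; have mB := measurable_region b u v.
rewrite [X in F X](_ : _ = ~` (region b x y `|` region b u v)); last by rewrite setCU.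
have disj : region b x y `&` region b u v = set0.
  apply/seteqP; split => // z [] /region_cball h1 /region_cball h2.
  have := edist_triangle x z u; rewrite [edist z u]edistC.
  by move: h1 h2; rewrite /cball/=; lra.
have H : fine (F (~` (region b x y `|` region b u v))) = 1 - (q b x y + q b u v).
  rewrite F_setC; last exact: measurableU.
  have -> : F (region b x y `|` region b u v) = (F (region b x y) + F (region b u v))%E.
    exact: measureU.
  by rewrite !(qE G).
rewrite H -exprMn lerXn2r ?nnegrE ?mulr_ge0//.
  by rewrite -H fine_ge0.
have := q01 G b x y; have := q01 G b u v; nra.
Qed.

Local Notation o4 k := (@Ordinal 4 k isT).

(** Each void event is relaxed by letting only the points outside all four indices count. Given the
    four points these n - 4 avoid both regions, the product bound separates the pairs, and the pairs
    are independent. *)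
Lemma integral_far_term b p n i j k l : uniq [:: i; j; k; l] ->
  (i < n)%N -> (j < n)%N -> (k < n)%N -> (l < n)%N ->
  (\int[P]_w (far_term b p n (X^~ w) i j k l)%:E <= J b p (n - 4) * J b p (n - 4))%E.
Proof.
move=> ut ni nj nk nl; pose t := [tuple i; j; k; l].
pose r (u : 4.-tuple T) a a' := edist (tnth u a) (tnth u a').
pose A := [set u : 4.-tuple T | 2 * (r u (o4 0) (o4 1) + r u (o4 2) (o4 3)) < r u (o4 0) (o4 2)].
have mr a a' : measurable_fun setT (fun u => r u a a').
  by apply: measurable_edist; exact: measurable_tnth.
have mA : measurable A.
  apply: measurable_ltr_set => //; apply: measurable_funM => //; exact: measurable_funD.
pose g (u : 4.-tuple T) := \1_A u * (r u (o4 0) (o4 1) `^ p * r u (o4 2) (o4 3) `^ p).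
have mg : measurable_fun setT g.
  apply: measurable_funM => //; apply: measurable_funM;
  by apply: measurable_edist_powR; exact: measurable_tnth.
have g0 u : 0 <= g u by rewrite !mulr_ge0 ?powR_ge0.
pose B := [set z : 4.-tuple T * T | ~ region b (tnth z.1 (o4 0)) (tnth z.1 (o4 1)) z.2] `&`
  [set z : 4.-tuple T * T | ~ region b (tnth z.1 (o4 2)) (tnth z.1 (o4 3)) z.2].
have mB : measurable B.
  by apply: measurableI; apply: measurable_region_set => //; exact: mtn.
have mX4 := measurable_subsample mX t.
have st a : tnth (subsample X t (a : O)) (o4 0) = X i a /\ tnth (subsample X t a) (o4 1) = X j a
    /\ tnth (subsample X t a) (o4 2) = X k a /\ tnth (subsample X t a) (o4 3) = X l a.
  by rewrite !tnth_subsample.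
apply: (@le_trans _ _ (\int[P]_w (g (subsample X t w) *
    \prod_(a <- others n t) \1_B (subsample X t w, X a w))%:E)%E).
  apply: ge0_integral_leE.
  - rewrite /far_term; apply: measurable_funM; last by apply: measurable_funM; exact: measurable_nn_term.
    have : measurable_fun setT (\1_(subsample X t @^-1` A) : O -> R).
      exact/measurable_indic/measurable_preimage.
    apply: eq_measurable_fun => w _; rewrite ut/= -[LHS]/(\1_A (subsample X t w)) /A indic_pred /r.
    by have [-> [-> [-> ->]]] := st w.
  - apply: measurable_funM; first exact: measurableT_comp.
    apply: measurable_prod => a _; apply: (measurableT_comp (measurable_indic mB)).
    exact: measurable_fun_pair.
  - by move=> w; exact: far_term_ge0.
  - move=> w; have [st0 [st1 [st2 st3]]] := st w.
    rewrite /far_term /nn_term ut/= /g /r st0 st1 st2 st3 /A indic_pred /r st0 st1 st2 st3.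
    rewrite -[X in _ <= X]mulrA ler_wpM2l// mulrACA ler_wpM2l ?mulr_ge0 ?powR_ge0//.
    pose S z := ~ region b (X i w) (X j w) z /\ ~ region b (X k w) (X l w) z.
    rewrite (eq_bigr (fun a => \1_[set z | S z] (X a w))); last first.
      by move=> a _; apply: indic_congr; rewrite /B/= st0 st1 st2 st3.
    rewrite prod_indic !voidE.
    have [v1|_] := boolP (is_void _ _ _ i j); last by rewrite mul0r.
    have [v2|_] := boolP (is_void _ _ _ k l); last by rewrite mulr0.
    rewrite mulr1; case: asboolP => // H; exfalso; apply: H => a.
    rewrite mem_others !inE !negb_or => /and5P[na ai aj ak al].
    by split; [move/asboolP: v1; exact|move/asboolP: v2; exact].
rewrite (integral_void mX indep law (uniq_others n ut) mg g0 mB).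
rewrite size_others//; last first.
  by move=> a; rewrite !inE => /or4P[] /eqP->.
pose h (z : 2.-tuple T * 2.-tuple T) := pair_void b p (n - 4) (tnth z.1 ord0, tnth z.1 ord_max) *
  pair_void b p (n - 4) (tnth z.2 ord0, tnth z.2 ord_max).
have m2 := measurable_pair_void b p (n - 4) (measurable_tnth (T := T) (ord0 : 'I_2)) (measurable_tnth ord_max).
have mh : measurable_fun setT h.
  by apply: measurable_funM; exact: (measurableT_comp m2).
have h0 z : 0 <= h z by rewrite mulr_ge0// pair_void_ge0.
pose t1 := [tuple i; j]; pose t2 := [tuple k; l].
have mXX i' j' := measurable_pair_void b p (n - 4) (mX i') (mX j').
apply: (@le_trans _ _ (\int[P]_w (pair_void b p (n - 4) (X i w, X j w) *
    pair_void b p (n - 4) (X k w, X l w))%:E)%E).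
  apply: ge0_integral_leE.
  - apply: measurable_funM; first exact: measurableT_comp.
    apply: measurable_funX; apply: measurableT_comp => //.
    apply: (measurableT_comp (measurable_section_measure sF mB)) => //.
  - exact: measurable_funM.
  - by move=> w; rewrite mulr_ge0// exprn_ge0// fine_ge0.
  - move=> w; have [st0 [st1 [st2 st3]]] := st w.
    rewrite /g /A indic_pred /r st0 st1 st2 st3.
    case: ltP => [far|_]; last by rewrite !mul0r mulr_ge0// pair_void_ge0.
    rewrite mul1r /pair_void/= mulrACA ler_wpM2l ?mulr_ge0 ?powR_ge0//.
    rewrite [X in F X](_ : _ =
      [set z | ~ region b (X i w) (X j w) z /\ ~ region b (X k w) (X l w) z]).
      exact: far_void_le.
    by apply/seteqP; split => z; rewrite /B/= st0 st1 st2 st3.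
have := @decouple _ _ _ _ _ P X mX indep _ _ t1 t2 h ut mh h0.
rewrite /h/=; under eq_integral do rewrite !tnth_subsample; move=> ->.
under eq_integral => w _.
  under eq_integral do rewrite !tnth_subsample.
  rewrite ge0_integral_scaleE ?pair_void_ge0//; last by move=> ?; exact: pair_void_ge0.
  over.
rewrite ge0_integralZr//.
- have [ij kl] : i != j /\ k != l.
    by move: ut; rewrite /= !inE !negb_or => /and4P[/and3P[-> _ _] _ -> _].
  by rewrite [X in (X * _)%E]integral_pair_void// [X in (_ * X)%E]integral_pair_void.
- by apply/measurable_EFinP; exact: mXX.
- by move=> w _; rewrite lee_fin pair_void_ge0.
- by apply: integral_ge0 => w _; rewrite lee_fin pair_void_ge0.
Qed.

Lemma lebesgue_cball_le x r : 0 <= r -> (mu (cball x r) <= (r ^+ d * V)%:E)%E.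
Proof.
rewrite le_eqVlt => /predU1P[<-|r0]; last by rewrite (lebesgue_cball Hmu).
rewrite expr0n gtn_eqF//= mul0r [X in mu X](_ : _ = [set z | edist x z = 0]).
  by rewrite [X in (X <= _)%E](lebesgue_sphere Hmu x 0 d0).
apply/seteqP; split => z /=; last by rewrite /cball/= => ->.
by rewrite /cball/= => le; apply/eqP; rewrite eq_le le edist_ge0.
Qed.

Local Notation o3 k := (@Ordinal 3 k isT).

(** Two integrations in turn: first the n - 3 further points, then x_k, which lies in a ball of
    radius 4 |x_i - x_j| with probability at most C 4^d V |x_i - x_j|^d. This raises the exponent of
    the weight by d. *)
Lemma integral_near_term b p n i j k : 0 <= p -> uniq [:: i; j; k] ->
  (i < n)%N -> (j < n)%N -> (k < n)%N ->
  (\int[P]_w (near_term b p n (X^~ w) i j k)%:E <=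
   (C * (4 ^+ d * V))%:E * J b (p + d%:R) (n - 3))%E.
Proof.
move=> p0 ut ni nj nk; pose t := [tuple i; j; k].
pose r (u : 3.-tuple T) a a' := edist (tnth u a) (tnth u a').
pose A := [set u : 3.-tuple T | r u (o3 0) (o3 2) <= 4 * r u (o3 0) (o3 1)].
have mr a a' : measurable_fun setT (fun u => r u a a').
  by apply: measurable_edist; exact: measurable_tnth.
have mA : measurable A.
  rewrite (_ : A = ~` [set u | 4 * r u (o3 0) (o3 1) < r u (o3 0) (o3 2)]).
    by apply: measurableC; apply: measurable_ltr_set => //; apply: measurable_funM.
  by apply/seteqP; split => u; rewrite /A/= leNgt => /negP.
pose g (u : 3.-tuple T) := \1_A u * r u (o3 0) (o3 1) `^ p.
have mg : measurable_fun setT g.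
  apply: measurable_funM => //.
  by apply: measurable_edist_powR; exact: measurable_tnth.
have g0 u : 0 <= g u by rewrite mulr_ge0 ?powR_ge0.
pose B := [set z : 3.-tuple T * T | ~ region b (tnth z.1 (o3 0)) (tnth z.1 (o3 1)) z.2].
have mB : measurable B by apply: measurable_region_set => //; exact: mtn.
have mX3 := measurable_subsample mX t.
have st a : [/\ tnth (subsample X t (a : O)) (o3 0) = X i a, tnth (subsample X t a) (o3 1) = X j a
    & tnth (subsample X t a) (o3 2) = X k a].
  by rewrite !tnth_subsample.
apply: (@le_trans _ _ (\int[P]_w (g (subsample X t w) *
    \prod_(a <- others n t) \1_B (subsample X t w, X a w))%:E)%E).
  apply: ge0_integral_leE.
  - rewrite /near_term; apply: measurable_funM; last exact: measurable_nn_term.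
    have : measurable_fun setT (\1_(subsample X t @^-1` A) : O -> R).
      exact/measurable_indic/measurable_preimage.
    apply: eq_measurable_fun => w _; rewrite -[LHS]/(\1_A (subsample X t w)) /A indic_pred /r.
    by have [-> -> ->] := st w.
  - apply: measurable_funM; first exact: measurableT_comp.
    apply: measurable_prod => a _; apply: (measurableT_comp (measurable_indic mB)).
    exact: measurable_fun_pair.
  - by move=> w; exact: near_term_ge0.
  - move=> w; have [st0 st1 st2] := st w.
    rewrite /near_term /nn_term /g /A indic_pred /r st0 st1 st2.
    rewrite -[X in _ <= X]mulrA ler_wpM2l// ler_wpM2l ?powR_ge0//.
    rewrite (eq_bigr (fun a => \1_(~` region b (X i w) (X j w)) (X a w))); last first.
      by move=> a _; apply: indic_congr; rewrite /B/= st0 st1.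
    rewrite prod_indic !voidE; have [v1|//] := boolP (is_void _ _ _ i j).
    case: asboolP => // H; exfalso; apply: H => a.
    rewrite mem_others !inE !negb_or => /and4P[na ai aj ak].
    by move/asboolP: v1; exact.
rewrite (integral_void mX indep law (uniq_others n ut) mg g0 mB).
rewrite size_others//; last by move=> a; rewrite !inE => /or3P[] /eqP->.
pose t1 := [tuple i; j]; pose m := (n - 3)%N.
pose g1 (u : 2.-tuple T) := pair_void b p m (tnth u ord0, tnth u ord_max).
have mg1 : measurable_fun setT g1.
  exact: measurable_pair_void (measurable_tnth _) (measurable_tnth _).
pose B1 := [set z : 2.-tuple T * T | edist (tnth z.1 ord0) z.2 <= 4 * edist (tnth z.1 ord0) (tnth z.1 ord_max)].
have mB1 : measurable B1.
  rewrite (_ : B1 = ~` [set z | 4 * edist (tnth z.1 ord0) (tnth z.1 ord_max) < edist (tnth z.1 ord0) z.2]).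
    apply: measurableC; apply: measurable_ltr_set.
      by apply: measurable_funM => //; apply: measurable_edist; exact: mtn.
    by apply: measurable_edist => //; exact: mtn.
  by apply/seteqP; split => u; rewrite /B1/= leNgt => /negP.
have ut1 : uniq (t1 ++ [:: k]) by [].
have := integral_void mX indep law ut1 mg1 (fun=> pair_void_ge0 _ _ _ _) mB1.
rewrite (_ : (fun w => (g1 (subsample X t1 w) * \prod_(a <- [:: k]) \1_B1 (subsample X t1 w, X a w))%:E) =
  (fun w => (g (subsample X t w) * fine (F [set z | B (subsample X t w, z)]) ^+ (n - size t))%:E)); last first.
  apply/funext => w; congr EFin; have [st0 st1 st2] := st w.
  rewrite big_seq1 /B1 (indic_pred R (fun z : 2.-tuple T * T =>
    edist (tnth z.1 ord0) z.2 <= 4 * edist (tnth z.1 ord0) (tnth z.1 ord_max))) /g1 !tnth_subsample.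
  rewrite /g /A indic_pred /r st0 st1 st2 /pair_void/= mulrC mulrA; congr (_ * _ ^+ _).
  rewrite -F_setC; last exact: measurable_region.
  by congr (fine (F _)); apply/seteqP; split => z; rewrite /B/= st0 st1.
move=> ->; have ij : i != j by move: ut; rewrite /= !inE !negb_or => /and3P[/andP[]].
rewrite -(integral_pair_void _ _ _ ij).
have kC : 0 <= C * (4 ^+ d * V).
  by rewrite mulr_ge0 ?(C_ge0 G)// mulr_ge0 ?exprn_ge0// ltW// (ball_volume_gt0 Hmu).
rewrite -ge0_integral_scaleE//; last 2 first.
- exact: measurable_pair_void.
- by move=> w; exact: pair_void_ge0.
apply: ge0_integral_leE.
- apply: measurable_funM; first exact: (measurableT_comp mg1 (measurable_subsample mX t1)).
  apply: measurable_funX; apply: measurableT_comp => //.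
  exact: (measurableT_comp (measurable_section_measure sF mB1) (measurable_subsample mX t1)).
- by apply: measurable_funM => //; exact: measurable_pair_void.
- by move=> w; rewrite mulr_ge0 ?pair_void_ge0// exprn_ge0// fine_ge0.
- move=> w; rewrite expr1 /g1 !tnth_subsample.
  have e0 : 0 <= edist (X i w) (X j w) := edist_ge0 _ _.
  have : F [set z | B1 (subsample X t1 w, z)] = F (cball (X i w) (4 * edist (X i w) (X j w))).
    by congr (F _); apply/seteqP; split => z; rewrite /B1/= !tnth_subsample.
  move=> ->; have mc := measurable_cball (X i w) (4 * edist (X i w) (X j w)).
  have : fine (F (cball (X i w) (4 * edist (X i w) (X j w)))) <=
      C * (4 ^+ d * V) * edist (X i w) (X j w) ^+ d.
    rewrite -lee_fin fineK ?(F_fin G)//; apply: le_trans (F_le_mu G mc) _.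
    rewrite -!mulrA EFinM lee_wpmul2l ?lee_fin ?(C_ge0 G)//.
    apply: le_trans (lebesgue_cball_le _ _) _; first by rewrite mulr_ge0.
    by rewrite lee_fin exprMn mulrAC mulrA.
  move=> /(ler_wpM2l (pair_void_ge0 b p m (X i w, X j w))) /le_trans; apply.
  have pd : (p + d%:R == 0) = false by rewrite gt_eqF// ltr_wpDl// ltr0n.
  rewrite /pair_void/= powRD ?pd//.
  by rewrite powR_mulrn// le_eqVlt; apply/orP; left; apply/eqP; ring.
Qed.

End Moments.

(** * From moments to convergence in L2 *)

Section SquareIntegrals.
Context (R : realType) (dO : measure_display) (O : measurableType dO) (P : probability O R).

Import HBNNSimple.

(* Spares a proof that NN_weight is measurable in the sample point. *)
Lemma ae_integral_le_nonmeasurable (g h : O -> R) : (forall w, 0 <= g w) -> (forall w, 0 <= h w) ->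
  measurable_fun setT h -> {ae P, forall w, g w <= h w} ->
  (\int[P]_w (g w)%:E <= \int[P]_w (h w)%:E)%E.
Proof.
move=> g0 h0 mh gh; rewrite ge0_integralTE//.
apply: ge_ereal_sup => _ [k kg <-].
rewrite -integralT_nnsfun; apply: ae_ge0_le_integral => //.
- by move=> w _; rewrite lee_fin.
- exact/measurable_EFinP.
- by move=> w _; rewrite lee_fin.
- exact/measurable_EFinP.
- by apply: filterS gh => w gh _; apply: le_trans (kg w) _; rewrite lee_fin.
Qed.

(** The mean of (Y - c)^2 is E Y^2 - 2 c E Y + c^2; with c >= 0 and E Y known, an upper bound on E
    Y^2 controls it. *)
Lemma L2_of_moments (Y : nat -> O -> R) (c : R) (e s : nat -> R) : 0 <= c ->
  (forall n, measurable_fun setT (Y n)) -> (forall n w, 0 <= Y n w) ->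
  (\forall n \near \oo, (\int[P]_w (Y n w)%:E = (e n)%:E)%E) ->
  (\forall n \near \oo, (\int[P]_w (Y n w ^+ 2)%:E <= (s n)%:E)%E) ->
  e n @[n --> \oo] --> c -> s n @[n --> \oo] --> c ^+ 2 -> L2_cvg_const P Y c.
Proof.
move=> c0 mY Y0 He Hs ec sc.
have bc : (s n + c ^+ 2 - 2 * c * e n)%:E @[n --> \oo] --> 0%E.
  apply: cvg_EFin; first exact: nearW.
  rewrite (_ : 0 = c ^+ 2 + c ^+ 2 - 2 * c * c); last by ring.
  by apply: cvgB; [apply: cvgD => //; exact: cvg_cst|apply: cvgM => //; exact: cvg_cst].
apply: (@squeeze_cvge _ _ _ _ (fun=> 0%E) _ _ _ _ _ bc); last exact: cvg_cst.
near=> n; apply/andP; split; first by apply: integral_ge0 => w _; rewrite lee_fin sqr_ge0.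
have En : (\int[P]_w (Y n w)%:E = (e n)%:E)%E by near: n.
have Sn : (\int[P]_w (Y n w ^+ 2)%:E <= (s n)%:E)%E by near: n.
have mYc : measurable_fun setT (fun w => (Y n w - c) ^+ 2).
  by apply: measurable_funX; apply: measurable_funB.
have c2 : 0 <= 2 * c by rewrite mulr_ge0.
(* The expansion is arranged with all terms nonnegative, so that no difference of extended reals
   occurs. *)
have H : (\int[P]_w ((Y n w - c) ^+ 2)%:E + (2 * c)%:E * (e n)%:E =
    \int[P]_w (Y n w ^+ 2)%:E + (c ^+ 2)%:E)%E.
  rewrite -En -ge0_integral_scaleE// -ge0_integral_addE//; last 3 first.
  - by apply: measurable_funM.
  - by move=> w; rewrite sqr_ge0.
  - by move=> w; rewrite mulr_ge0.
  have -> : (c ^+ 2)%:E = (\int[P]_w (c ^+ 2)%:E)%E.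
    by rewrite integral_cst// [X in (_ = _ * X)%E]probability_setT mule1.
  rewrite -ge0_integral_addE//; last 3 first.
  - exact: measurable_funX.
  - by move=> w; rewrite sqr_ge0.
  - by move=> w; rewrite sqr_ge0.
  by apply: eq_integral => w _; congr EFin; ring.
rewrite EFinB leeBrDr// EFinM H EFinD.
exact: leeD2r.
Unshelve. all: by end_near. Qed.

Lemma L2_combine (Z Y1 Y2 : nat -> O -> R) (c1 c2 : R) :
  (forall n, measurable_fun setT (Y1 n)) -> (forall n, measurable_fun setT (Y2 n)) ->
  (forall n, {ae P, forall w, Z n w = Y1 n w - 2^-1 * Y2 n w}) ->
  L2_cvg_const P Y1 c1 -> L2_cvg_const P Y2 c2 -> L2_cvg_const P Z (c1 - 2^-1 * c2).
Proof.
move=> m1 m2 HZ H1 H2.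
have bc : (2%:E * \int[P]_w ((Y1 n w - c1) ^+ 2)%:E + (2^-1)%:E * \int[P]_w ((Y2 n w - c2) ^+ 2)%:E)%E
    @[n --> \oo] --> 0%E.
  rewrite -[X in _ --> X](_ : 2%:E * 0 + (2^-1)%:E * 0 = 0)%E; last by rewrite !mule0 adde0.
  by apply: cvgeD; [rewrite !mule0|apply: cvgeZl|apply: cvgeZl].
apply: (@squeeze_cvge _ _ _ _ (fun=> 0%E) _ _ _ _ _ bc); last exact: cvg_cst.
apply: nearW => n.
apply/andP; split; first by apply: integral_ge0 => w _; rewrite lee_fin sqr_ge0.
have mq (Y : nat -> O -> R) c : (forall n, measurable_fun setT (Y n)) ->
    measurable_fun setT (fun w => (Y n w - c) ^+ 2).
  by move=> mY; apply: measurable_funX; apply: measurable_funB.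
have sq (a : R) : 0 <= a ^+ 2 by exact: sqr_ge0.
rewrite -!ge0_integral_scaleE//; [|exact: mq..].
rewrite -ge0_integral_addE//; last 4 first.
- by apply: measurable_funM => //; exact: mq.
- by apply: measurable_funM => //; exact: mq.
- by move=> w; rewrite mulr_ge0.
- by move=> w; rewrite mulr_ge0.
apply: ae_integral_le_nonmeasurable => //.
- by move=> w; rewrite addr_ge0// mulr_ge0.
- by apply: measurable_funD; apply: measurable_funM => //; exact: mq.
- apply: filterS (HZ n) => w ->.
  (* With u and v the two deviations, 2 u^2 + v^2 / 2 - (u - v / 2)^2 = (2 u + v)^2 / 4. *)
  have := sq (2 * (Y1 n w - c1) + (Y2 n w - c2)); nra.
Qed.

End SquareIntegrals.

Section ShiftedLimits.
Context (R : realType).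

Lemma cvg_ratio_powR (k : nat) (a : R) :
  ((m + k.+1)%:R / m.+1%:R) `^ a @[m --> \oo] --> (1 : R).
Proof.
have h : (m + k.+1)%:R / m.+1%:R @[m --> \oo] --> (1 : R).
  rewrite (_ : (fun m => _) = fun m : nat => 1 + k%:R * (m.+1%:R^-1 : R)); last first.
    by apply/funext => m; rewrite addnS -addSn natrD mulrDl divff ?pnatr_eq0.
  rewrite -[X in _ --> X](_ : 1 + k%:R * 0 = 1); last by rewrite mulr0 addr0.
  apply: cvgD; first exact: cvg_cst.
  by apply: cvgM; [exact: cvg_cst|exact: cvg_harmonic].
have l1 : expR (a * ln (1 : R)) = 1 by rewrite ln1 mulr0 expR0.
rewrite -[X in _ --> X]l1.
rewrite (_ : (fun m => _) = fun m : nat => expR (a * ln ((m + k.+1)%:R / m.+1%:R))); last first.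
  by apply/funext => m; rewrite /powR gt_eqF// divr_gt0// addnS.
apply: continuous_cvg; first exact: continuous_expR.
apply: cvgM; first exact: cvg_cst.
by apply: continuous_cvg => //; apply: continuous_ln.
Qed.

(** The ratio n / (n - k) tends to 1, so J(n - k) may be normalised by a power of n. *)
Lemma cvg_shift_powR (u : nat -> R) (a l : R) (k : nat) :
  (m.+1%:R `^ a * u m.+1 @[m --> \oo] --> l) -> (n%:R `^ a * u (n - k)%N @[n --> \oo] --> l).
Proof.
move=> ul; rewrite -(cvg_shiftn k.+1) -[l]mul1r.
have := cvgM (cvg_ratio_powR k a) ul.
rewrite (_ : _ \* _ = fun n : nat => (n + k.+1)%:R `^ a * u (n + k.+1 - k)%N); first by move=> H; apply: H.
apply/funext => m /=.
rewrite (_ : (m + k.+1 - k)%N = m.+1); last by rewrite addnS -addSn addnK.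
rewrite mulrA; congr (_ * _); rewrite -powRM ?divr_ge0//.
by rewrite divfK// pnatr_eq0.
Qed.

End ShiftedLimits.

Section SecondMoment.
Context (R : realType) (d : nat) (mu F : {measure set (d.-tuple R) -> \bar R}).
Local Notation T := (d.-tuple R).
Local Notation V := (ball_volume mu).
Variables (f : T -> R) (K : set T) (c C D : R).
Hypothesis G : density_on_convex mu F f K c C D.
Context (dO : measure_display) (O : measurableType dO) (P : probability O R).
Variable X : nat -> O -> T.
Hypothesis mX : forall i, measurable_fun setT (X i).
Hypothesis indep : forall (s : seq nat) (A : nat -> set T), uniq s ->
  (forall i, measurable (A i)) ->
  P (\bigcap_(i in [set` s]) (X i @^-1` A i)) =
  (\big[*%E/1%E]_(i <- s) P (X i @^-1` A i))%E.
Hypothesis law : forall i A, measurable A -> P (X i @^-1` A) = F A.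
Let Hmu := doc_lebesgue G.
Let d0 := doc_dim G.
Local Notation J := (void_integral mu F f).

Lemma integral_nn_sum b p n j : (J b p (n - 2) = j%:E)%E ->
  (\int[P]_w (nn_sum b p n (X^~ w))%:E = (n%:R * n.-1%:R * j)%:E)%E.
Proof.
move=> Jj; rewrite integral_sum_cond; last 2 first.
- by move=> i; apply: measurable_sum_cond => k; exact: measurable_nn_term.
- by move=> i w; apply: sumr_ge0 => k _; exact: nn_term_ge0.
rewrite (eq_bigr (fun i : 'I_n => (n.-1%:R * j)%:E)).
  by rewrite sumEFin sumr_const card_ord -mulrA [_%:R * (_ * _)]mulr_natl.
move=> i _; rewrite integral_sum_cond; last 2 first.
- by move=> k; exact: measurable_nn_term.
- by move=> k w; exact: nn_term_ge0.
rewrite (eq_bigr (fun k : 'I_n => j%:E)).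
  by rewrite sumEFin sumr_const cardC1 card_ord [_%:R * _]mulr_natl.
move=> k ki; rewrite (integral_nn_term G mX indep law)//.
by move: ki; rewrite eq_sym.
Qed.

Lemma measurable_far_term b p n i j k l : measurable_fun setT (fun w => far_term b p n (X^~ w) i j k l).
Proof.
apply: measurable_funM; last by apply: measurable_funM; exact: measurable_nn_term.
have mr i' j' : measurable_fun setT (fun w => edist (X i' w) (X j' w)) by exact: measurable_edist.
have : measurable_fun setT (\1_[set w | uniq [:: i; j; k; l] &&
    (2 * (edist (X i w) (X j w) + edist (X k w) (X l w)) < edist (X i w) (X k w))] : O -> R).
  apply: measurable_indic; case: (uniq _) => /=.
    by apply: measurable_ltr_set => //; apply: measurable_funM => //; exact: measurable_funD.
  by rewrite (_ : [set _ | _] = set0)//; apply/seteqP; split.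
by apply: eq_measurable_fun => w _; rewrite indic_pred.
Qed.

Lemma measurable_near_term b p n i j k : measurable_fun setT (fun w => near_term b p n (X^~ w) i j k).
Proof.
apply: measurable_funM; last exact: measurable_nn_term.
have mr i' j' : measurable_fun setT (fun w => edist (X i' w) (X j' w)) by exact: measurable_edist.
have : measurable_fun setT (\1_(~` [set w | 4 * edist (X i w) (X j w) < edist (X i w) (X k w)]) : O -> R).
  apply: measurable_indic; apply: measurableC; apply: measurable_ltr_set => //.
  exact: measurable_funM.
apply: eq_measurable_fun => w _; rewrite indic_setC indic_pred leNgt.
by case: ltP; rewrite ?subrr ?subr0.
Qed.

Lemma void_integral_fin_ge0 b p m j : (J b p m = j%:E)%E -> 0 <= j.
Proof.
move=> E; rewrite -lee_fin -E; apply: integral_ge0 => x _; apply: integral_ge0 => y _.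
have /andP[_ q1] := q01 G b x y.
by rewrite lee_fin !mulr_ge0 ?(doc_ge0 G) ?powR_ge0// exprn_ge0// subr_ge0.
Qed.

Lemma integral_far_sum b p n j : (J b p (n - 4) = j%:E)%E ->
  (\int[P]_w (far_sum b p n (X^~ w))%:E <= (n%:R ^+ 4 * j ^+ 2)%:E)%E.
Proof.
move=> Jj; have j0 := void_integral_fin_ge0 Jj.
rewrite -[X in (_ <= (X ^+ 4 * _)%:E)%E](_ : #|'I_n|%:R = _); last by rewrite card_ord.
rewrite (_ : _ ^+ 4 * _ = #|'I_n|%:R * (#|'I_n|%:R * (#|'I_n|%:R * (#|'I_n|%:R * (j * j))))); last by ring.
apply: integral_sum_le => [i|i w||i _].
- by do 3 (apply: measurable_sum_cond => ?); exact: measurable_far_term.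
- by do 3 (apply: sumr_ge0 => ? _); exact: far_term_ge0.
- by rewrite !mulr_ge0.
apply: integral_sum_le => [k|k w||k _].
- by do 2 (apply: measurable_sum_cond => ?); exact: measurable_far_term.
- by do 2 (apply: sumr_ge0 => ? _); exact: far_term_ge0.
- by rewrite !mulr_ge0.
apply: integral_sum_le => [k'|k' w||k' _].
- by apply: measurable_sum_cond => ?; exact: measurable_far_term.
- by apply: sumr_ge0 => ? _; exact: far_term_ge0.
- by rewrite !mulr_ge0.
apply: integral_sum_le => [l|l w||l _].
- exact: measurable_far_term.
- exact: far_term_ge0.
- by rewrite mulr_ge0.
have [u|u] := boolP (uniq [:: i : nat; k : nat; k' : nat; l : nat]).
  apply: le_trans (integral_far_term G mX indep law _ _ _ _ _ _ _) _ => //.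
  by rewrite Jj -EFinM.
under eq_integral do rewrite /far_term (negbTE u) mul0r.
by rewrite integral0 lee_fin mulr_ge0.
Qed.

Lemma integral_near_sum b p n j : 0 <= p -> (J b (p + d%:R) (n - 3) = j%:E)%E ->
  (\int[P]_w (near_sum b p n (X^~ w))%:E <= (n%:R ^+ 3 * (C * (4 ^+ d * V) * j))%:E)%E.
Proof.
move=> p0 Jj; have j0 := void_integral_fin_ge0 Jj.
have k0 : 0 <= C * (4 ^+ d * V) * j.
  by rewrite !mulr_ge0 ?(C_ge0 G) ?exprn_ge0// ltW// (ball_volume_gt0 Hmu).
rewrite -[X in (_ <= (X ^+ 3 * _)%:E)%E](_ : #|'I_n|%:R = _); last by rewrite card_ord.
rewrite (_ : _ ^+ 3 * _ = #|'I_n|%:R * (#|'I_n|%:R * (#|'I_n|%:R * (C * (4 ^+ d * V) * j)))); last by ring.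
apply: integral_sum_le => [i|i w||i _].
- by do 2 (apply: measurable_sum_cond => ?); exact: measurable_near_term.
- by do 2 (apply: sumr_ge0 => ? _); exact: near_term_ge0.
- by do 2 apply: mulr_ge0 => //.
apply: integral_sum_le => [k|k w||k ki].
- by apply: measurable_sum_cond => ?; exact: measurable_near_term.
- by apply: sumr_ge0 => ? _; exact: near_term_ge0.
- by apply: mulr_ge0.
apply: integral_sum_le => [l|l w||l /andP[li lk]].
- exact: measurable_near_term.
- exact: near_term_ge0.
- by [].
apply: le_trans (integral_near_term G mX indep law _ _ _ _ _ _) _ => //.
  by rewrite /= !inE !negb_or andbT; apply/andP; split; [apply/andP; split|];
    [move: ki|move: li|move: lk]; rewrite eq_sym.
by rewrite Jj -EFinM.
Qed.

Lemma integral_nn_sum_sqr b p n j1 j2 j3 : 0 <= p -> (J b p (n - 4) = j1%:E)%E ->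
  (J b (2 * p) (n - 2) = j2%:E)%E -> (J b (2 * p + d%:R) (n - 3) = j3%:E)%E ->
  (\int[P]_w (nn_sum b p n (X^~ w) ^+ 2)%:E <= (n%:R ^+ 4 * j1 ^+ 2 +
    3 * (n%:R * n.-1%:R * j2) + 2 * (n%:R ^+ 3 * (C * (4 ^+ d * V) * j3)))%:E)%E.
Proof.
move=> p0 J1 J2 J3; have p20 : 0 <= 2 * p by rewrite mulr_ge0.
have mS p' : measurable_fun setT (fun w => nn_sum b p' n (X^~ w)) by exact: measurable_nn_sum.
have S0 p' w : 0 <= nn_sum b p' n (X^~ w) by exact: nn_sum_ge0.
have mfs : measurable_fun setT (fun w => far_sum b p n (X^~ w)).
  by do 4 (apply: measurable_sum_cond => ?); exact: measurable_far_term.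
have mns : measurable_fun setT (fun w => near_sum b (2 * p) n (X^~ w)).
  by do 3 (apply: measurable_sum_cond => ?); exact: measurable_near_term.
have fs0 w : 0 <= far_sum b p n (X^~ w).
  by do 4 (apply: sumr_ge0 => ? _); exact: far_term_ge0.
have ns0 w : 0 <= near_sum b (2 * p) n (X^~ w).
  by do 3 (apply: sumr_ge0 => ? _); exact: near_term_ge0.
apply: (@le_trans _ _ (\int[P]_w (far_sum b p n (X^~ w) + 3 * nn_sum b (2 * p) n (X^~ w)
    + 2 * near_sum b (2 * p) n (X^~ w))%:E)%E).
  apply: ae_integral_le_nonmeasurable => //.
  - by move=> w; rewrite sqr_ge0.
  - by move=> w; rewrite !addr_ge0// mulr_ge0.
  - by apply: measurable_funD; [apply: measurable_funD|] => //; exact: measurable_funM.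
  - apply: filterS (ae_no_ties G mX indep law n) => w [nt _]; exact: nn_sum_sqr_le.
rewrite ge0_integral_addE; last 4 first.
- by apply: measurable_funD => //; exact: measurable_funM.
- exact: measurable_funM.
- by move=> w; rewrite addr_ge0// mulr_ge0.
- by move=> w; rewrite mulr_ge0.
rewrite ge0_integral_addE//; last 2 first.
- exact: measurable_funM.
- by move=> w; rewrite mulr_ge0.
rewrite !ge0_integral_scaleE// (integral_nn_sum J2) -EFinM.
apply: (@le_trans _ _ ((n%:R ^+ 4 * j1 ^+ 2)%:E + (3 * (n%:R * n.-1%:R * j2))%:E +
    (2 * (n%:R ^+ 3 * (C * (4 ^+ d * V) * j3)))%:E)%E); last by rewrite -!EFinD.
apply: leeD; first by apply: leeD => //; exact: integral_far_sum.
by rewrite [leRHS]EFinM; apply: lee_wpmul2l => //; exact: integral_near_sum.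
Qed.

(** The limit in real-valued form. Finiteness of J(n - k) is read off from the convergence to a
    finite limit, whence only for large n. *)
Lemma void_integral_limit b p : 0 <= p -> exists l : R,
  [/\ 0 <= l, l = V * Gamma (1 + p / d%:R) * kappa mu b `^ (- 1 - p / d%:R) *
    fine (\int[mu]_(x in K) (f x `^ ((d%:R - p) / d%:R))%:E)%E,
  (forall k, \forall n \near \oo, J b p (n - k) = (fine (J b p (n - k)))%:E) &
  (forall k, (n%:R : R) `^ (1 + p / d%:R) * fine (J b p (n - k)) @[n --> \oo] --> l)].
Proof.
move=> p0; set l := _ * fine _; exists l.
pose i := (\int[mu]_(x in K) (f x `^ ((d%:R - p) / d%:R))%:E)%E.
have i0 : (0 <= i)%E by apply: integral_ge0 => x _; rewrite lee_fin powR_ge0.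
have fi : i \is a fin_num by rewrite ge0_fin_numE//; exact: (void_value_fin G p).
have J0 m : (0 <= J b p m)%E.
  apply: integral_ge0 => x _; apply: integral_ge0 => y _; have /andP[_ q1] := q01 G b x y.
  by rewrite lee_fin !mulr_ge0 ?(doc_ge0 G) ?powR_ge0// exprn_ge0// subr_ge0.
have cv := void_integral_cvg G (b := b) p0; rewrite -/i -(fineK fi) -EFinM -/l in cv.
have pw (n : nat) : 0 < n.+1%:R `^ (1 + p / d%:R) :> R by rewrite powR_gt0.
have cl : n.+1%:R `^ (1 + p / d%:R) * fine (J b p n.+1) @[n --> \oo] --> l.
  have := fine_cvg cv.
  rewrite (_ : _ \o _ = fun n : nat => n.+1%:R `^ (1 + p / d%:R) * fine (J b p n.+1)).
    by move=> H; apply: H.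
  apply/funext => n /=.
  (* If J is infinite, so is its positive multiple, and [fine] gives 0 on both sides. *)
  have := pw n; case: (J b p n.+1) (J0 n.+1) => [r _ _|_ r0|//] //.
  by rewrite gt0_muley//= mulr0.
split; [|by []| |].
- have V0 : 0 <= V by apply: ltW; exact: ball_volume_gt0.
  rewrite !mulr_ge0 ?powR_ge0 ?fine_ge0//.
  by apply: integral_ge0 => t _; rewrite lee_fin mulr_ge0 ?powR_ge0 ?expR_ge0.
- move=> k; have [N _ HN] := cvg_is_fine cv; exists (N + k.+1)%N => // n /= nN.
  have kn : (k < n)%N by apply: leq_trans nN; exact: leq_addl.
  have /= := HN (n - k.+1)%N; rewrite -subSn// subSS leq_subRL// addnC nN => /(_ isT).
  have : 0 < (n - k)%:R `^ (1 + p / d%:R) :> R by rewrite powR_gt0// ltr0n subn_gt0.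
  by case: (J b p (n - k)) (J0 (n - k)%N) => [r _ _ //|_ r0|//]; rewrite gt0_muley.
- by move=> k; exact: (@cvg_shift_powR R (fun m => fine (J b p m)) _ l k cl).
Qed.

(** To be read with m = n, m' = n - 1, v = n^(a - 2), s = n^a and u = n^(2 a - 1), where a = 1 +
    p/d: after rescaling, the diagonal and near contributions carry a factor 1 / n. *)
Lemma second_moment_arith (m m' s u v M' j1 j2 j3 : R) : 0 < m -> m' <= m -> 0 <= u -> 0 <= j2 ->
  u * m = s ^+ 2 -> v * m ^+ 2 = s ->
  v ^+ 2 * (m ^+ 4 * j1 ^+ 2 + 3 * (m * m' * j2) + 2 * (m ^+ 3 * (M' * j3))) <=
  (s * j1) ^+ 2 + (3 * (u * j2) + 2 * M' * (u * m * j3)) / m.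
Proof.
move=> m0 mm u0 j20 e2 e3; have mE : m != 0 by rewrite gt_eqF.
have vE : v = s / m ^+ 2 by rewrite -e3; field.
have uE : u = s ^+ 2 / m by rewrite -e2; field.
have -> : v ^+ 2 * (m ^+ 4 * j1 ^+ 2 + 3 * (m * m' * j2) + 2 * (m ^+ 3 * (M' * j3))) =
    (s * j1) ^+ 2 + (3 * (u * (m' / m) * j2) + 2 * M' * (s ^+ 2 * j3)) / m.
  by rewrite vE uE; field.
rewrite e2 lerD2l; apply: ler_wpM2r; first by rewrite invr_ge0 ltW.
rewrite lerD2r; apply: ler_wpM2l => //; apply: ler_wpM2r => //; apply: ler_piMr => //.
by rewrite ler_pdivrMr// mul1r.
Qed.

Lemma nn_sum_L2 b p (l : R) : 0 <= p ->
  l = V * Gamma (1 + p / d%:R) * kappa mu b `^ (- 1 - p / d%:R) *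
    fine (\int[mu]_(x in K) (f x `^ ((d%:R - p) / d%:R))%:E)%E ->
  L2_cvg_const P (fun n w => n%:R `^ ((p - d%:R) / d%:R) * nn_sum b p n (X^~ w)) l.
Proof.
move=> p0 lE; have p20 : 0 <= 2 * p by rewrite mulr_ge0.
have [l1 [l1_ge0 l1E fin1 cv1]] := void_integral_limit b p0.
have {l1E lE} E : l1 = l by rewrite lE.
rewrite {l1}E in l1_ge0 cv1.
have [l2 [_ _ fin2 cv2]] := void_integral_limit b p20.
have p30 : 0 <= 2 * p + d%:R by rewrite addr_ge0.
have [l3 [_ _ fin3 cv3]] := void_integral_limit b p30.
have {}fin1 := (fin1 2%N, fin1 4%N); have {}fin2 := fin2 2%N; have {}fin3 := fin3 3%N.
pose a : R := 1 + p / d%:R.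
have dn0 : d%:R != 0 :> R by rewrite pnatr_eq0 -lt0n.
have aE : (p - d%:R) / d%:R = a - 2 by rewrite /a; field.
have a2 : 1 + 2 * p / d%:R = 2 * a - 1 by rewrite /a; field.
have a3 : 1 + (2 * p + d%:R) / d%:R = 2 * a by rewrite /a; field.
rewrite a2 in cv2; rewrite a3 in cv3; rewrite -/a in cv1.
pose M := C * (4 ^+ d * V).
pose x (n : nat) : R := n%:R `^ a * fine (J b p (n - 2)).
pose x4 (n : nat) : R := n%:R `^ a * fine (J b p (n - 4)).
pose y (n : nat) : R := n%:R `^ (2 * a - 1) * fine (J b (2 * p) (n - 2)).
pose z (n : nat) : R := n%:R `^ (2 * a) * fine (J b (2 * p + d%:R) (n - 3)).
have inv0 : (n%:R^-1 : R) @[n --> \oo] --> (0 : R).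
  by rewrite -(cvg_shiftn 1); under eq_fun do rewrite addn1; exact: cvg_harmonic.
have pw k n : (0 < n)%N -> n%:R `^ (a - k%:R) * n%:R ^+ k = n%:R `^ a :> R.
  by move=> n0; rewrite -powR_mulrn// -powRD ?subrK// pnatr_eq0 (gtn_eqF n0) implybT.
(* The rescaled mean is n^(a - 2) n (n - 1) J(n - 2), which is n^a J(n - 2) times 1 - 1 / n. *)
apply: (@L2_of_moments _ _ _ P _ l (fun n => x n * (1 - n%:R^-1))
  (fun n => x4 n ^+ 2 + (3 * y n + 2 * M * z n) * n%:R^-1)) => //.
- by move=> n; apply: measurable_funM => //; exact: measurable_nn_sum.
- by move=> n w; rewrite mulr_ge0 ?powR_ge0// nn_sum_ge0.
- apply: filterS2 (nbhs_infty_gt 0) fin1.1 => n n0 J1.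
  rewrite ge0_integral_scaleE ?powR_ge0//; last 2 first.
  + exact: measurable_nn_sum.
  + by move=> w; exact: nn_sum_ge0.
  rewrite (integral_nn_sum J1) -EFinM aE /x -(pw 2 n n0); congr EFin.
  by rewrite -subn1 natrB//; field; rewrite pnatr_eq0 -lt0n.
- apply: filterS2 (filterI (nbhs_infty_gt 0) fin1.2) (filterI fin2 fin3) => n [n0 J1] [J2 J3].
  under eq_integral do rewrite exprMn.
  rewrite ge0_integral_scaleE ?sqr_ge0//; last 2 first.
  + by apply: measurable_funX; exact: measurable_nn_sum.
  + by move=> w; exact: sqr_ge0.
  apply: le_trans (lee_wpmul2l _ (integral_nn_sum_sqr p0 J1 J2 J3)) _.
    by rewrite lee_fin sqr_ge0.
  rewrite -EFinM lee_fin aE /x4 /y /z.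
  have nR : 0 < n%:R :> R by rewrite ltr0n.
  have e1 : n%:R `^ (2 * a) = (n%:R `^ a) ^+ 2 :> R by rewrite mulrC powRrM powR_mulrn ?powR_ge0.
  have e2 : n%:R `^ (2 * a - 1) * n%:R = (n%:R `^ a) ^+ 2 :> R.
    rewrite -e1 -[X in _ * X]powRr1 ?ler0n// -powRD ?subrK//.
    by rewrite pnatr_eq0 (gtn_eqF n0) implybT.
  have e3 : n%:R `^ (a - 2) * n%:R ^+ 2 = n%:R `^ a :> R by exact: pw.
  rewrite e1 -e2; apply: second_moment_arith => //.
  - by rewrite ler_nat leq_pred.
  - exact: (void_integral_fin_ge0 J2).
- rewrite -[X in _ --> X](_ : l * (1 - 0) = l); last by rewrite subr0 mulr1.
  by apply: cvgM; [exact: cv1|apply: cvgB => //; exact: cvg_cst].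
- rewrite -[X in _ --> X](_ : l * l + (3 * l2 + 2 * M * l3) * 0 = l ^+ 2); last first.
    by rewrite mulr0 addr0 expr2.
  apply: cvgD; first by apply: cvgM; exact: cv1.
  apply: cvgM => //; apply: cvgD; apply: cvgM; [exact: cvg_cst|exact: cv2|exact: cvg_cst|exact: cv3].
Qed.

Theorem NN_weight_L2 p : 0 <= p -> L2_cvg_const P
  (fun n w => n%:R `^ ((p - d%:R) / d%:R) * NN_weight p (sample X n w))
  (V * Gamma (1 + p / d%:R) *
    (V `^ (- 1 - p / d%:R) - 2^-1 * omega mu `^ (- 1 - p / d%:R)) *
   fine (\int[mu]_(x in K) (f x `^ ((d%:R - p) / d%:R))%:E)%E).
Proof.
move=> p0; set i := fine _.
rewrite (_ : _ * _ * i = V * Gamma (1 + p / d%:R) * kappa mu false `^ (- 1 - p / d%:R) * i -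
  2^-1 * (V * Gamma (1 + p / d%:R) * kappa mu true `^ (- 1 - p / d%:R) * i)); last first.
  by rewrite /kappa; ring.
have mS b n : measurable_fun setT
    (fun w => n%:R `^ ((p - d%:R) / d%:R) * nn_sum b p n (X^~ w)).
  by apply: measurable_funM => //; exact: measurable_nn_sum.
apply: (@L2_combine _ _ _ P _ _ _ _ _ (mS false) (mS true)).
- move=> n; apply: filterS (ae_no_ties G mX indep law n) => w [_ us].
  by rewrite NN_weight_nn_sum//; ring.
- exact: nn_sum_L2.
- exact: nn_sum_L2.
Qed.

End SecondMoment.

(** * Volumes of the unit ball and of the union of two balls *)

Section ConsMeasure.
Context (R : realType) (d : nat).
Local Notation T := (d.-tuple R).
Local Notation T' := (d.+1.-tuple R).

Definition pair_cons (z : measurableTypeR R * T) : T' := cons_tuple (z.1 : R) z.2.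

Lemma tnth_pair_cons0 z : tnth (pair_cons z) ord0 = z.1.
Proof. by []. Qed.

Lemma tnth_pair_consS z i : tnth (pair_cons z) (lift ord0 i) = tnth z.2 i.
Proof. by rewrite /pair_cons !(tnth_nth 0). Qed.

Lemma measurable_pair_cons : measurable_fun setT pair_cons.
Proof.
apply/measurable_fun_tnthP => i; have [j ->|->] := unliftP ord0 i.
  rewrite (_ : _ \o _ = fun z => tnth z.2 j); last by apply/funext => z; exact: tnth_pair_consS.
  exact: (measurableT_comp (measurable_tnth j)).
by rewrite (_ : _ \o _ = fst).
Qed.

Variable nu : {measure set T -> \bar R}.
Hypothesis Hnu : is_lebesgue nu.
Let N : {sigma_finite_measure set T -> \bar R} := sigma_finite_alias (lebesgue_sigma_finite Hnu).
Let L : {measure set (measurableTypeR R) -> \bar R} := @lebesgue_measure R.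

Definition cons_measure : {measure set T' -> \bar R} :=
  image_measure (L \x N)%E measurable_pair_cons.

Lemma lebesgue_cons_measure : is_lebesgue cons_measure.
Proof.
move=> a b ab; rewrite big_ord_recl EFinM.
pose a' := [tuple tnth a (lift ord0 i) | i < d]; pose b' := [tuple tnth b (lift ord0 i) | i < d].
have -> : (\prod_(i < d) (tnth b (lift ord0 i) - tnth a (lift ord0 i)))%:E = N (box a' b').
  have := lebesgue_box Hnu (a := a') (b := b') => ->; last by move=> i; rewrite !tnth_mktuple.
  by congr EFin; apply: eq_bigr => i _; rewrite !tnth_mktuple.
have -> : (tnth b ord0 - tnth a ord0)%:E = L `[tnth a ord0, tnth b ord0]%classic.
  transitivity (lebesgue_measure ([set` `[tnth a ord0, tnth b ord0]] : set R)) => //.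
  rewrite lebesgue_measure_itv/= lte_fin; case: ltP => // ba.
  by rewrite (le_anti (introT andP (conj ba (ab ord0)))) subrr.
rewrite -product_measure1E//; last exact: measurable_box.
transitivity ((L \x N)%E (pair_cons @^-1` box a b)) => //.
congr ((L \x N)%E _); apply/seteqP; split => -[x y] /=.
  move=> H; split; first by have := H ord0; rewrite in_itv.
  by move=> i; rewrite !tnth_mktuple -(tnth_pair_consS (x, y)); exact: H.
move=> [H1 H2] i; have [j ->|->] := unliftP ord0 i; last by move: H1; rewrite in_itv.
by have := H2 j; rewrite !tnth_mktuple tnth_pair_consS.
Qed.

(** The product of Lebesgue measure on the line with [nu] has the right values on boxes, so it is
    [mu] up to [pair_cons]. *)
Lemma lebesgue_slice (mu : {measure set T' -> \bar R}) (f : T' -> R) : is_lebesgue mu ->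
  measurable_fun setT f -> (forall x, 0 <= f x) ->
  (\int[mu]_x (f x)%:E = \int[@lebesgue_measure R]_x \int[nu]_y (f (pair_cons (x, y)))%:E)%E.
Proof.
move=> Hmu mf f0.
have sL : sigma_finite setT L by exact: sigma_finiteT.
have H : (\int[(L \x N)%E]_z (f (pair_cons z))%:E = 1%:E * \int[mu]_x (f x)%:E)%E.
  apply: (@ge0_change_variables _ _ _ _ R (L \x N)%E mu pair_cons 1 (fun x => (f x)%:E)) => //.
  - exact: measurable_pair_cons.
  - by move=> A mA; rewrite mul1e; exact: (lebesgue_unique lebesgue_cons_measure Hmu mA).
  - exact/measurable_EFinP.
rewrite mul1e in H; rewrite -H.
rewrite (sigma_finite_product_unique sL (lebesgue_sigma_finite Hnu) (m' := (L \x N)%E))//.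
- by move=> A B mA mB; exact: product_measure1E.
- by apply/measurable_EFinP; apply: (measurableT_comp mf); exact: measurable_pair_cons.
- by move=> z; rewrite lee_fin.
Qed.

End ConsMeasure.

Lemma dirac_lebesgue (R : realType) : is_lebesgue (\d_[tuple] : {measure set (0.-tuple R) -> \bar R}).
Proof.
by move=> a b _; rewrite big_ord0; change (dirac (R := R) [tuple] (box a b) = 1%E); rewrite diracE mem_set// => -[].
Qed.

(** The theorem supplies a measure in its own dimension only; slicing needs one in the dimension
    below, and the special values of Gamma need one on the line. *)
Lemma exists_lebesgue (R : realType) d : exists mu : {measure set (d.-tuple R) -> \bar R}, is_lebesgue mu.
Proof.
elim: d => [|d [nu Hnu]]; first by exists (\d_[tuple]); exact: dirac_lebesgue.
by exists (cons_measure Hnu); exact: lebesgue_cons_measure.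
Qed.

Section Gaussian.
Context (R : realType).

Lemma lt_sqrtr (x t : R) : 0 <= x -> 0 <= t -> (x < Num.sqrt t) = (x ^+ 2 < t).
Proof. by move=> x0 t0; rewrite -[in RHS](sqr_sqrtr t0) ltr_pXn2r ?nnegrE ?sqrtr_ge0. Qed.

Lemma le_sqrtr (x t : R) : 0 <= x -> 0 <= t -> (x <= Num.sqrt t) = (x ^+ 2 <= t).
Proof. by move=> x0 t0; rewrite -[in RHS](sqr_sqrtr t0) ler_pXn2r ?nnegrE ?sqrtr_ge0. Qed.

Lemma edist_pair_cons d x (y : d.-tuple R) :
  edist (origin R d.+1) (pair_cons (x, y)) ^+ 2 = x ^+ 2 + edist (origin R d) y ^+ 2.
Proof.
rewrite !edist_sqr big_ord_recl; congr (_ + _).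
  by rewrite tnth_origin tnth_pair_cons0 sub0r sqrrN.
by apply: eq_bigr => i _; rewrite !tnth_origin tnth_pair_consS.
Qed.

Lemma integral_gauss d (mu : {measure set (d.-tuple R) -> \bar R}) : is_lebesgue mu ->
  (\int[mu]_u (expR (- edist (origin R d) u ^+ 2))%:E = (pi `^ (d%:R / 2))%:E)%E.
Proof.
elim: d mu => [|d IH] mu Hmu.
  rewrite mul0r powRr0 (_ : (fun u => _) = cst 1%E); last first.
    apply/funext => u; rewrite [u]tuple0 /= (_ : origin R 0 = [tuple]) ?edistxx; last exact: tuple0.
    by rewrite expr0n/= oppr0 expR0.
  rewrite integral_cst// mul1e; have := Hmu [tuple] [tuple] (fun i => lexx _).
  by rewrite big_ord0 => <-; congr (mu _); apply/seteqP; split => // x _ [].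
have [nu Hnu] := exists_lebesgue R d.
rewrite (lebesgue_slice Hnu Hmu); last 2 first.
- apply: measurableT_comp => //; apply: measurableT_comp => //; apply: measurable_funX.
  exact: measurable_edist_origin.
- by move=> u; exact: expR_ge0.
transitivity (\int[lebesgue_measure]_x ((pi `^ (d%:R / 2)) * gauss_fun x)%:E : \bar R)%E.
  apply: eq_integral => x _.
  under eq_integral do rewrite edist_pair_cons opprD expRD.
  rewrite ge0_integral_scaleE ?expR_ge0//.
  - by rewrite IH// -EFinM mulrC.
  - apply: measurableT_comp => //; apply: measurableT_comp => //; apply: measurable_funX.
    exact: measurable_edist_origin.
rewrite ge0_integral_scaleE ?powR_ge0//; last 2 first.
- exact: measurable_gauss_fun.
- exact: gauss_fun_ge0.
rewrite integralT_gauss -EFinM; congr EFin.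
rewrite -powR12_sqrt ?pi_ge0// -powRD ?pi_gt0//.
  by congr (_ `^ _); rewrite -natr1; field.
by rewrite (gt_eqF (pi_gt0 R)) implybT.
Qed.

Lemma integral_expRN_tail (r : R) :
  (\int[lebesgue_measure]_(t in `[r, +oo[) (expR (- t))%:E = (expR (- r))%:E)%E.
Proof.
have dF (x : R) : is_derive x 1 (- (expR \o -%R)) (expR (- x)).
  have h := @is_deriveN _ _ _ _ x 1 _ (is_derive1_comp (is_derive_expR (- x)) (is_deriveN (is_derive_id x 1))).
  by apply: is_derive_eq h _; rewrite mulrN1 opprK.
rewrite (@ge0_continuous_FTC2y _ _ (- (expR \o -%R)) r 0).
- by rewrite -EFinB sub0r opprK.
- by move=> x _; exact: expR_ge0.
- by apply: continuous_subspaceT => x; apply: continuous_comp; [exact: continuousN|exact: continuous_expR].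
- rewrite -oppr0; apply: cvgN; exact: cvgr_expR.
- by move=> x _; exact: ex_derive.
- apply: cvg_at_right_filter; apply: differentiable_continuous; apply/derivable1_diffP.
  exact: ex_derive.
- by move=> x _; rewrite derive1E derive_val.
Qed.

(** Write exp(- h) as the integral of exp(- t) over t > h and exchange the integrals: what remains
    is the volume v t^q of a sublevel set against exp(- t). *)
Lemma layer_gamma d (T : measurableType d) (m : {measure set T -> \bar R}) (h : T -> R)
    (v q : R) : sigma_finite setT m -> measurable_fun setT h -> (forall u, 0 <= h u) ->
  0 <= v -> 0 <= q ->
  (forall t, 0 <= t -> m [set u | h u < t] = (v * t `^ q)%:E) ->
  (\int[m]_u (expR (- h u))%:E = (v * Gamma (1 + q))%:E)%E.
Proof.
move=> sm mh h0 v0 q0 H.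
pose L : {measure set (measurableTypeR R) -> \bar R} := @lebesgue_measure R.
have sL : sigma_finite setT L by exact: sigma_finiteT.
pose A : set (T * measurableTypeR R) := [set z | h z.1 < (z.2 : R)].
have mA : measurable A.
  by apply: measurable_ltr_set; [exact: measurableT_comp|exact: measurable_snd].
pose g (z : T * measurableTypeR R) : \bar R := (\1_A z * expR (- (z.2 : R)))%:E.
have mg : measurable_fun setT g.
  apply/measurable_EFinP; apply: measurable_funM => //.
  by apply: measurableT_comp => //; apply: measurableT_comp => //; exact: measurable_snd.
have g0 z : (0 <= g z)%E by rewrite lee_fin mulr_ge0 ?expR_ge0.
transitivity (\int[m]_u \int[L]_t g (u, t))%E.
  apply: eq_integral => u _; rewrite -integral_expRN_tail.
  rewrite -(@integral_itv_obnd_cbnd R (h u) (BInfty _ false)).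
    rewrite integral_mkcond; apply: eq_integral => t _.
    by rewrite patchE /g /A indic_pred mem_setE in_itv/= andbT; case: ifP; rewrite ?mul1r ?mul0r.
  apply/measurable_EFinP; apply: measurable_funTS; apply: measurableT_comp => //.
rewrite (tonelli_exchange sm sL mg g0).
transitivity (\int[L]_(t in `[0%R, +oo[) (v * (t `^ q * expR (- t)))%:E)%E.
  rewrite [RHS]integral_mkcond; apply: eq_integral => t _.
  rewrite patchE mem_setE in_itv/= andbT; case: ifP => [t0|/negbT t0]; last first.
    apply: integral0_eq => u _; rewrite /g /A indic_pred.
    by rewrite ltNge (le_trans _ (h0 u)) ?mul0r// ltW// ltNge.
  transitivity (\int[m]_u (expR (- t) * \1_[set u | h u < t] u)%:E)%E.
    by apply: eq_integral => u _; rewrite /g mulrC; congr EFin; congr (_ * _); exact: indic_congr.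
  have mB : measurable [set u | h u < t] by exact: measurable_ltr_set.
  rewrite ge0_integral_scaleE ?expR_ge0//.
  by rewrite integral_indic// setIT [X in (_ * X)%E](H _ t0) -EFinM; congr EFin; ring.
under eq_integral do rewrite EFinM.
rewrite ge0_integralZl_EFin//; first by rewrite GammaE.
- by move=> t _; rewrite lee_fin mulr_ge0 ?powR_ge0 ?expR_ge0.
- apply/measurable_EFinP; apply: measurable_funTS; apply: measurable_funM.
    exact: measurable_powR.
  by apply: measurableT_comp.
Qed.

(** The Gaussian integral evaluated twice: coordinate by coordinate, and by layers of |u|^2, whose
    sublevel sets have volume V t^(d/2). *)
Lemma ball_volume_Gamma d (mu : {measure set (d.-tuple R) -> \bar R}) : is_lebesgue mu ->
  (0 < d)%N -> ball_volume mu * Gamma (1 + d%:R / 2) = pi `^ (d%:R / 2).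
Proof.
move=> Hmu d0; have /ltW V0 := ball_volume_gt0 Hmu.
have := integral_gauss Hmu.
rewrite (@layer_gamma _ _ mu (fun u => edist (origin R d) u ^+ 2) (ball_volume mu) (d%:R / 2))//.
- by move=> [].
- exact: lebesgue_sigma_finite.
- by apply: measurable_funX; exact: measurable_edist_origin.
- by move=> u; exact: sqr_ge0.
- move=> t t0; rewrite [X in mu X](_ : _ = oball (origin R d) (Num.sqrt t)).
    rewrite (lebesgue_oball Hmu)// ?sqrtr_ge0// mulrC -powR12_sqrt//.
    by rewrite -powR_mulrn ?powR_ge0// -powRrM [2^-1 * _]mulrC.
  by apply/seteqP; split => u /=; rewrite /oball/= lt_sqrtr ?edist_ge0.
Qed.

Lemma ball_volume_vball d (mu : {measure set (d.-tuple R) -> \bar R}) : is_lebesgue mu ->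
  (0 < d)%N -> ball_volume mu = vball R d.
Proof.
move=> Hmu d0; have := ball_volume_Gamma Hmu d0; rewrite /vball => <-.
rewrite mulfK//; apply/negP => /eqP G0.
have := ball_volume_Gamma Hmu d0; rewrite G0 mulr0 => /eqP.
by rewrite lt_eqF// powR_gt0// pi_gt0.
Qed.

Lemma lebesgue_cball1 (mu : {measure set (1.-tuple R) -> \bar R}) (r : R) : is_lebesgue mu ->
  0 <= r -> mu (cball (origin R 1) r) = (2 * r)%:E.
Proof.
move=> Hmu r0; rewrite [X in mu X](_ : _ = box [tuple - r] [tuple r]).
  rewrite (lebesgue_box Hmu); last by move=> i; rewrite !(tnth_nth 0)/= ord1/=; lra.
  by rewrite big_ord1 !(tnth_nth 0)/= opprK; congr EFin; ring.
apply/seteqP; split => x /=; rewrite /cball/= -ler_sqr ?nnegrE ?edist_ge0// edist_sqr big_ord1.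
  rewrite tnth_origin => h i; rewrite ord1 !(tnth_nth 0)/= -!(tnth_nth 0 x ord0).
  by apply/andP; nra.
move=> /(_ ord0); rewrite tnth_origin !(tnth_nth 0)/= -!(tnth_nth 0 x ord0) => /andP[]; nra.
Qed.

Lemma ball_volume1 (mu : {measure set (1.-tuple R) -> \bar R}) : is_lebesgue mu ->
  ball_volume mu = 2.
Proof.
by move=> Hmu; apply: EFin_inj; rewrite -(ball_volumeE Hmu) lebesgue_cball1// mulr1.
Qed.

Lemma Gamma1 : Gamma (1 : R) = 1.
Proof.
apply: EFin_inj; rewrite -[in LHS](addr0 1) -GammaE//.
under eq_integral do rewrite powRr0 mul1r.
by rewrite integral_expRN_tail oppr0 expR0.
Qed.

(* Radial integration and layer cake compute the same integral of exp(- |u|) over the line. *)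
Lemma Gamma2 : Gamma (2 : R) = 1.
Proof.
have [nu Hnu] := exists_lebesgue R 1; have V2 := ball_volume1 Hnu.
have /ltW V0 := ball_volume_gt0 Hnu.
have := radial_gamma Hnu (ltn0Sn 0) (lexx (0 : R)) ltr01.
under eq_integral do rewrite powRr0 !mul1r expr1.
rewrite (@layer_gamma _ _ nu (edist (origin R 1)) (ball_volume nu) 1)//.
- rewrite mul0r addr0 Gamma1 V2 powR1 => -[]; rewrite -[1 + 1]/(2%:R); lra.
- exact: lebesgue_sigma_finite.
- exact: measurable_edist_origin.
- by move=> u; exact: edist_ge0.
- move=> t t0; by rewrite [LHS] (lebesgue_oball Hnu)// expr1 powRr1// mulrC.
Qed.

(** The volume formula read backwards on the line, where the unit ball has length 2. *)
Lemma Gamma_three_halves : Gamma (1 + 2^-1 : R) = Num.sqrt pi / 2.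
Proof.
have [nu Hnu] := exists_lebesgue R 1.
have := ball_volume_Gamma Hnu (ltn0Sn 0); rewrite ball_volume1// mul1r powR12_sqrt ?pi_ge0//.
by move=> <-; field.
Qed.

Lemma ball_volume2 (mu : {measure set (2.-tuple R) -> \bar R}) : is_lebesgue mu ->
  ball_volume mu = pi.
Proof.
move=> Hmu; have := ball_volume_Gamma Hmu (ltn0Sn 1).
by rewrite divff ?pnatr_eq0// -[1 + 1]/(2%:R) Gamma2 mulr1 powRr1// pi_ge0.
Qed.

Lemma omega1 (mu : {measure set (1.-tuple R) -> \bar R}) : is_lebesgue mu -> omega mu = 3.
Proof.
move=> Hmu; rewrite /omega [X in mu X](_ : _ = box [tuple - 1] [tuple 2]).
  rewrite (lebesgue_box Hmu)/=; last by move=> i; rewrite !(tnth_nth 0)/= ord1/=; lra.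
  by rewrite big_ord1 !(tnth_nth 0)/=; lra.
have e (x y : 1.-tuple R) : (edist x y <= 1) = ((tnth x ord0 - tnth y ord0) ^+ 2 <= 1).
  by rewrite -ler_sqr ?nnegrE ?edist_ge0// edist_sqr big_ord1 expr1n.
apply/seteqP; split => x /=; rewrite !e !tnth_mktuple/=.
  move=> h i; rewrite ord1 !(tnth_nth 0)/= -!(tnth_nth 0 x ord0); apply/andP.
  by case: h => h; split; nra.
move=> /(_ ord0); rewrite !(tnth_nth 0)/= -!(tnth_nth 0 x ord0) => /andP[h1 h2].
have [le|lt] := lerP (tnth x ord0) 1; [left|right]; nra.
Qed.

Lemma disc_slice (mu : {measure set (2.-tuple R) -> \bar R}) (I : set R) : is_lebesgue mu ->
  measurable I ->
  mu (cball (origin R 2) 1 `&` [set u | I (tnth u ord0)]) =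
  (\int[lebesgue_measure]_(x in I) (2 * Num.sqrt (1 - x ^+ 2))%:E)%E.
Proof.
move=> Hmu mI; have [nu Hnu] := exists_lebesgue R 1.
have mA : measurable (cball (origin R 2) 1 `&` [set u | I (tnth u ord0)]).
  apply: measurableI; first exact: measurable_cball.
  exact: (measurable_preimage (measurable_tnth ord0) mI).
have indE d' (m : {measure set (d'.-tuple R) -> \bar R}) C : measurable C ->
    m C = (\int[m]_u (\1_C u)%:E)%E.
  by move=> mC; rewrite integral_indic// setIT.
rewrite (indE _ mu _ mA) (lebesgue_slice Hnu Hmu); last 2 first.
- exact: measurable_indic.
- by [].
rewrite [RHS]integral_mkcond; apply: eq_integral => x _; rewrite patchE.
have E (y : 1.-tuple R) : cball (origin R 2) 1 (pair_cons (x, y)) <->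
    x ^+ 2 + edist (origin R 1) y ^+ 2 <= 1.
  by rewrite -edist_pair_cons /cball/= -ler_sqr ?nnegrE ?edist_ge0// expr1n.
have [xI|xI] := boolP (x \in I); last first.
  rewrite integral0_eq// => y _; rewrite indicE memNset// => -[_].
  by rewrite /= tnth_pair_cons0 => /mem_set; exact/negP.
have [x1|x1] := lerP (x ^+ 2) 1.
  have s0 : 0 <= 1 - x ^+ 2 by rewrite subr_ge0.
  rewrite -(lebesgue_cball1 Hnu (sqrtr_ge0 _)) (indE _ nu); last exact: measurable_cball.
  apply: eq_integral => y _; congr EFin; apply: indic_congr.
  have -> : cball (origin R 1) (Num.sqrt (1 - x ^+ 2)) y <-> x ^+ 2 + edist (origin R 1) y ^+ 2 <= 1.
    by rewrite /cball/= le_sqrtr ?edist_ge0// lerBrDl.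
  by rewrite -E; split => [[]//|h]; split => //=; rewrite tnth_pair_cons0; exact: set_mem.
(* For |x| > 1 the slice is empty, and the square root of a negative number is 0. *)
rewrite ler0_sqrtr ?subr_le0 ?ltW// mulr0 integral0_eq// => y _.
rewrite indicE memNset// => -[/E + _].
by apply/negP; rewrite -ltNge (lt_le_trans x1)// lerDl sqr_ge0.
Qed.

(** The triple angle formula at pi / 6 reads 1 = 3 s - 4 s^3, that is (s + 1) (2 s - 1)^2 = 0, and s
    is positive. *)
Lemma sin_pi6 : sin (pi / 6) = 2^-1 :> R.
Proof.
have p0 := pi_gt0 R.
have s0 : 0 < sin (pi / 6 : R) by apply: sin_gt0_pi; apply/andP; split; lra.
have E : sin (pi / 2 : R) = 3 * sin (pi / 6) - 4 * sin (pi / 6) ^+ 3.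
  have -> : pi / 2 = pi / 6 + (pi / 6 + pi / 6) :> R by field.
  have c2 : cos (pi / 6 : R) ^+ 2 = 1 - sin (pi / 6) ^+ 2 by rewrite cos2sin2.
  rewrite sinD sinD cosD; move: c2; set c := cos _; set s := sin _ => c2.
  have -> : s * (c * c - s * s) + c * (s * c + c * s) = 3 * s * c ^+ 2 - s ^+ 3 by ring.
  by rewrite c2; ring.
rewrite sin_pihalf in E; move: s0 E; set s := sin _ => s0 E.
have : (s + 1) * (2 * s - 1) ^+ 2 = 0.
  by rewrite (_ : (s + 1) * (2 * s - 1) ^+ 2 = 1 - (3 * s - 4 * s ^+ 3)); [rewrite -E subrr|ring].
move/eqP; rewrite mulf_eq0 sqrf_eq0 => /orP[/eqP|/eqP]; lra.
Qed.

Lemma asin_half : asin (2^-1 : R) = pi / 6.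
Proof.
by rewrite -sin_pi6 sinK// in_itv/=; have p0 := pi_gt0 R; apply/andP; split; lra.
Qed.

Lemma integral_disc_slab :
  (\int[lebesgue_measure]_(x in `[0%R, 2^-1%R]) (2 * Num.sqrt (1 - x ^+ 2))%:E =
   (Num.sqrt 3 / 4 + pi / 6 : R)%:E)%E.
Proof.
have pos (x : R) : -1 < x < 1 -> 0 < 1 - x ^+ 2 by move=> /andP[]; nra.
pose g : R -> R := cst 1 - (@idfun R) ^+ 2.
(* The primitive x sqrt(1 - x^2) + asin x of 2 sqrt(1 - x^2). *)
pose F : R -> R := (@idfun R) * (Num.sqrt \o g) + asin.
have gE x : g x = 1 - x ^+ 2 by [].
have dg (x : R) : is_derive x 1 g (- (2 * x)).
  by apply: is_derive_eq; rewrite /= sub0r expr1 scaler1 mulr_natl.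
have dF (x : R) : -1 < x < 1 -> is_derive x 1 F (2 * Num.sqrt (1 - x ^+ 2)).
  move=> x1; have p := pos _ x1.
  have p' : 0 < g x by [].
  have h1 := is_derive1_asin x1; have h2 := is_derive1_comp (is_derive1_sqrt p') (dg x).
  have h3 := is_deriveD (is_deriveM (is_derive_id x 1) h2) h1.
  apply: is_derive_eq h3 _; rewrite gE /= -[_ *: _]/(_ * _) -[X in _ + X + _]/(_ * _).
  have s0 : Num.sqrt (1 - x ^+ 2) != 0 by rewrite gt_eqF// sqrtr_gt0.
  have s2 : x ^+ 2 = 1 - Num.sqrt (1 - x ^+ 2) ^+ 2 by rewrite sqr_sqrtr ?ltW//; ring.
  move: s0 s2; set s := Num.sqrt _ => s0 s2.
  have -> : x * ((2 * s)^-1 * - (2 * x)) + s * 1 + s^-1 = (- x ^+ 2) / s + s + s^-1 by field.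
  by rewrite s2; field.
have cF (x : R) : -1 < x < 1 -> {for x, continuous F}.
  move=> x1; apply: differentiable_continuous; apply/derivable1_diffP.
  by case: (dF x x1).
rewrite (@continuous_FTC2 _ _ F 0 (2^-1)).
- have asin0 : asin (0 : R) = 0.
    by rewrite -[X in asin X]sin0 sinK// in_itv/=; have p0 := pi_gt0 R; apply/andP; split; lra.
  have s34 : Num.sqrt (1 - 2^-1 ^+ 2) = Num.sqrt 3 / 2 :> R.
    rewrite (_ : 1 - 2^-1 ^+ 2 = 3 * 2^-1 ^+ 2); last by field.
    by rewrite sqrtrM// sqrtr_sqr ger0_norm.
  have -> : F 2^-1 = 2^-1 * Num.sqrt (1 - 2^-1 ^+ 2) + asin 2^-1 by [].
  have -> : F 0 = 0 * Num.sqrt (1 - 0 ^+ 2) + asin 0 by [].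
  by rewrite asin_half s34 asin0 -EFinB; congr EFin; field.
- by rewrite invr_gt0.
- apply: continuous_in_subspaceT => x; rewrite inE/= in_itv/= => /andP[x0 x1].
  have gx : {for x, continuous g}.
    by apply: differentiable_continuous; apply/derivable1_diffP; case: (dg x).
  have hs : {for x, continuous (Num.sqrt \o g)} := continuous_comp gx (sqrt_continuous (x := g x)).
  have hc : {for x, continuous (fun y : R => 2 * Num.sqrt (1 - y ^+ 2))}.
    by apply: cvgM; [exact: cvg_cst|exact: hs].
  exact: hc.
- split.
  + move=> x; rewrite in_itv/= => /andP[x0 x1].
    have x2 : -1 < x < 1 by apply/andP; split; lra.
    by case: (dF x x2).
  + by apply: cvg_at_right_filter; apply: cF; apply/andP; split; lra.
  + by apply: cvg_at_left_filter; apply: cF; apply/andP; split; lra.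
- move=> x; rewrite in_itv/= => /andP[x0 x1].
  have x2 : -1 < x < 1 by apply/andP; split; lra.
  have := dF x x2 => h.
  by rewrite derive1E (@derive_val _ _ _ _ _ _ _ h).
Qed.

(* The point reflection exchanging the two centres also exchanges the two halves of the
   union, and the left half is the part of the unit disc left of x = 1/2. *)
Lemma omega2 (mu : {measure set (2.-tuple R) -> \bar R}) : is_lebesgue mu ->
  omega mu = (8 * pi + 3 * Num.sqrt 3) / 6.
Proof.
move=> Hmu.
pose D (I : set R) := cball (origin R 2) 1 `&` [set u | I (tnth u ord0)].
pose m (I : set R) : \bar R := (\int[lebesgue_measure]_(x in I) (2 * Num.sqrt (1 - x ^+ 2))%:E)%E.
have Dm I : measurable I -> mu (D I) = m I by move=> mI; exact: disc_slice.
have mD I : measurable I -> measurable (D I).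
  move=> mI; apply: measurableI; first exact: measurable_cball.
  exact: (measurable_preimage (measurable_tnth ord0) mI).
have mphi B : measurable_fun B (fun x : R => (2 * Num.sqrt (1 - x ^+ 2))%:E).
  apply/measurable_EFinP; apply: measurable_funTS; apply: measurable_funM => //.
  by apply: (measurableT_comp (@sqrtr_measurable R)); apply: measurable_funB.
have reflect h B : measurable B -> mu (affine (-1) h @^-1` B) = mu B.
  by move=> mB; rewrite (lebesgue_affine _ Hmu)// ?normrN1 ?expr1n ?invr1 ?mul1e// oppr_eq0 oner_eq0.
have e2 (x u : 2.-tuple R) : edist x u ^+ 2 = (tnth x ord0 - tnth u ord0) ^+ 2 +
    (tnth x ord_max - tnth u ord_max) ^+ 2.
  have -> : ord_max = lift ord0 ord0 :> 'I_2 by exact/val_inj.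
  by rewrite edist_sqr big_ord_recl big_ord1.
have le1 (x u : 2.-tuple R) : (edist x u <= 1) = ((tnth x ord0 - tnth u ord0) ^+ 2 +
    (tnth x ord_max - tnth u ord_max) ^+ 2 <= 1).
  by rewrite -e2 -ler_sqr ?nnegrE ?edist_ge0// expr1n.
have half : m `]-oo, 0%R[%classic = m `[0%R, +oo[%classic.
  rewrite [RHS]/m -integral_itv_obnd_cbnd// -/(m _) -[RHS]Dm// -[LHS]Dm//.
  rewrite -[LHS](reflect (origin R 2)); last exact: mD.
  congr (mu _); apply/seteqP; split => u /=; rewrite /D/= /cball/= !le1 !in_itv/= !tnth_affine !tnth_origin;
    by move=> [h1 h2]; split; nra.
have VD : mu (cball (origin R 2) 1) = (mu (D `]-oo, 0%R[%classic) + mu (D `[0%R, +oo[%classic))%E.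
  rewrite -measureU//; [|exact: mD|exact: mD|].
    congr (mu _); apply/seteqP; split => u; rewrite /D/= !in_itv/= andbT.
      by move=> h; case: (ltP (tnth u ord0) 0); [left|right].
    by move=> [[]|[]].
  by apply/seteqP; split => // u [[_ /=] + [_ /=]]; rewrite !in_itv/= andbT ltNge => /negP.
have hD : mu (D `]-oo, 0%R[%classic) = (pi / 2)%:E.
  move: VD; rewrite (ball_volumeE Hmu) ball_volume2// [X in (_ = _ + X)%E -> _]Dm// -half -Dm//.
  case: (mu _) => [r| |]//; rewrite -EFinD => -[E]; congr EFin; lra.
have quarter : m `]-oo, 2^-1%R]%classic = (pi / 2 + (Num.sqrt 3 / 4 + pi / 6))%:E.
  rewrite -Dm// EFinD -hD -integral_disc_slab -/(m _) -Dm// -measureU//; [|exact: mD|exact: mD|].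
    congr (mu _); apply/seteqP; split => u; rewrite /D/= !in_itv/=.
      move=> [h h']; case: (ltP (tnth u ord0) 0) => h0; [left|right]; split => //.
    by move=> [[h h']|[h /andP[h1 h2]]]; split => //; rewrite (le_trans (ltW h')).
  by apply/seteqP; split => // u [[_ /=] + [_ /=]]; rewrite !in_itv/= ltNge => /negP h /andP[].
(* The reflected half is taken with a strict inequality, so that the two halves are disjoint. *)
have quarter' : m `]-oo, 2^-1%R[%classic = (pi / 2 + (Num.sqrt 3 / 4 + pi / 6))%:E.
  by rewrite -quarter /m integral_itv_bndo_bndc.
rewrite /omega [X in mu X](_ : _ = D `]-oo, 2^-1%R]%classic `|`
    affine (-1) (e1 R 2) @^-1` (D `]-oo, 2^-1%R[%classic)).
  rewrite [X in fine X](_ : _ = (mu (D `]-oo, 2^-1%R]%classic) +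
      mu (affine (-1) (e1 R 2) @^-1` (D `]-oo, 2^-1%R[%classic)))%E); last apply: measureU => //.
  - rewrite reflect; last exact: mD.
    by rewrite !Dm// quarter quarter' -EFinD/=; field.
  - exact: mD.
  - by apply: measurable_preimage; [exact: measurable_affine|exact: mD].
  - apply/seteqP; split => // u [[_ /=] + [_ /=]].
    by rewrite !in_itv/= tnth_affine tnth_mktuple/=; lra.
have -> : [tuple 0 | _ < 2] = origin R 2 by [].
apply/seteqP; split => u; rewrite /D/= /cball/= !le1 !in_itv/= !tnth_affine !tnth_origin !tnth_mktuple/=.
  move: (tnth u ord0) (tnth u ord_max) => x y; clear.
  by move=> h; case: (lerP x 2^-1) => h0; [left|right]; split; case: h => h; nra.
move: (tnth u ord0) (tnth u ord_max) => x y; clear.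
by move=> [[h h0]|[h h0]]; [left|right]; nra.
Qed.

End Gaussian.

(** * Convex polyhedra and cubes *)

Section ConvexBounded.
Context (R : realType) (d : nat) (mu : {measure set (d.-tuple R) -> \bar R}).
Local Notation T := (d.-tuple R).
Hypothesis Hmu : is_lebesgue mu.
Variable K : set T.
Hypothesis mK : measurable K.
Hypothesis convK : forall x y (t : R), K x -> K y -> 0 <= t <= 1 ->
  K [tuple (1 - t) * tnth x i + t * tnth y i | i < d].
Hypothesis K_gt0 : (0 < mu K)%E.
Hypothesis K_fin : (mu K < +oo)%E.

Lemma bounded_part_gt0 : exists k, (0 < mu (K `&` @cbox R d k))%E.
Proof.
apply: contrapT => H.
have H0 k : mu (K `&` @cbox R d k) = 0%E.
  apply/eqP; rewrite eq_le measure_ge0 andbT leNgt; apply/negP => h; apply: H; by exists k.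
have : mu.-negligible (\bigcup_k (K `&` @cbox R d k)).
  apply: negligible_bigcup => k; apply/negligibleP; last exact: H0.
  by apply: measurableI => //; exact: measurable_cbox.
rewrite -setI_bigcupr cbox_cover setIT => /negligibleP => /(_ mK) E.
by move: K_gt0; rewrite E ltxx.
Qed.

(* Contracting a bounded part of K of positive volume towards a far away point y of K, by
   N different ratios at most 1/2, gives N disjoint subsets of K of volume at least
   2 ^ -d times that of the bounded part. *)
Lemma convex_coord_bound : exists M : R, forall y i, K y -> `|tnth y i| <= M.
Proof.
have [k K0] := bounded_part_gt0; set K' := K `&` @cbox R d k in K0.
have mK' : measurable K' by apply: measurableI => //; exact: measurable_cbox.
have fK' : mu K' \is a fin_num.
  rewrite ge0_fin_numE//; apply: le_lt_trans K_fin; apply: le_measure; rewrite ?inE//.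
  exact: subIsetl.
pose a := fine (mu K'); pose v := fine (mu K).
have a0 : 0 < a by apply: fine_gt0; rewrite K0 ltey_eq fK'.
have v0 : 0 <= v by exact: fine_ge0.
(* So many copies, each of volume at least 2^(-d) a, exceed the volume v of K. *)
pose N := (Num.truncn (2 ^+ d * v / a)).+1.
(* Two ratios differ by at least 1 / (2 N), so coordinate l separates the copies by more than 2 k as
   soon as |y_l| > 4 k N, while points of the bounded part have coordinates within k of 0. *)
exists (4 * k%:R * N%:R) => y l Ky; rewrite leNgt; apply/negP => big.
have N0 : 0 < N%:R :> R by rewrite ltr0n.
pose t (j : 'I_N) : R := j%:R / (2 * N%:R).
have t01 j : 0 <= t j <= 2^-1.
  apply/andP; split; first by rewrite divr_ge0// mulr_ge0.
  have : j%:R <= N%:R :> R by rewrite ler_nat ltnW.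
  by rewrite /t ler_pdivrMr ?mulr_gt0//; nra.
pose A j : set T := affine (1 - t j)^-1 [tuple - (t j / (1 - t j)) * tnth y i | i < d] @^-1` K'.
have mA j : measurable (A j) by apply: measurable_preimage => //; exact: measurable_affine.
have tE j : 1 - t j != 0 by have /andP[] := t01 j => ? ?; rewrite gt_eqF//; lra.
have AE j x : A j x -> exists2 z, K' z & forall i, tnth x i = (1 - t j) * tnth z i + t j * tnth y i.
  move=> Ax; eexists; first exact: Ax.
  by move=> i; rewrite tnth_affine tnth_mktuple; field.
have AK j : A j `<=` K.
  move=> x /AE[z [Kz _] E]; have t1 : 0 <= t j <= 1 by have /andP[] := t01 j => ? ?; apply/andP; split; lra.
  have := convK Kz Ky t1; congr K; apply: eq_from_tnth => i.
  by rewrite tnth_mktuple E.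
have disj : trivIset setT A.
  apply/trivIsetP => i j _ _ ij; apply/seteqP; split => // x [/AE[z [_ Bz] E] /AE[z' [_ Bz'] E']].
  have := E l; rewrite E' => {E E'} E; have := Bz l; have := Bz' l.
  rewrite !tnth_mktuple => /andP[b1 b2] /andP[b3 b4].
  have /andP[ti0 ti1] := t01 i; have /andP[tj0 tj1] := t01 j.
  have : `|(t i - t j) * tnth y l| <= 2 * k%:R.
    rewrite (_ : _ * _ = (1 - t j) * tnth z' l - (1 - t i) * tnth z l); last by move: E; lra.
    by rewrite ler_norml; apply/andP; nra.
  apply/negP; rewrite -ltNge normrM.
  have st : (2 * N%:R)^-1 <= `|t i - t j|.
    rewrite /t -mulrBl normrM [`|_^-1|]ger0_norm ?invr_ge0 ?mulr_ge0//.
    rewrite ler_peMl ?invr_ge0 ?mulr_ge0// -[1]/(1%:R).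
    have [lt|lt|eq] := ltngtP i j.
    - by rewrite distrC ger0_norm ?subr_ge0 ?ler_nat 1?ltnW// -natrB 1?ltnW// ler_nat subn_gt0.
    - by rewrite ger0_norm ?subr_ge0 ?ler_nat 1?ltnW// -natrB 1?ltnW// ler_nat subn_gt0.
    - by move: ij; rewrite (val_inj eq) eqxx.
  apply: (@lt_le_trans _ _ ((2 * N%:R)^-1 * `|tnth y l|)).
    by rewrite [X in _ < X]mulrC ltr_pdivlMr ?mulr_gt0//; lra.
  by rewrite ler_wpM2r.
have muA j : ((2^-1 ^+ d * a)%:E <= mu (A j))%E.
  rewrite (lebesgue_affine _ Hmu) ?invr_eq0// -[X in (_ <= _ * X)%E](fineK fK') -EFinM lee_fin.
  have /andP[? ?] := t01 j.
  apply: ler_wpM2r; first exact: ltW.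
  rewrite ger0_norm ?invr_ge0; last by lra.
  by rewrite -exprVn invrK lerXn2r ?nnegrE//; lra.
have mbig : measurable (\big[setU/set0]_(j < N) A j) by exact: bigsetU_measurable.
have : (mu (\big[setU/set0]_(j < N) A j) <= mu K)%E.
  apply: le_measure; rewrite ?inE//.
  apply: (big_ind (fun B => B `<=` K)) => // B B' h1 h2 x [/h1|/h2]//.
rewrite (measure_semi_additive_ord mu mA disj mbig) leNgt => /negP; apply.
apply: (@lt_le_trans _ _ (\sum_(j < N) (2^-1 ^+ d * a)%:E)%E); last by apply: lee_sum => j _; exact: muA.
have -> : mu K = v%:E by rewrite fineK// ge0_fin_numE.
rewrite sumEFin sumr_const card_ord lte_fin -[_ *+ N]mulr_natl exprVn.
have := truncnS_gt (2 ^+ d * v / a); rewrite -/N ltr_pdivrMr// => h.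
have p2 : 0 < 2 ^+ d :> R by rewrite exprn_gt0.
rewrite -(ltr_pM2l p2) (_ : 2 ^+ d * (N%:R * (2 ^- d * a)) = N%:R * a)//.
by rewrite mulrCA mulVKf// gt_eqF.
Qed.

Lemma convex_diameter : exists2 D : R, 0 < D & forall x y, K x -> K y -> edist x y < D.
Proof.
have [M HM] := convex_coord_bound; pose S : R := d%:R * (2 * M) ^+ 2.
have S0 : 0 <= S by rewrite mulr_ge0// sqr_ge0.
exists (Num.sqrt S + 1); first by rewrite ltr_wpDl// sqrtr_ge0.
move=> x y Kx Ky; rewrite ltr_pwDr// le_sqrtr ?edist_ge0// edist_sqr /S.
rewrite -[d in d%:R]card_ord mulr_natl -sumr_const; apply: ler_sum => i _.
have := HM _ i Kx; have := HM _ i Ky; rewrite !ler_norml => /andP[? ?] /andP[? ?].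
by rewrite -subr_ge0 subr_sqr mulr_ge0//; lra.
Qed.

End ConvexBounded.

Section Polyhedron.
Context (R : realType) (d : nat).
Local Notation T := (d.-tuple R).

Lemma measurable_convex_polyhedron (K : set T) : convex_polyhedron K -> measurable K.
Proof.
move=> [m [a [b ->]]]; rewrite [X in measurable X](_ : _ = \bigcap_(j in [set: 'I_m])
    (~` [set x | b j < \sum_(i < d) tnth (a j) i * tnth x i])).
  apply: fin_bigcap_measurable => // j _; apply: measurableC; apply: measurable_ltr_set => //.
  apply: measurable_sum => i; apply: measurable_funM => //; exact: measurable_tnth.
by apply/seteqP; split => x /= H j; [move=> _; apply/negP; rewrite -leNgt|rewrite leNgt; apply/negP; exact: H].
Qed.

Lemma convex_polyhedron_segment (K : set T) x y (t : R) : convex_polyhedron K ->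
  K x -> K y -> 0 <= t <= 1 -> K [tuple (1 - t) * tnth x i + t * tnth y i | i < d].
Proof.
move=> [m [a [b ->]]] Kx Ky /andP[t0 t1] j.
rewrite (eq_bigr (fun i => (1 - t) * (tnth (a j) i * tnth x i) + t * (tnth (a j) i * tnth y i))).
  rewrite big_split/= -!mulr_sumr; have := Kx j; have := Ky j.
  set u := \sum_i _; set v := \sum_i _ => hu hv.
  rewrite [leRHS](_ : _ = (1 - t) * b j + t * b j); last by ring.
  by apply: lerD; apply: ler_wpM2l => //; rewrite subr_ge0.
by move=> i _; rewrite tnth_mktuple; ring.
Qed.

Lemma lebesgue_hyperplane (mu : {measure set T -> \bar R}) (i : 'I_d) (t : R) :
  is_lebesgue mu -> mu [set x | tnth x i = t] = 0%E.
Proof.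
move=> Hmu.
have mH : measurable [set x : T | tnth x i = t].
  by apply: measurable_eqr_set => //; exact: measurable_tnth.
apply/(negligibleP mu mH); rewrite -[X in _.-negligible X]setIT -cbox_cover setI_bigcupr.
apply: negligible_bigcup => k; have [tk|tk] := boolP (- k%:R <= t <= k%:R); last first.
  rewrite (_ : _ `&` _ = set0); first exact: negligible_set0.
  apply/seteqP; split => // x [/= xt] /(_ i); rewrite !tnth_mktuple xt.
  by apply/negP.
have [tk1 tk2] := andP tk.
pose a : T := [tuple if j == i then t else - k%:R | j < d].
pose b : T := [tuple if j == i then t else k%:R | j < d].
exists (box a b); split; first exact: measurable_box.
  rewrite (lebesgue_box Hmu).
    by rewrite (bigD1 i)//= !tnth_mktuple eqxx subrr mul0r.
  by move=> j; rewrite !tnth_mktuple; case: ifP => // _; rewrite (le_trans tk1).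
move=> x [/= xt] H j; rewrite !tnth_mktuple; case: eqP => [->|_]; first by rewrite xt lexx.
by have := H j; rewrite !tnth_mktuple.
Qed.

End Polyhedron.

(** Integrating c <= f <= C over K gives c |K| <= 1 <= C |K|. *)
Lemma integral_density_gt0 (R : realType) d (T : measurableType d)
    (mu : {measure set T -> \bar R}) (f : T -> R) (K : set T) (c C : R) :
  measurable K -> measurable_fun setT f -> (forall x, 0 <= f x) -> (forall x, ~ K x -> f x = 0) ->
  0 < c -> (forall x, K x -> c <= f x <= C) -> (\int[mu]_x (f x)%:E = 1)%E ->
  (0 < mu K < +oo)%E.
Proof.
move=> mK mf f0 fK c0 cC F1.
have f1 : (\int[mu]_x (f x)%:E = \int[mu]_(x in K) (f x)%:E)%E.
  rewrite [RHS]integral_mkcond; apply: eq_integral => x _; rewrite patchE.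
  by case: ifPn => //; rewrite notin_setE => /fK ->.
have mfK : measurable_fun K (fun x => (f x)%:E) by apply/measurable_EFinP; exact: measurable_funTS.
apply/andP; split.
  rewrite lt0e measure_ge0 andbT; apply/eqP => K0.
  have : (1 <= C%:E * mu K)%E.
    rewrite -F1 f1 -integral_cst//; apply: ge0_le_integral => //.
    - by move=> x _; rewrite lee_fin.
    - by move=> x Kx; rewrite lee_fin; have /andP[] := cC x Kx.
  by rewrite K0 mule0 leNgt lte01.
have : (c%:E * mu K <= 1)%E.
  rewrite -F1 f1 -integral_cst//; apply: ge0_le_integral => //.
  - by move=> x _; rewrite lee_fin ltW.
  - by move=> x Kx; rewrite lee_fin; have /andP[] := cC x Kx.
by case: (mu K) (measure_ge0 mu K) => [r _ _|_|//]; [rewrite ltry|rewrite gt0_muley].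
Qed.

Theorem NN_weight_L2_C1 (R : realType) d (alpha : R) (mu : {measure set (d.-tuple R) -> \bar R})
    (f : d.-tuple R -> R) (K : set (d.-tuple R))
    (dO : measure_display) (O : measurableType dO) (P : probability O R)
    (X : nat -> O -> d.-tuple R) :
  (1 <= d)%N -> 0 <= alpha -> is_lebesgue mu ->
  prob_density mu f -> C1 f K -> iid_with_density mu f P X ->
  L2_cvg_const P
    (fun n w => (n%:R `^ ((alpha - d%:R) / d%:R)) * NN_weight alpha (sample X n w))
    (Gamma (1 + alpha / d%:R) *
      (vball R d `^ (- (alpha / d%:R))
       - 2^-1 * vball R d * omega mu `^ (- 1 - alpha / d%:R)) *
     fine (\int[mu]_(x in K) ((f x) `^ ((d%:R - alpha) / d%:R))%:E)%E).
Proof.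
move=> d0 a0 Hmu [mf [f0 F1]] [polyK [fK [c [C [c0 cC]]]]] [mX [law indep]].
have mK := measurable_convex_polyhedron polyK.
have /andP[Kgt0 Kfin] := integral_density_gt0 mK mf f0 fK c0 cC F1.
have convK x y t := @convex_polyhedron_segment R d K x y t polyK.
have [D D0 diam] := convex_diameter Hmu mK convK Kgt0 Kfin.
have [x0 Kx0] : exists x, K x.
  apply: contrapT => nK; move: Kgt0; rewrite (_ : K = set0) ?measure0 ?ltxx//.
  by apply/seteqP; split => // x Kx; apply: nK; exists x.
have C0 : 0 <= C by have /andP[h1 h2] := cC _ Kx0; rewrite ltW// (lt_le_trans c0)// (le_trans h1).
(* The common law is taken as the image of P, which makes it a measure at once; its density form is
   the hypothesis [law]. *)
pose F : {measure set (d.-tuple R) -> \bar R} := image_measure P (mX 0%N).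
have FE A : measurable A -> F A = (\int[mu]_(x in A) (f x)%:E)%E by move=> mA; exact: law.
have G : density_on_convex mu F f K c C D.
  split => //.
  - by move=> x; have [/cC/andP[]//|/fK ->] := pselect (K x).
  - by move=> x /cC/andP[].
  - by rewrite FE.
have lawF i A : measurable A -> P (X i @^-1` A) = F A.
  by move=> mA; rewrite FE//; exact: law.
have := NN_weight_L2 G mX indep lawF a0.
rewrite (ball_volume_vball Hmu d0).
have v0 : 0 < vball R d by rewrite -(ball_volume_vball Hmu d0) ball_volume_gt0.
set g := Gamma _; set i := fine _; set o := omega mu `^ _.
(* The factor V comes from polar coordinates; against V^(-1 - alpha/d) in the single-ball term it
   leaves V^(- alpha/d). *)
rewrite (_ : vball R d * g * _ * i = g * (vball R d * vball R d `^ (-1 - alpha / d%:R) -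
  2^-1 * vball R d * o) * i); last by ring.
rewrite -[X in X * _ `^ _]powRr1 ?ltW// -powRD; last by rewrite (gt_eqF v0) implybT.
by rewrite addrA subrr sub0r.
Qed.

(** * Uniform points in the cube *)

Section Cube.
Context (R : realType) (d : nat) (mu : {measure set (d.-tuple R) -> \bar R}).
Local Notation T := (d.-tuple R).
Hypothesis Hmu : is_lebesgue mu.

Definition open_cube : set T := [set x | forall i, 0 < tnth x i < 1].
Definition closed_cube : set T := [set x | forall i, 0 <= tnth x i <= 1].

Lemma closed_cube_box : closed_cube = box [tuple 0 | _ < d] [tuple 1 | _ < d].
Proof.
by apply/seteqP; split => x H i; have := H i; rewrite ?tnth_mktuple.
Qed.

Lemma measurable_closed_cube : measurable closed_cube.
Proof. by rewrite closed_cube_box; exact: measurable_box. Qed.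

Lemma measurable_open_cube : measurable open_cube.
Proof.
rewrite (_ : open_cube = \bigcap_(i in [set: 'I_d])
    ([set x | 0 < tnth x i] `&` [set x | tnth x i < 1])).
  apply: fin_bigcap_measurable => // i _; apply: measurableI; apply: measurable_ltr_set => //;
  exact: measurable_tnth.
apply/seteqP; split => x /= H i; first by have /andP[] := H i.
by have [h1 h2] := H i I; apply/andP.
Qed.

Lemma lebesgue_closed_cube : mu closed_cube = 1%E.
Proof.
rewrite closed_cube_box (lebesgue_box Hmu).
  by rewrite big1// => i _; rewrite !tnth_mktuple subr0.
by move=> i; rewrite !tnth_mktuple.
Qed.

Lemma ae_open_closed_cube : {ae mu, forall x, \1_open_cube x = \1_closed_cube x :> R}.
Proof.
have : {ae mu, forall x : T, forall n, forall i : 'I_d, i = n :> nat ->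
    tnth x i <> 0 /\ tnth x i <> 1}.
  apply: ae_nat => n; have [nd|nd] := ltnP n d; last first.
    by apply: aeW => x i E; move: nd; rewrite -E leqNgt ltn_ord.
  pose i := Ordinal nd.
  have H t : {ae mu, forall x : T, tnth x i <> t}.
    have mH : measurable [set x : T | tnth x i = t].
      by apply: measurable_eqr_set => //; exact: measurable_tnth.
    have /(negligibleP mu mH) := lebesgue_hyperplane i t Hmu.
    by apply: negligibleS => x /= /contrapT.
  apply: filterS2 (H 0) (H 1) => x h0 h1 j E.
  by rewrite (_ : j = i) //; exact: val_inj.
apply: filterS => x H; apply: indic_congr; split => h i; have /andP[h1 h2] := h i.
  by rewrite !ltW.
have [/eqP n0 /eqP n1] := H i i erefl.
by rewrite !lt_neqAle h1 h2 eq_sym n0 n1.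
Qed.

Lemma integral_open_cube (A : set T) : measurable A ->
  (\int[mu]_(x in A) (\1_open_cube x : R)%:E = \int[mu]_(x in A) (\1_closed_cube x : R)%:E)%E.
Proof.
move=> mA; have mo := measurable_open_cube; have mc := measurable_closed_cube.
apply: ge0_ae_eq_integral => //.
- by apply/measurable_EFinP; apply: measurable_funTS; exact: measurable_indic.
- by apply/measurable_EFinP; apply: measurable_funTS; exact: measurable_indic.
- by apply: filterS ae_open_closed_cube => x E _; rewrite E.
Qed.

Lemma prob_density_closed_cube : prob_density mu (\1_closed_cube : T -> R).
Proof.
split; [|split] => //; first exact: measurable_indic measurable_closed_cube.
by rewrite integral_indic ?setIT ?lebesgue_closed_cube//; exact: measurable_closed_cube.
Qed.

Lemma convex_polyhedron_closed_cube : convex_polyhedron closed_cube.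
Proof.
exists (d + d)%N, (fun j => match fintype.split j with
  | inl k => [tuple (i == k)%:R | i < d] | inr k => [tuple - (i == k)%:R | i < d] end),
  (fun j => match fintype.split j with inl _ => 1 | inr _ => 0 end).
have S (k : 'I_d) (x : T) (s : R) :
    \sum_(i < d) tnth [tuple s * (i == k)%:R | i < d] i * tnth x i = s * tnth x k.
  rewrite (bigD1 k)//= tnth_mktuple eqxx mulr1 big1 ?addr0// => i ik.
  by rewrite tnth_mktuple (negbTE ik) mulr0 mul0r.
apply/seteqP; split => x /= H.
  move=> j; case: (fintype.split j) => k; have /andP[h0 h1] := H k.
    have := S k x 1; under [X in X = _ -> _]eq_bigr do rewrite tnth_mktuple mul1r.
    by under [X in _ -> is_true (X <= _)]eq_bigr do rewrite tnth_mktuple; move=> ->; rewrite mul1r.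
  have := S k x (-1); under [X in X = _ -> _]eq_bigr do rewrite tnth_mktuple mulN1r.
  under [X in _ -> is_true (X <= _)]eq_bigr do rewrite tnth_mktuple; move=> ->.
  by rewrite mulN1r oppr_le0.
move=> k; apply/andP; split.
  have := H (unsplit (inr k)); rewrite unsplitK.
  have := S k x (-1); under [X in X = _ -> _]eq_bigr do rewrite tnth_mktuple mulN1r.
  under [X in _ -> is_true (X <= _) -> _]eq_bigr do rewrite tnth_mktuple; move=> ->.
  by rewrite mulN1r oppr_le0.
have := H (unsplit (inl k)); rewrite unsplitK.
have := S k x 1; under [X in X = _ -> _]eq_bigr do rewrite tnth_mktuple mul1r.
by under [X in _ -> is_true (X <= _) -> _]eq_bigr do rewrite tnth_mktuple; move=> ->; rewrite mul1r.
Qed.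

Lemma C1_closed_cube : C1 (\1_closed_cube : T -> R) closed_cube.
Proof.
split; first exact: convex_polyhedron_closed_cube.
split; first by move=> x nK; rewrite indicE memNset.
by exists 1, 1; split => // x Kx; rewrite indicE mem_set// lexx.
Qed.

(** (C1) asks for closed half-spaces, so the closed cube serves as support. Its indicator differs
    from that of the open cube on the faces only, a null set, so the sample has either density. *)
Lemma NN_weight_L2_cube (alpha : R) (dO : measure_display) (O : measurableType dO)
    (P : probability O R) (U : nat -> O -> T) :
  (1 <= d)%N -> 0 <= alpha -> iid_with_density mu (\1_open_cube : T -> R) P U ->
  L2_cvg_const P
    (fun n w => (n%:R `^ ((alpha - d%:R) / d%:R)) * NN_weight alpha (sample U n w))
    (Gamma (1 + alpha / d%:R) *
      (vball R d `^ (- (alpha / d%:R))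
       - 2^-1 * vball R d * omega mu `^ (- 1 - alpha / d%:R))).
Proof.
move=> d0 a0 [mU [law indep]].
have iid : iid_with_density mu (\1_closed_cube : T -> R) P U.
  by split => //; split => // i A mA; rewrite law// integral_open_cube.
have := NN_weight_L2_C1 d0 a0 Hmu prob_density_closed_cube C1_closed_cube iid.
rewrite (_ : fine _ = 1) ?mulr1//.
rewrite (eq_integral (cst 1%E)); last first.
  by move=> x xK; rewrite indicE xK powR1.
by rewrite integral_cst ?mul1e; [rewrite lebesgue_closed_cube|exact: measurable_closed_cube].
Qed.

End Cube.

Lemma NN_weight_L2_square (R : realType) (alpha : R) (mu : {measure set (2.-tuple R) -> \bar R})
    (dO : measure_display) (O : measurableType dO) (P : probability O R)
    (U : nat -> O -> 2.-tuple R) :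
  0 <= alpha -> is_lebesgue mu ->
  iid_with_density mu (\1_[set x : 2.-tuple R | forall i, 0 < tnth x i < 1]) P U ->
  L2_cvg_const P
    (fun n w => (n%:R `^ ((alpha - 2) / 2)) * NN_weight alpha (sample U n w))
    (Gamma (1 + alpha / 2) *
      (pi `^ (- (alpha / 2))
       - pi / 2 * (6 / (8 * pi + 3 * Num.sqrt 3)) `^ (1 + alpha / 2))).
Proof.
move=> a0 Hmu iid; have := NN_weight_L2_cube Hmu (isT : (1 <= 2)%N) a0 iid.
have vE : vball R 2 = pi by rewrite -(ball_volume_vball Hmu)// ball_volume2.
have aE : - 1 - alpha / 2 = - (1 + alpha / 2) by rewrite opprD.
rewrite vE (omega2 Hmu) aE [(_ / 6) `^ _]powRN.
have c0 : 0 < 8 * pi + 3 * Num.sqrt 3 :> R.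
  by rewrite ltr_wpDr ?mulr_ge0 ?sqrtr_ge0// mulr_gt0// pi_gt0.
set c := 8 * pi + _ in c0 *.
have -> : (6 / c) `^ (1 + alpha / 2) = ((c / 6) `^ (1 + alpha / 2))^-1.
  have -> : 6 / c = (c / 6) `^ (-1) by rewrite powR_inv1 ?invf_div// divr_ge0// ltW.
  by rewrite -powRrM mulN1r powRN.
by rewrite [2^-1 * pi]mulrC.
Qed.

Theorem theorem3 (R : realType) :
  (* general statement *)
  (forall (d : nat) (alpha : R) (mu : {measure set (d.-tuple R) -> \bar R})
      (f : d.-tuple R -> R) (K : set (d.-tuple R))
      (dO : measure_display) (O : measurableType dO) (P : probability O R)
      (X : nat -> O -> d.-tuple R),
    (1 <= d)%N -> 0 <= alpha -> is_lebesgue mu ->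
    prob_density mu f -> C1 f K -> iid_with_density mu f P X ->
    L2_cvg_const P
      (fun n w => (n%:R `^ ((alpha - d%:R) / d%:R)) * NN_weight alpha (sample X n w))
      (Gamma (1 + alpha / d%:R) *
        (vball R d `^ (- (alpha / d%:R))
         - 2^-1 * vball R d * omega mu `^ (- 1 - alpha / d%:R)) *
       fine (\int[mu]_(x in K) ((f x) `^ ((d%:R - alpha) / d%:R))%:E)%E)) /\
  (* uniform points on (0,1)^2, all alpha >= 0 *)
  (forall (alpha : R) (mu : {measure set (2.-tuple R) -> \bar R})
      (dO : measure_display) (O : measurableType dO) (P : probability O R)
      (U : nat -> O -> 2.-tuple R),
    0 <= alpha -> is_lebesgue mu ->
    iid_with_density mu (\1_[set x : 2.-tuple R | forall i, 0 < tnth x i < 1]) P U ->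
    L2_cvg_const P
      (fun n w => (n%:R `^ ((alpha - 2) / 2)) * NN_weight alpha (sample U n w))
      (Gamma (1 + alpha / 2) *
        (pi `^ (- (alpha / 2))
         - pi / 2 * (6 / (8 * pi + 3 * Num.sqrt 3)) `^ (1 + alpha / 2)))) /\
  (* uniform points on (0,1)^2, alpha = 1 *)
  (forall (mu : {measure set (2.-tuple R) -> \bar R})
      (dO : measure_display) (O : measurableType dO) (P : probability O R)
      (U : nat -> O -> 2.-tuple R),
    is_lebesgue mu ->
    iid_with_density mu (\1_[set x : 2.-tuple R | forall i, 0 < tnth x i < 1]) P U ->
    L2_cvg_const P
      (fun n w => (n%:R `^ (- 2^-1)) * NN_weight 1 (sample U n w))
      (2^-1 - 4^-1 * (6 * pi / (8 * pi + 3 * Num.sqrt 3)) `^ (3 / 2))) /\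
  (* uniform points on (0,1), alpha = 1 *)
  (forall (mu : {measure set (1.-tuple R) -> \bar R})
      (dO : measure_display) (O : measurableType dO) (P : probability O R)
      (U : nat -> O -> 1.-tuple R),
    is_lebesgue mu ->
    iid_with_density mu (\1_[set x : 1.-tuple R | forall i, 0 < tnth x i < 1]) P U ->
    L2_cvg_const P (fun n w => NN_weight 1 (sample U n w)) (7 / 18)).
Proof.
split; [|split; [|split]].
- by move=> d alpha mu f K dO O P X; exact: NN_weight_L2_C1.
- by move=> alpha mu dO O P U; exact: NN_weight_L2_square.
- move=> mu dO O P U Hmu iid; have := NN_weight_L2_square ler01 Hmu iid.
  rewrite (_ : (1 - 2) / 2 = - 2^-1); last by field.
  rewrite div1r Gamma_three_halves (_ : 1 + 2^-1 = 3 / 2); last by field.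
  have p0 := pi_gt0 R; set c := 8 * pi + _.
  have c0 : 0 < c by rewrite ltr_wpDr ?mulr_ge0 ?sqrtr_ge0// mulr_gt0.
  have -> : 6 * pi / c = pi * (6 / c) by field; rewrite gt_eqF.
  rewrite [(pi * _) `^ _]powRM ?pi_ge0 ?divr_ge0 ?ltW//.
  have -> : 3 / 2 = 1 + 2^-1 :> R by field.
  rewrite [pi `^ (1 + _)]powRD; last by rewrite (gt_eqF p0) implybT.
  rewrite powRr1 ?pi_ge0// powRN powR12_sqrt ?pi_ge0//.
  have s0 : Num.sqrt pi != 0 :> R by rewrite gt_eqF// sqrtr_gt0.
  set Z := _ `^ (1 + 2^-1).
  have -> : Num.sqrt pi / 2 * ((Num.sqrt pi)^-1 - pi / 2 * Z) =
      2^-1 - 4^-1 * (pi * Num.sqrt pi * Z).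
    move: (sqr_sqrtr (pi_ge0 R)) s0; move: (Num.sqrt pi) => s sE s0.
    by rewrite -sE; field.
  exact.
- move=> mu dO O P U Hmu iid; have := NN_weight_L2_cube Hmu (isT : (1 <= 1)%N) ler01 iid.
  have vE : vball R 1 = 2 by rewrite -(ball_volume_vball Hmu)// ball_volume1.
  rewrite subrr mul0r divr1 vE (omega1 Hmu) (_ : 1 + 1 = 2)// Gamma2.
  (* With v_1 = 2 and omega_1 = 3 the constant is 1/2 - 1/9. *)
  have -> : 1 * (2 `^ (-1) - 2^-1 * 2 * 3 `^ (-1 - 1)) = 7 / 18 :> R.
    by rewrite (_ : - 1 - 1 = - 2%:R); [rewrite !powRN powRr1// powR_mulrn//; field|ring].
  rewrite (_ : (fun n w => _ * _) = fun n w => NN_weight 1 (sample U n w)); first exact.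
  by apply/funext => n; apply/funext => w; rewrite powRr0 mul1r.
Qed.
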